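(* Let $n\ge 2$, and let $f=(f_1,\ldots,f_n)\in\mathscr{H}_a(\mathbf{B}^n,\mathbb{R}^n)$ be a $K$-quasiregular mapping such that $\sup_{x\in\mathbf{B}^n}\{a(x)\}<\infty$. Suppose there exists some $j\in\{1,\ldots,n\}$ for which: (1) $f_j\Delta f_j\ge 0$, and (2) $\Delta f_j^2$ is quasi-nearly subharmonic in $\mathbf{B}^n$. If $f_j\in\mathbb{H}^p(\mathbf{B}^n,\mathbb{R})$ for some $p>p_0=1$, then $f\in\mathbb{H}^p(\mathbf{B}^n,\mathbb{R}^n)$. Moreover, the constant $p_0=1$ is sharp.
   Context: $\mathbf{B}^n$ is the open unit ball of $\mathbb{R}^n$, $\mathbf{B}^n(x,r)$ the open ball of radius $r$ with center $x$, $\mathbf{S}^{n-1}$ the boundary of $\mathbf{B}^n$, $d\sigma$ the normalized Lebesgue surface measure on $\mathbf{S}^{n-1}$, $\Delta=\sum_j\partial^2/\partial x_j^2$ the Laplacian, $\nabla$ the gradient, and $|\cdot|$ the Euclidean norm. Hardy type space: for $p\in(0,\infty)$, $m\ge1$, $\mathbb{H}^p(\mathbf{B}^n,\mathbb{R}^m)$ is the set of measurable $f:\mathbf{B}^n\to\mathbb{R}^m$ such that $M_p(r,f)=\left(\int_{\mathbf{S}^{n-1}}|f(r\zeta)|^p\,d\sigma(\zeta)\right)^{1/p}$ exists for all $r\in[0,1)$ and $\|f\|_p=\sup_{0<r<1}M_p(r,f)<\infty$. Quasiregular: a continuous $f:\Omega\subset\mathbb{R}^n\to\mathbb{R}^n$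 is $K$-quasiregular ($K\ge1$ a constant) if $f\in W^1_{n,\mathrm{loc}}(\Omega)$ (the distributional first partial derivatives of the coordinates of $f$ are locally in $L^n(\Omega)$) and $|f'(x)|^n\le K J_f(x)$ for almost every $x\in\Omega$, where $|f'(x)|$ is the operator norm of the derivative and $J_f$ is the Jacobian of $f$. Quasi-nearly subharmonic: a non-negative locally integrable function $\psi$ on a domain $\Omega\subset\mathbb{R}^n$ is quasi-nearly subharmonic if there is a positive constant $C=C(n,\Omega)$ such that $\psi(x)\le\frac{C}{r^n}\int_{\mathbf{B}^n(x,r)}\psi(y)\,dV_N(y)$ for every ball $\mathbf{B}^n(x,r)\subset\Omega$, where $dV_N$ is the normalized Lebesgue volume measure. The class $\mathscr{H}_a(\mathbf{B}^n,\mathbb{R}^m)$, where $a$ is a real-valued nonnegative continuous function in $\mathbf{B}^n$: the set of all $f=(f_1,\ldots,f_m)\in C^2(\mathbf{B}^n)$ (with values in $\mathbb{R}^m$) satisfying $0\le\sum_{j=1}^m f_j(x)\Delta f_j(x)\le a(x)\sum_{j=1}^m|\nabla f_j(x)|^2$ for all $x\in\mathbf{B}^n$. *)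

(* Defs.v *)
From HB Require Import structures.
From mathcomp Require Import all_boot all_order all_algebra.
From mathcomp Require Import all_classical all_reals all_analysis.
From mathcomp Require Import measurable_realfun.

Set Implicit Arguments.
Unset Strict Implicit.
Unset Printing Implicit Defensive.

Import Order.TTheory GRing.Theory Num.Theory.
Import numFieldNormedType.Exports.

Local Open Scope classical_set_scope.
Local Open Scope ring_scope.

(* Points of R^n are row vectors.  The library norm `|x| on 'rV[R]_n is the sup
   norm, so the Euclidean norm is introduced separately; both induce the same
   topology, so the library's continuity, compactness and derivatives apply. *)

Section euclidean.
Context {R : realType}.

Definition enorm n (x : 'rV[R]_n) : R := Num.sqrt (\sum_i x ord0 i ^+ 2).

Definition eball n (x : 'rV[R]_n) (r : R) : set 'rV[R]_n :=
  [set y | enorm (y - x) < r].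

Definition unit_ball n : set 'rV[R]_n := eball 0 1.

Definition unit_sphere n : set 'rV[R]_n := [set x | enorm x = 1].

(* Operator norm of v |-> v *m M for the Euclidean norm. *)
Definition opnorm n m (M : 'M[R]_(n, m)) : R :=
  sup [set enorm (v *m M) | v in [set v : 'rV[R]_n | enorm v <= 1]].

Definition component n m (f : 'rV[R]_n -> 'rV[R]_m) (j : 'I_m) :
  'rV[R]_n -> R := fun x => f x ord0 j.

End euclidean.
Arguments unit_ball {R} n.
Arguments unit_sphere {R} n.

Section calculus.
Context {R : realType} {n : nat}.
Implicit Types (U : set 'rV[R]_n) (g : 'rV[R]_n -> R).

Definition partial (k : 'I_n) g : 'rV[R]_n -> R :=
  fun x => 'D_(delta_mx ord0 k) g x.

(* Class C^d on U, meant for open U. *)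
Fixpoint Cd (d : nat) U g : Prop :=
  {within U, continuous g} /\
  match d with
  | 0 => True
  | d'.+1 => forall k : 'I_n,
      (forall x, U x -> derivable g x (delta_mx ord0 k)) /\
      Cd d' U (partial k g)
  end.

Definition gradient g (x : 'rV[R]_n) : 'rV[R]_n := \row_k partial k g x.

Definition laplacian g (x : 'rV[R]_n) : R :=
  \sum_k partial k (partial k g) x.

(* Smooth functions with compact support in U. *)
Definition test_function U (phi : 'rV[R]_n -> R) : Prop :=
  (forall d, Cd d setT phi) /\
  exists A : set 'rV[R]_n,
    [/\ compact A, A `<=` U & forall x, ~ A x -> phi x = 0].

End calculus.

(* The sigma-algebra of 'rV[R]_n generated by the coordinates, that is, the
   Borel sigma-algebra. *)

Definition rV_display : measure_display. Proof. exact. Qed.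

Section measurable_rV.
Context {R : realType} (n : nat).

Definition rV_coord (i : 'I_n) (x : 'rV[R]_n) : measurableTypeR R := x ord0 i.

Let rV_set0 : g_sigma_preimage rV_coord set0.
Proof. exact: sigma_algebra0. Qed.

Let rV_setC A : g_sigma_preimage rV_coord A -> g_sigma_preimage rV_coord (~` A).
Proof. exact: sigma_algebraC. Qed.

Let rV_bigcup (F : _^nat) : (forall i, g_sigma_preimage rV_coord (F i)) ->
  g_sigma_preimage rV_coord (\bigcup_i (F i)).
Proof. exact: sigma_algebra_bigcup. Qed.

HB.instance Definition _ := @isMeasurable.Build rV_display
  'rV[R]_n (g_sigma_preimage rV_coord) rV_set0 rV_setC rV_bigcup.

End measurable_rV.

Section measurable_rV_lemmas.
Context {R : realType}.

Lemma measurable_rV_coord n (i : 'I_n) :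
  measurable_fun [set: 'rV[R]_n] (rV_coord i).
Proof.
move=> _ Y mY; rewrite setTI; apply: sub_sigma_algebra => /=.
rewrite -bigcup_seq/=; exists i => /=; first by rewrite mem_index_enum.
by exists Y => //; rewrite setTI.
Qed.

Lemma measurable_fun_rVP d (T : measurableType d) n (f : T -> 'rV[R]_n) :
  (forall i, measurable_fun [set: T] (rV_coord i \o f)) ->
  measurable_fun [set: T] f.
Proof.
move=> mf.
suff H : g_sigma_preimage (fun i => rV_coord i \o f) `<=` measurable.
  move: H; rewrite g_sigma_preimage_comp => H _ A mA.
  by apply: H; exists A.
apply: smallest_sub; first exact: sigma_algebra_measurable.
case: n => [|n] in f mf *; first by rewrite big_ord0.
rewrite -bigcup_mkord_ord; apply: bigcup_sub => i Ii.
by move=> A [B mB <-]; exact: mf.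
Qed.

Lemma measurable_enorm n : measurable_fun [set: 'rV[R]_n] (@enorm R n).
Proof.
have mS : measurable_fun [set: 'rV[R]_n]
    (fun x : 'rV[R]_n => \sum_i x ord0 i ^+ 2).
  apply: measurable_sum => i; apply: measurable_funX.
  exact: measurable_rV_coord.
have -> : @enorm R n = fun x : 'rV[R]_n => (\sum_i x ord0 i ^+ 2) `^ 2^-1.
  apply/funext => x; rewrite powR12_sqrt// sumr_ge0// => i _.
  exact: sqr_ge0.
exact: (measurableT_comp (measurable_powR _)).
Qed.

Lemma measurable_unit_ball n : measurable (@unit_ball R n).
Proof.
rewrite -[unit_ball n]setTI.
have -> : unit_ball n = @enorm R n @^-1` `]-oo, 1[%classic.
  by apply/seteqP; split=> x /=; rewrite /unit_ball/eball/= subr0 in_itv.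
exact: measurable_enorm.
Qed.

Definition radial n (x : 'rV[R]_n) : 'rV[R]_n := (enorm x)^-1 *: x.

Lemma measurable_radial n : measurable_fun [set: 'rV[R]_n] (@radial n).
Proof.
apply: measurable_fun_rVP => i.
have -> : rV_coord i \o @radial n =
    fun x => (enorm x `^ (-1)) * rV_coord i x :> measurableTypeR R.
  apply/funext => x; rewrite /radial /rV_coord/= mxE; congr (_ * _).
  by rewrite powR_inv1// sqrtr_ge0.
apply: measurable_funM; last exact: measurable_rV_coord.
exact: (measurableT_comp (measurable_powR _) (@measurable_enorm n)).
Qed.

End measurable_rV_lemmas.

(* Lebesgue measure on R^n, as the iterated product of the one-dimensional
   Lebesgue measure through R * R^n = R^n.+1. *)

Section lebesgue_rV.
Context {R : realType}.

Definition cons_rV n (p : measurableTypeR R * 'rV[R]_n) : 'rV[R]_n.+1 :=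
  \row_i (if unlift ord0 i is Some j then p.2 ord0 j else p.1).

Let behead_rV n (x : 'rV[R]_n.+1) : measurableTypeR R * 'rV[R]_n :=
  (x ord0 ord0, \row_j x ord0 (lift ord0 j)).

Lemma measurable_cons_rV n : measurable_fun setT (@cons_rV n).
Proof.
apply: measurable_fun_rVP => i.
case: (unliftP ord0 i) => [j ->|->].
  have -> : rV_coord (lift ord0 j) \o @cons_rV n = rV_coord j \o snd.
    by apply/funext => x; rewrite /rV_coord/= mxE liftK.
  apply: measurableT_comp => //; exact: measurable_rV_coord.
have -> : rV_coord ord0 \o @cons_rV n = fst.
  by apply/funext => x; rewrite /rV_coord/= mxE unlift_none.
exact: measurable_fst.
Qed.

Let measurable_behead_rV n : measurable_fun setT (@behead_rV n).
Proof.
apply: measurable_fun_pair; first exact: measurable_rV_coord.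
apply: measurable_fun_rVP => i.
have -> : rV_coord i \o (fun x : 'rV[R]_n.+1 => \row_j x ord0 (lift ord0 j)) =
    rV_coord (lift ord0 i).
  by apply/funext => x; rewrite /rV_coord/= mxE.
exact: measurable_rV_coord.
Qed.

Let cons_rVK n : cancel (@cons_rV n) (@behead_rV n).
Proof.
move=> [x v]; rewrite /behead_rV mxE unlift_none; congr pair.
by apply/rowP => j; rewrite !mxE liftK.
Qed.

Section step.
Context (n : nat) (mu : {sigma_finite_measure set 'rV[R]_n -> \bar R}).

Definition lebesgue_rV_step : set 'rV[R]_n.+1 -> \bar R :=
  pushforward (@lebesgue_measure R \x mu)%E (@cons_rV n).

Let mcons := @measurable_cons_rV n.

Let step0 : lebesgue_rV_step set0 = 0%E.
Proof. by rewrite /lebesgue_rV_step (measure0 (pushforward _ _)). Qed.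

Let step_ge0 A : (0 <= lebesgue_rV_step A)%E.
Proof. exact: measure_ge0. Qed.

Let step_sigma_additive : semi_sigma_additive lebesgue_rV_step.
Proof. exact: measure_semi_sigma_additive. Qed.

HB.instance Definition _ := isMeasure.Build _ _ _ lebesgue_rV_step
  step0 step_ge0 step_sigma_additive.

Let step_sigma_finite : sigma_finite setT lebesgue_rV_step.
Proof.
have /sigma_finiteP[F [TF ndF Foo]] := sigma_finiteT (@lebesgue_measure R).
have /sigma_finiteP[G [TG ndG Goo]] := sigma_finiteT mu.
exists (fun k => @behead_rV n @^-1` (F k `*` G k)).
  rewrite -preimage_bigcup -[LHS](preimage_setT (@behead_rV n)).
  congr (_ @^-1` _); rewrite -setXTT TF TG predeqE => -[x y]; split.
    move=> [/= [i _ Fix] [j _ Gjy]]; exists (maxn i j) => //; split.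
    - by move: x Fix; exact/subsetPset/ndF/leq_maxl.
    - by move: y Gjy; exact/subsetPset/ndG/leq_maxr.
  by move=> [i _ []/= ? ?]; split; exists i.
move=> k; have [mF Fk] := Foo k; have [mG Gk] := Goo k; split.
  rewrite -[X in measurable X]setTI; apply: measurable_behead_rV => //.
  exact: measurableX.
rewrite /lebesgue_rV_step /pushforward -comp_preimage.
have -> : @behead_rV n \o @cons_rV n = idfun.
  by apply/funext => x /=; exact: cons_rVK.
by rewrite preimage_id product_measure1E// lte_mul_pinfty// ge0_fin_numE.
Qed.

HB.instance Definition _ := Measure_isSigmaFinite.Build _ _ _ lebesgue_rV_step
  step_sigma_finite.

End step.

Fixpoint lebesgue_rV (n : nat) : {sigma_finite_measure set 'rV[R]_n -> \bar R} :=
  match n with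
  | 0 => \d_(0 : 'rV[R]_0)
  | n'.+1 => lebesgue_rV_step (lebesgue_rV n')
  end.

End lebesgue_rV.
Arguments lebesgue_rV {R} n.

Section normalized_measures.
Context {R : realType} (n : nat).

Let inv_vol_ge0 : 0 <= (fine (lebesgue_rV n (@unit_ball R n)))^-1.
Proof. by rewrite invr_ge0 fine_ge0. Qed.

(* Lebesgue volume normalized so that the unit ball has measure 1. *)
Definition normalized_volume : set 'rV[R]_n -> \bar R :=
  mscale (NngNum inv_vol_ge0) (lebesgue_rV n).

HB.instance Definition _ := Measure.on normalized_volume.

(* Normalized surface measure of the unit sphere (extended by 0 to R^n): the
   measure of A is the normalized volume of the cone {x in B : x / |x| in A}. *)
Definition sphere_measure : set 'rV[R]_n -> \bar R :=
  pushforward (mrestr normalized_volume (@measurable_unit_ball R n))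
    (@radial R n).

Let mradial := @measurable_radial R n.

Let sphere_measure0 : sphere_measure set0 = 0%E.
Proof. by rewrite /sphere_measure (measure0 (pushforward _ _)). Qed.

Let sphere_measure_ge0 A : (0 <= sphere_measure A)%E.
Proof. exact: measure_ge0. Qed.

Let sphere_measure_sigma_additive : semi_sigma_additive sphere_measure.
Proof. exact: measure_semi_sigma_additive. Qed.

HB.instance Definition _ := isMeasure.Build _ _ _ sphere_measure
  sphere_measure0 sphere_measure_ge0 sphere_measure_sigma_additive.

End normalized_measures.
Arguments normalized_volume {R} n.
Arguments sphere_measure {R} n.

Section function_classes.
Context {R : realType} {n : nat}.
Implicit Types (U : set 'rV[R]_n) (g h psi : 'rV[R]_n -> R).

(* Integral mean over the sphere of radius r. *)
Definition Mp m (p r : R) (f : 'rV[R]_n -> 'rV[R]_m) : \bar R :=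
  poweR (\int[sphere_measure n]_(z in unit_sphere n)
           ((enorm (f (r *: z))) `^ p)%:E) p^-1.

Definition hardy m (p : R) (f : 'rV[R]_n -> 'rV[R]_m) : Prop :=
  [/\ measurable_fun (unit_ball n) f,
      forall r : R, 0 <= r < 1 ->
        (sphere_measure n).-integrable (unit_sphere n)
          (fun z => ((enorm (f (r *: z))) `^ p)%:E) &
      (ereal_sup [set Mp p r f | r in [set r : R | (0 < r < 1)%R]] < +oo)%E].

Definition locally_Lp (p : R) U g : Prop :=
  measurable_fun U g /\
  forall A, compact A -> A `<=` U ->
    (\int[lebesgue_rV n]_(x in A) (`|g x| `^ p)%:E < +oo)%E.

(* h is the k-th distributional partial derivative of g on U. *)
Definition weak_partial U (k : 'I_n) g h : Prop :=
  [/\ locally_Lp 1 U g, locally_Lp 1 U h &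
      forall phi, test_function U phi ->
        (\int[lebesgue_rV n]_(x in U) (g x * partial k phi x)%:E =
         - \int[lebesgue_rV n]_(x in U) (h x * phi x)%:E)%E].

(* The derivative f'(x) of a Sobolev map is the matrix of its distributional
   first partial derivatives; with row vectors, entry (k, i) of D x is the
   k-th partial derivative of the i-th component, and f'(x) v is v *m D x. *)
Definition quasiregular (K : R) U (f : 'rV[R]_n -> 'rV[R]_n) : Prop :=
  [/\ 1 <= K, {within U, continuous f} &
      exists D : 'rV[R]_n -> 'M[R]_n,
        [/\ forall k i, weak_partial U k (component f i) (fun x => D x k i),
            forall k i, locally_Lp n%:R U (fun x => D x k i) &
            {ae lebesgue_rV n, forall x, U x ->
               opnorm (D x) ^+ n <= K * \det (D x)}]].

Definition quasi_nearly_subharmonic U psi : Prop :=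
  [/\ forall x, U x -> 0 <= psi x,
      locally_Lp 1 U psi &
      exists2 C : R, 0 < C &
        forall (x : 'rV[R]_n) (r : R), 0 < r -> eball x r `<=` U ->
          ((psi x)%:E <=
           (C / r ^+ n)%:E *
           \int[normalized_volume n]_(y in eball x r) (psi y)%:E)%E].

(* The class H_a, together with the standing assumptions on the weight a. *)
Definition class_Ha m (a : 'rV[R]_n -> R) (f : 'rV[R]_n -> 'rV[R]_m) : Prop :=
  [/\ {within unit_ball n, continuous a},
      forall x, unit_ball n x -> 0 <= a x,
      forall j, Cd 2 (unit_ball n) (component f j) &
      forall x, unit_ball n x ->
        0 <= \sum_j component f j x * laplacian (component f j) x <=
        a x * \sum_j enorm (gradient (component f j) x) ^+ 2].

Definition scalar_map g : 'rV[R]_n -> 'rV[R]_1 := fun x => (g x)%:M.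

(* The last condition is on the Laplacian of the square of f_j. *)
Definition riesz_setting (K : R) (a : 'rV[R]_n -> R)
    (f : 'rV[R]_n -> 'rV[R]_n) (j : 'I_n) : Prop :=
  [/\ class_Ha a f,
      quasiregular K (unit_ball n) f,
      (ereal_sup [set (a x)%:E | x in unit_ball n] < +oo)%E,
      forall x, unit_ball n x ->
        0 <= component f j x * laplacian (component f j) x &
      quasi_nearly_subharmonic (unit_ball n)
        (laplacian (fun x => component f j x ^+ 2))].

End function_classes.

(* Main.v *)
Require Import Defs.
From mathcomp Require Import all_boot all_order all_algebra.
From mathcomp Require Import all_classical all_reals all_analysis.
From mathcomp Require Import measurable_realfun ring lra perm.

(** Put [F i] for the components of [f], [W = 1 + |f|^2] and [S = 1 + F j ^+ 2].
    Quasiregularity bounds every partial derivative of every component by a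
    constant times [|grad (F j)|]; hence, for [b = p / 2 > 1/2] and suitable
    constants, [W^b - C1 W^(b-1) S - C2 S^b] is superharmonic.  Comparing its
    mean on the sphere of radius [r] with its value at [0] and absorbing
    [W^(b-1) S] by Young's inequality bounds the mean of [W^b >= |f|^p] by that
    of [S^b <= 2^b (1 + |F j|^p)], uniformly in [r].  The condition [p > 1] is
    what makes [S^b] strictly subharmonic where [grad (F j)] does not vanish.

    For sharpness take the gradient of the Newtonian kernel with pole [e] on the
    sphere, with its first component reversed:
    [f x = (- w_0, w_1, ..) / |w|^n] for [w = x - e].  It is harmonic and
    quasiregular; its first component is positive and harmonic, hence lies in
    the Hardy space of exponent 1, whereas [|f x| = |x - e|^(1-n)] has unbounded
    means, [|y|^(1-n)] being non-integrable near [0] in dimension [n - 1]. *)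

(** The sphere carries the measure induced by cones in the ball, so the mean value inequality is
    proved for balls first and then carried over by thin shells, on which a function is close to its
    radial projection.

    The summand 1 keeps [W] and [S] positive, so that all real powers are smooth even where [f]
    vanishes; for [p < 2] the exponents [b - 1] and [b - 2] are negative.

    [W^b] alone is not superharmonic: its Laplacian is only bounded in size, by a multiple of
    [W^(b-1) |grad (F j)|^2]. The term [W^(b-1) S] is chosen because the Laplacian of its factor [S]
    produces exactly this quantity, while the term itself is smaller than [W^b] by the factor
    [S / W], which is what allows its mean to be absorbed.

    Quasiregularity speaks of weak derivatives almost everywhere. The du Bois-Reymond lemma
    identifies them with the classical ones, and continuity then turns the resulting inequality into
    one at every point. *)

Set Implicit Arguments.
Unset Strict Implicit.
Unset Printing Implicit Defensive.

Import Order.TTheory GRing.Theory Num.Theory.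
Import numFieldNormedType.Exports.

Local Open Scope classical_set_scope.
Local Open Scope ring_scope.

(** * Functions of class C^d *)

Section chain_rules.
Context {R : realType}.

(** Restriction to a line, which brings every directional derivative under the one-variable chain
    rule. *)
Lemma is_derive_line (V : normedModType R) (g : V -> R) (x v : V) (d : R) :
  is_derive x v g d <-> is_derive (0 : R) 1 (fun t : R => g (t *: v + x)) d.
Proof.
have E : 'D_1 (fun t : R => g (t *: v + x)) 0 = 'D_v g x.
  rewrite /derive; set g1 := fun h => h^-1 *: _; set g2 := fun h => h^-1 *: _.
  suff -> : g1 = g2 by [].
  rewrite funeqE /g1 /g2 => h /=.
  by rewrite addr0 scale0r add0r [_%:A]mulr1.
have D := derivable1P g x v.
split=> [[gv <-]|[gv <-]].
  by rewrite -E; apply: derivableP; apply D.1.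
by rewrite E; apply: derivableP; apply D.2.
Qed.

Lemma is_derive_compR (V : normedModType R) (phi : R -> R) (g : V -> R)
    (x v : V) (a d : R) :
  is_derive (g x) 1 phi a -> is_derive x v g d ->
  is_derive x v (phi \o g) (a * d).
Proof.
move=> ha /is_derive_line hd; apply/is_derive_line.
set G := (fun t : R => g (t *: v + x)) in hd.
have G0 : G 0 = g x by rewrite /G scale0r add0r.
rewrite -G0 in ha.
exact: (@is_derive1_comp _ phi G 0 a d ha hd).
Qed.

Lemma is_deriveMR (V : normedModType R) (g h : V -> R) (x v : V) (a b : R) :
  is_derive x v g a -> is_derive x v h b ->
  is_derive x v (fun y => g y * h y) (g x * b + h x * a).
Proof. by move=> ha hb; exact: is_deriveM. Qed.

End chain_rules.

Section Cd_calculus.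
Context {R : realType} {n : nat}.
Variable U : set 'rV[R]_n.
Hypothesis oU : open U.
Implicit Types (g h : 'rV[R]_n -> R) (x : 'rV[R]_n) (k : 'I_n) (d : nat).

Lemma near_open x (P : 'rV[R]_n -> Prop) :
  U x -> (forall y, U y -> P y) -> \forall y \near x, P y.
Proof.
move=> Ux UP; have UN : nbhs x U by exact: open_nbhs_nbhs.
exact: filterS UN.
Qed.

Lemma within_contP g :
  {within U, continuous g} <-> (forall x, U x -> {for x, continuous g}).
Proof.
have E := continuous_open_subspace g oU; split.
  by rewrite E => H x Ux; apply: H; rewrite inE.
by move=> H; rewrite E => x; rewrite inE; exact: H.
Qed.

Lemma near_eq_open x g h :
  U x -> (forall y, U y -> g y = h y) -> {near x, g =1 h}.
Proof. by move=> Ux gh; exact: near_open. Qed.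

Lemma eq_continuous_at x g h : U x -> (forall y, U y -> g y = h y) ->
  {for x, continuous g} -> {for x, continuous h}.
Proof.
move=> Ux gh; rewrite /prop_for /continuous_at gh// => cg.
exact: cvg_trans (near_eq_cvg (near_eq_open Ux gh)) cg.
Qed.

Lemma Cd_continuous d g x : Cd d U g -> U x -> {for x, continuous g}.
Proof. by case: d => [|d] /= [/within_contP cg _]; exact: cg. Qed.

Lemma CdS_derive d g k x :
  Cd d.+1 U g -> U x -> is_derive x (delta_mx ord0 k) g (partial k g x).
Proof. by move=> [_ /(_ k)[dg _]] Ux; apply: derivableP; exact: dg. Qed.

Lemma CdS_partial d g k : Cd d.+1 U g -> Cd d U (partial k g).
Proof. by move=> [_ /(_ k)[]]. Qed.

Lemma CdW d g : Cd d.+1 U g -> Cd d U g.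
Proof.
elim: d g => [|d IH] g [cg dg]; split => // k.
by have [dgk Cdg] := dg k; split => //; exact: IH.
Qed.

Lemma partial_eq g h k x :
  (forall y, U y -> g y = h y) -> U x -> partial k g x = partial k h x.
Proof. by move=> gh Ux; apply: near_eq_derive; exact: near_eq_open. Qed.

(** As [U] is open, derivatives at its points only see values on [U]; formulas valid on [U] alone
    may therefore replace a function, as in [CdS_intro]. *)
Lemma eq_Cd d g h : (forall y, U y -> g y = h y) -> Cd d U g -> Cd d U h.
Proof.
have W g' h' : (forall y, U y -> g' y = h' y) -> {within U, continuous g'} ->
    {within U, continuous h'}.
  move=> gh /within_contP cg; apply/within_contP => x Ux.
  exact: eq_continuous_at gh (cg _ Ux).
elim: d g h => [|d IH] g h gh [cg dg].
  by split => //; exact: W cg.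
split; first exact: W cg.
move=> k; have [dgk Cdg] := dg k; split.
  by move=> x Ux; apply: near_eq_derivable (dgk _ Ux); exact: near_eq_open.
by apply: IH Cdg => y Uy; exact: partial_eq.
Qed.

Lemma partial_is_derive g k x (a : R) :
  is_derive x (delta_mx ord0 k) g a -> partial k g x = a.
Proof. by case. Qed.

Lemma CdS_intro d g (G : 'I_n -> 'rV[R]_n -> R) :
  (forall x, U x -> {for x, continuous g}) ->
  (forall k x, U x -> is_derive x (delta_mx ord0 k) g (G k x)) ->
  (forall k, Cd d U (G k)) -> Cd d.+1 U g.
Proof.
move=> cg dg CG; split; first exact/within_contP.
move=> k; split; first by move=> x Ux; have [] := dg k x Ux.
by apply: eq_Cd (CG k) => y Uy; apply/esym/partial_is_derive/dg.
Qed.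

Lemma Cd_cst d (c : R) : Cd d U (fun=> c).
Proof.
elim: d c => [|d IH] c.
  by split => //; apply/within_contP => x _; exact: cst_continuous.
apply: (@CdS_intro _ _ (fun _ _ => 0)).
- by move=> x _; exact: cst_continuous.
- by move=> k /=; exact: (IH 0).
Qed.

Lemma CdD d g h : Cd d U g -> Cd d U h -> Cd d U (fun x => g x + h x).
Proof.
elim: d g h => [|d IH] g h Cg Ch.
  split => //; apply/within_contP => x Ux.
  by apply: continuousD; [exact: Cd_continuous Cg Ux|exact: Cd_continuous Ch Ux].
apply: (@CdS_intro _ _ (fun k x => partial k g x + partial k h x)).
- move=> x Ux.
  by apply: continuousD; [exact: Cd_continuous Cg Ux|exact: Cd_continuous Ch Ux].
- move=> k x Ux.
  by apply: is_deriveD; [exact: CdS_derive Cg Ux|exact: CdS_derive Ch Ux].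
- by move=> k; apply: IH; exact: CdS_partial.
Qed.

Lemma CdM d g h : Cd d U g -> Cd d U h -> Cd d U (fun x => g x * h x).
Proof.
elim: d g h => [|d IH] g h Cg Ch.
  split => //; apply/within_contP => x Ux.
  by apply: continuousM; [exact: Cd_continuous Cg Ux|exact: Cd_continuous Ch Ux].
apply: (@CdS_intro _ _ (fun k x => g x * partial k h x + h x * partial k g x)).
- move=> x Ux.
  by apply: continuousM; [exact: Cd_continuous Cg Ux|exact: Cd_continuous Ch Ux].
- move=> k x Ux.
  by apply: is_deriveMR; [exact: CdS_derive Cg Ux|exact: CdS_derive Ch Ux].
- move=> k; apply: CdD; apply: IH; solve [exact: CdW|exact: CdS_partial].
Qed.

Lemma CdZ d c g : Cd d U g -> Cd d U (fun x => c * g x).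
Proof. by move=> Cg; apply: CdM => //; exact: Cd_cst. Qed.

Lemma CdN d g : Cd d U g -> Cd d U (fun x => - g x).
Proof.
move=> Cg; apply: eq_Cd (CdZ (-1) Cg) => x _; exact: mulN1r.
Qed.

Lemma CdB d g h : Cd d U g -> Cd d U h -> Cd d U (fun x => g x - h x).
Proof. by move=> Cg Ch; apply: CdD => //; exact: CdN. Qed.

Lemma CdX d g m : Cd d U g -> Cd d U (fun x => g x ^+ m).
Proof.
move=> Cg; elim: m => [|m IH].
  by under eq_fun do rewrite expr0; exact: Cd_cst.
by under eq_fun do rewrite exprS; exact: CdM.
Qed.

Lemma Cd_sum d (I : Type) (r : seq I) (P : pred I) (F : I -> 'rV[R]_n -> R) :
  (forall i, P i -> Cd d U (F i)) -> Cd d U (fun x => \sum_(i <- r | P i) F i x).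
Proof.
move=> CF; elim: r => [|i r IH].
  by under eq_fun do rewrite big_nil; exact: Cd_cst.
under eq_fun do rewrite big_cons.
by have [Pi|//] := boolP (P i); apply: CdD => //; exact: CF.
Qed.

Lemma Cd_prod d (I : Type) (r : seq I) (P : pred I) (F : I -> 'rV[R]_n -> R) :
  (forall i, P i -> Cd d U (F i)) -> Cd d U (fun x => \prod_(i <- r | P i) F i x).
Proof.
move=> CF; elim: r => [|i r IH].
  by under eq_fun do rewrite big_nil; exact: Cd_cst.
under eq_fun do rewrite big_cons.
by have [Pi|//] := boolP (P i); apply: CdM => //; exact: CF.
Qed.

Lemma is_derive_coord (i k : 'I_n) x :
  is_derive x (delta_mx ord0 k) (fun y : 'rV[R]_n => y ord0 i) (i == k)%:R.
Proof.
apply/is_derive_line.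
rewrite (_ : (fun _ => _) = fun t : R => t * (i == k)%:R + x ord0 i); last first.
  by apply/funext => t; rewrite !mxE eqxx.
have H : is_derive (0 : R) 1 (fun t : R => t) 1 by exact: is_derive_id.
have := is_deriveD (is_deriveMR H (is_derive_cst ((i == k)%:R : R) (0 : R) (1 : R)))
  (is_derive_cst (x ord0 i) (0 : R) (1 : R)).
by move=> /is_derive_eq; apply; rewrite mul0r add0r mulr1 addr0.
Qed.

Lemma Cd_coord d (i : 'I_n) : Cd d U (fun x => x ord0 i).
Proof.
have cc x : {for x, continuous (fun y : 'rV[R]_n => y ord0 i)}.
  exact: coord_continuous.
case: d => [|d]; first by split => //; apply/within_contP => x _; exact: cc.
apply: (@CdS_intro _ _ (fun k _ => (i == k)%:R)).
- by move=> x _; exact: cc.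
- by move=> k x _; exact: is_derive_coord.
- by move=> k; exact: Cd_cst.
Qed.

(** The whole sequence of iterated derivatives is carried along: differentiating [F m \o g] produces
    [F m.+1 \o g], so the induction on [d] runs for all [m] at once. *)
Lemma Cd_comp d (V : set R) (F : nat -> R -> R) g :
  (forall m z, V z -> is_derive z 1 (F m) (F m.+1 z)) ->
  (forall x, U x -> V (g x)) -> Cd d U g -> forall m, Cd d U (F m \o g).
Proof.
move=> dF UV; have cF m x : U x -> {for g x, continuous (F m)}.
  move=> Ux; have [dFx _] := dF m _ (UV _ Ux).
  by apply: differentiable_continuous; exact/derivable1_diffP.
elim: d => [|d IH] Cg m.
  split => //; apply/within_contP => x Ux.
  by apply: continuous_comp; [exact: Cd_continuous Cg Ux|exact: cF].
apply: (@CdS_intro _ _ (fun k x => F m.+1 (g x) * partial k g x)).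
- move=> x Ux.
  by apply: continuous_comp; [exact: Cd_continuous Cg Ux|exact: cF].
- move=> k x Ux; apply: is_derive_compR; first exact/dF/UV.
  exact: CdS_derive Cg Ux.
- move=> k; apply: CdM; last exact: CdS_partial.
  by apply: (IH _ m.+1); exact: CdW.
Qed.

Lemma Cd_powR d (a : R) g : (forall x, U x -> 0 < g x) -> Cd d U g ->
  Cd d U (fun x => g x `^ a).
Proof.
move=> g0 Cg.
pose F m (z : R) := (\prod_(i < m) (a - i%:R)) * z `^ (a - m%:R).
have dF (m : nat) (z : R) :
    [set y : R | 0 < y] z -> is_derive z 1 (F m) (F m.+1 z).
  move=> /= z0.
  have := is_derive1_powR (a - m%:R) z0.
  move=> /(is_deriveZ (\prod_(i < m) (a - i%:R))) H.
  apply: is_derive_eq H _.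
  by rewrite /F big_ord_recr/= -mulrA -[X in X *: _]/(_) -natr1 opprD addrA.
have := Cd_comp dF g0 Cg 0.
by congr Cd; apply/funext => x; rewrite /F/= big_ord0 mul1r subr0.
Qed.

End Cd_calculus.

(** * Sum, product and power rules for the Laplacian *)

Section laplacian_calculus.
Context {R : realType} {n : nat}.
Variable U : set 'rV[R]_n.
Hypothesis oU : open U.
Implicit Types (g h : 'rV[R]_n -> R) (x : 'rV[R]_n) (k : 'I_n).

Lemma partialD d g h k x : Cd d.+1 U g -> Cd d.+1 U h -> U x ->
  partial k (fun y => g y + h y) x = partial k g x + partial k h x.
Proof.
move=> Cg Ch Ux; apply: partial_is_derive.
by apply: is_deriveD; [exact: CdS_derive Cg Ux|exact: CdS_derive Ch Ux].
Qed.

Lemma partialM d g h k x : Cd d.+1 U g -> Cd d.+1 U h -> U x ->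
  partial k (fun y => g y * h y) x = g x * partial k h x + h x * partial k g x.
Proof.
move=> Cg Ch Ux; apply: partial_is_derive.
by apply: is_deriveMR; [exact: CdS_derive Cg Ux|exact: CdS_derive Ch Ux].
Qed.

Lemma partial_cst k x (c : R) : partial k (fun=> c) x = 0.
Proof. by apply: partial_is_derive; exact: is_derive_cst. Qed.

Lemma partialZ d c g k x : Cd d.+1 U g -> U x ->
  partial k (fun y => c * g y) x = c * partial k g x.
Proof.
move=> Cg Ux; rewrite (partialM _ (Cd_cst oU _ c) Cg Ux).
by rewrite partial_cst mulr0 addr0.
Qed.

Lemma partial_powR d (a : R) g k x :
  (forall x, U x -> 0 < g x) -> Cd d.+1 U g -> U x ->
  partial k (fun y => g y `^ a) x = a * g x `^ (a - 1) * partial k g x.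
Proof.
move=> g0 Cg Ux; apply: partial_is_derive.
have := is_derive_compR (is_derive1_powR a (g0 _ Ux)) (CdS_derive k Cg Ux).
exact.
Qed.

Lemma eq_laplacian g h x : (forall y, U y -> g y = h y) -> U x ->
  laplacian g x = laplacian h x.
Proof.
move=> gh Ux; apply: eq_bigr => k _.
by apply: (partial_eq oU) => // y Uy; exact: (partial_eq oU).
Qed.

Lemma laplacianD g h x : Cd 2 U g -> Cd 2 U h -> U x ->
  laplacian (fun y => g y + h y) x = laplacian g x + laplacian h x.
Proof.
move=> Cg Ch Ux; rewrite /laplacian -big_split; apply: eq_bigr => k _ /=.
rewrite (partial_eq oU k (h := fun y => partial k g y + partial k h y))//.
  by apply: (@partialD 0) => //; exact: CdS_partial.
by move=> y Uy; exact: (@partialD 1).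
Qed.

Definition graddot g h x : R := \sum_k partial k g x * partial k h x.

Lemma laplacianM g h x : Cd 2 U g -> Cd 2 U h -> U x ->
  laplacian (fun y => g y * h y) x =
  g x * laplacian h x + h x * laplacian g x + 2 * graddot g h x.
Proof.
move=> Cg Ch Ux; rewrite /laplacian /graddot !mulr_sumr -!big_split/=.
apply: eq_bigr => k _ /=.
have Cgk := CdS_partial k Cg; have Chk := CdS_partial k Ch.
have Cg1 := CdW Cg; have Ch1 := CdW Ch.
have E y : U y -> partial k (fun y => g y * h y) y =
    g y * partial k h y + h y * partial k g y.
  exact: (partialM k Cg Ch).
rewrite (partial_eq oU k E Ux).
have := partialD k (CdM oU Cg1 Chk) (CdM oU Ch1 Cgk) Ux.
have := partialM k Cg1 Chk Ux; have := partialM k Ch1 Cgk Ux.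
move=> -> -> ->; move: (g x) (h x) (partial k g x) (partial k h x).
move: (partial k (partial k g) x) (partial k (partial k h) x) => a b c d e f.
by ring.
Qed.

Lemma laplacian_cst x (c : R) : laplacian (fun=> c) x = 0.
Proof.
rewrite /laplacian big1// => k _.
have -> : partial k (fun=> c) = fun=> 0.
  by apply/funext => y; exact: partial_cst.
exact: partial_cst.
Qed.

Lemma laplacianZ c g x : Cd 2 U g -> U x ->
  laplacian (fun y => c * g y) x = c * laplacian g x.
Proof.
move=> Cg Ux; rewrite (laplacianM (Cd_cst oU 2 c) Cg Ux).
rewrite laplacian_cst mulr0 addr0 /graddot big1 ?mulr0 ?addr0// => k _.
by rewrite partial_cst mul0r.
Qed.

Lemma laplacian_powR (a : R) g x :
  (forall x, U x -> 0 < g x) -> Cd 2 U g -> U x ->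
  laplacian (fun y => g y `^ a) x =
  a * g x `^ (a - 1) * laplacian g x +
  a * (a - 1) * g x `^ (a - 2) * graddot g g x.
Proof.
move=> g0 Cg Ux; rewrite /laplacian /graddot !mulr_sumr -!big_split/=.
apply: eq_bigr => k _ /=.
have Cgk := CdS_partial k Cg; have Cg1 := CdW Cg.
have E y : U y -> partial k (fun y => g y `^ a) y =
    (a * g y `^ (a - 1)) * partial k g y.
  exact: (partial_powR a k g0 Cg).
rewrite (partial_eq oU k E Ux).
have Cp : Cd 1 U (fun y => g y `^ (a - 1)) by exact: Cd_powR.
have := partialM k (CdZ oU a Cp) Cgk Ux; have := partialZ a k Cp Ux.
have := partial_powR (a - 1) k g0 Cg1 Ux.
rewrite (_ : a - 1 - 1 = a - 2); last by ring.
move=> -> -> ->.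
move: (partial k (partial k g) x) (partial k g x) => b c.
move: (g x `^ (a - 1)) (g x `^ (a - 2)) => d e.
by ring.
Qed.

Lemma graddot_powRl d (a : R) g h x :
  (forall x, U x -> 0 < g x) -> Cd d.+1 U g -> U x ->
  graddot (fun y => g y `^ a) h x = a * g x `^ (a - 1) * graddot g h x.
Proof.
move=> g0 Cg Ux; rewrite /graddot mulr_sumr; apply: eq_bigr => k _.
by rewrite (@partial_powR d)// mulrA.
Qed.

Lemma graddot_gradient g x : graddot g g x = enorm (gradient g x) ^+ 2.
Proof.
rewrite /enorm sqr_sqrtr; last by apply: sumr_ge0 => k _; exact: sqr_ge0.
by apply: eq_bigr => k _; rewrite mxE expr2.
Qed.

End laplacian_calculus.

(** * Euclidean norm and Lebesgue measure *)

Section enorm_theory.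
Context {R : realType}.

Lemma enorm_ge0 n (x : 'rV[R]_n) : 0 <= enorm x.
Proof. exact: sqrtr_ge0. Qed.

Lemma enorm_sqr n (x : 'rV[R]_n) : enorm x ^+ 2 = \sum_i x ord0 i ^+ 2.
Proof. by rewrite sqr_sqrtr// sumr_ge0// => i _; exact: sqr_ge0. Qed.

Lemma enorm0 n : enorm (0 : 'rV[R]_n) = 0.
Proof. by rewrite /enorm big1 ?sqrtr0// => i _; rewrite mxE expr0n. Qed.

Lemma enormZ n (c : R) (x : 'rV[R]_n) : enorm (c *: x) = `|c| * enorm x.
Proof.
rewrite /enorm -sqrtr_sqr -sqrtrM ?sqr_ge0// mulr_sumr; congr Num.sqrt.
by apply: eq_bigr => i _; rewrite mxE exprMn.
Qed.

Lemma ler_coord_enorm n (x : 'rV[R]_n) i : `|x ord0 i| <= enorm x.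
Proof.
rewrite -sqrtr_sqr /enorm ler_wsqrtr// (bigD1 i)//= lerDl.
by apply: sumr_ge0 => j _; exact: sqr_ge0.
Qed.

Lemma enorm_le_sum n (x : 'rV[R]_n) : enorm x <= \sum_i `|x ord0 i|.
Proof.
have s0 : 0 <= \sum_i `|x ord0 i| by exact: sumr_ge0.
rewrite -(@ler_pXn2r _ 2)// ?nnegrE ?enorm_ge0// enorm_sqr expr2 mulr_suml.
apply: ler_sum => i _; rewrite -real_normK ?num_real// expr2.
apply: ler_wpM2l => //; rewrite (bigD1 i)//= lerDl; exact: sumr_ge0.
Qed.

Lemma enorm_eq0 n (x : 'rV[R]_n) : enorm x = 0 -> x = 0.
Proof.
move=> x0; apply/rowP => i; rewrite mxE; apply/normr0_eq0/eqP.
by rewrite eq_le normr_ge0 andbT -x0 ler_coord_enorm.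
Qed.

(** A triangle inequality with the crude factor [n], obtained by comparison with the sum of the
    coordinates; it serves only to compare distances to the pole in [qns_kelvin_map0]. *)
Lemma enorm_leD n (x y : 'rV[R]_n) :
  enorm (x + y) <= n%:R * (enorm x + enorm y).
Proof.
rewrite (le_trans (enorm_le_sum _))//.
have -> : n%:R * (enorm x + enorm y) = \sum_(i < n) (enorm x + enorm y).
  by rewrite sumr_const card_ord mulr_natl.
apply: ler_sum => i _; rewrite mxE (le_trans (ler_normD _ _))//.
by apply: lerD; exact: ler_coord_enorm.
Qed.

Lemma Cd_enorm2 n d (c : 'rV[R]_n) (U : set 'rV[R]_n) : open U ->
  Cd d U (fun x => enorm (x - c) ^+ 2).
Proof.
move=> oU.
apply: (eq_Cd oU (g := fun x => \sum_i (x ord0 i - c ord0 i) ^+ 2)).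
  by move=> x _; rewrite enorm_sqr; apply: eq_bigr => i _; rewrite !mxE.
apply: Cd_sum => // i _; apply: CdX => //; apply: CdB => //.
  exact: Cd_coord.
exact: Cd_cst.
Qed.

Lemma enorm_continuous n : continuous (@enorm R n).
Proof.
move=> x.
have -> : @enorm R n = Num.sqrt \o (fun y : 'rV[R]_n => enorm (y - 0) ^+ 2).
  by apply/funext => y /=; rewrite subr0 sqrtr_sqr ger0_norm// enorm_ge0.
apply: continuous_comp; last exact: sqrt_continuous.
exact: (Cd_continuous openT (Cd_enorm2 0 0 openT) I).
Qed.

Lemma open_unit_ball n : open (@unit_ball R n).
Proof.
have -> : @unit_ball R n = @enorm R n @^-1` [set t | t < 1].
  by apply/seteqP; split=> x /=; rewrite /unit_ball/eball/= subr0.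
apply: open_comp; last exact: open_lt.
by move=> x _; exact: enorm_continuous.
Qed.

Lemma unit_ballE n (x : 'rV[R]_n) : unit_ball n x = (enorm x < 1) :> Prop.
Proof. by rewrite /unit_ball/eball/= subr0. Qed.

End enorm_theory.

Section boxes.
Context {R : realType} {n : nat}.

Definition obox (a b : 'rV[R]_n) : set 'rV[R]_n :=
  [set x | forall i, a ord0 i < x ord0 i < b ord0 i].

Lemma measurable_obox a b : measurable (obox a b).
Proof.
have -> : obox a b = \bigcap_(i in [set: 'I_n])
    (rV_coord i @^-1` `]a ord0 i, b ord0 i[%classic).
  by apply/seteqP; split=> [x abx i _|x abx i];
    [rewrite /= in_itv/=; exact: abx|have := abx i I; rewrite /= in_itv].
apply: fin_bigcap_measurable => // i _.
rewrite -[X in measurable X]setTI; apply: measurable_rV_coord => //.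
Qed.

Definition cbox (a b : 'rV[R]_n) : set 'rV[R]_n :=
  [set x | forall i, a ord0 i <= x ord0 i <= b ord0 i].

Lemma obox_cbox a b : obox a b `<=` cbox a b.
Proof. by move=> x abx i; have /andP[? ?] := abx i; rewrite !ltW. Qed.

Lemma compact_cbox a b : compact (cbox a b).
Proof.
have -> : cbox a b =
    [set x : 'rV[R]_n | forall i, `[a ord0 i, b ord0 i]%classic (x ord0 i)].
  by apply/seteqP; split=> x abx i; have := abx i; rewrite /= in_itv.
apply: (@rV_compact R n (fun i => `[a ord0 i, b ord0 i]%classic)) => i.
exact: segment_compact.
Qed.

(** Countability makes open sets measurable for the coordinate sigma-algebra and reduces
    almost-everywhere statements to single boxes. The closed boxes are required to lie in [A] so
    that test functions living on a box have compact support in [A]. *)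
Lemma open_obox_rat (A : set 'rV[R]_n) : open A ->
  A = \bigcup_(p in [set p : 'rV[rat]_n * 'rV[rat]_n |
    cbox (map_mx ratr p.1) (map_mx ratr p.2) `<=` A])
    obox (map_mx ratr p.1) (map_mx ratr p.2).
Proof.
move=> oA; apply/seteqP; split; last first.
  by move=> x [p pA] /obox_cbox; exact: pA.
move=> x Ax.
have [e /= e0 eA] : exists2 e : R, 0 < e & ball x e `<=` A.
  by apply/nbhs_ballP; exact: open_nbhs_nbhs.
have Hp (i : 'I_n) : exists p : rat * rat,
    (x ord0 i - e < ratr p.1 < x ord0 i) && (x ord0 i < ratr p.2 < x ord0 i + e).
  have [|q] := @rat_in_itvoo R (x ord0 i - e) (x ord0 i); first by lra.
  rewrite in_itv/= => hq.
  have [|r] := @rat_in_itvoo R (x ord0 i) (x ord0 i + e); first by lra.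
  by rewrite in_itv/= => hr; exists (q, r); rewrite /= hq hr.
pose p i := sval (cid (Hp i)).
have pP i := svalP (cid (Hp i)).
exists (\row_i (p i).1, \row_i (p i).2) => /=.
  apply: subset_trans eA => y yp; split=> // i0 i; rewrite ord1 /ball/=.
  have := yp i; have := pP i; rewrite !mxE -/(p i).
  move=> /andP[/andP[? ?] /andP[? ?]] /andP[? ?].
  by rewrite ltr_norml; apply/andP; split; lra.
move=> i; have := pP i; rewrite !mxE -/(p i).
by move=> /andP[/andP[_ ->] /andP[-> _]].
Qed.

Lemma open_measurable_rV (A : set 'rV[R]_n) : open A -> measurable A.
Proof.
move=> oA; rewrite (open_obox_rat oA).
rewrite bigcup_mkcond; apply: countable_bigcupT_measurable => // p.
by case: ifP => // _; exact: measurable_obox.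
Qed.

Lemma closed_measurable_rV (A : set 'rV[R]_n) : closed A -> measurable A.
Proof.
move=> cA; rewrite -(setCK A); apply: measurableC.
by apply: open_measurable_rV; exact: closed_openC.
Qed.

Lemma continuous_measurable_rV (U : set 'rV[R]_n) (g : 'rV[R]_n -> R) :
  open U -> (forall x, U x -> {for x, continuous g}) -> measurable_fun U g.
Proof.
move=> oU cg; apply: (measurability _ (RGenOInfty.measurableE R)).
move=> _ [_ [a ->] <-]; apply: open_measurable_rV.
rewrite openE => x [Ux /=]; rewrite in_itv/= andbT => ax.
apply: filterI; first exact: open_nbhs_nbhs.
have ag : nbhs (g x) [set t | a < t] by exact: lt_nbhsr.
have N : nbhs x (g @^-1` [set t | a < t]) := cg x Ux _ ag.
apply: (@filterS _ _ (nbhs_filter x) _ _ _ N) => y /=.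
by rewrite in_itv/= andbT.
Qed.

Lemma measurable_fun_rV d (T : measurableType d) (D : set T)
    (f : T -> 'rV[R]_n) :
  (forall i, measurable_fun D (fun t => f t ord0 i)) -> measurable_fun D f.
Proof.
move=> mf mD; apply: (measurability (\big[setU/set0]_(i < n)
  preimage_set_system setT (@rV_coord R n i) measurable)) => //.
move=> _ [A + <-]; rewrite -bigcup_seq => -[/= i _ [B mB <-]].
rewrite setTI; exact: mf.
Qed.

End boxes.

(** * Fubini's theorem, boxes and affine changes of variables *)

Section lebesgue_rV_fubini.
Context {R : realType}.
Local Notation mu := (@lebesgue_measure R).
Local Notation leb n := (@lebesgue_rV R n).
Local Open Scope ereal_scope.

Lemma measurable_cons_rVl n (t : R) :
  measurable_fun setT (fun y : 'rV[R]_n => cons_rV (t, y)).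
Proof.
apply: (measurableT_comp (@measurable_cons_rV R n)).
exact: measurable_pair1.
Qed.

Lemma ge0_integral_rVS n (F : 'rV[R]_n.+1 -> \bar R) :
  measurable_fun setT F -> (forall x, 0 <= F x) ->
  \int[leb n.+1]_x F x = \int[mu]_t \int[leb n]_y F (cons_rV (t, y)).
Proof.
move=> mF F0.
have -> : \int[leb n.+1]_x F x =
    \int[pushforward (mu \x leb n) (@cons_rV R n)]_x F x by [].
rewrite (ge0_integral_pushforward (@measurable_cons_rV R n))//.
rewrite preimage_setT fubini_tonelli1//; last by move=> z; exact: F0.
exact: measurableT_comp (@measurable_cons_rV R n).
Qed.

(** Both orders are kept because [integral_partial_eq0] takes as inner integral the one that
    contains the differentiated coordinate. *)
Lemma integral_rVS n (F : 'rV[R]_n.+1 -> \bar R) :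
  (leb n.+1).-integrable setT F ->
  \int[leb n.+1]_x F x = \int[mu]_t \int[leb n]_y F (cons_rV (t, y)) /\
  \int[leb n.+1]_x F x = \int[leb n]_y \int[mu]_t F (cons_rV (t, y)).
Proof.
move=> iF.
have mF := measurable_int _ iF.
have iFc : (mu \x leb n).-integrable setT (F \o @cons_rV R n).
  move/integrableP: (iF) => [_ Foo]; apply/integrableP; split.
    exact: measurableT_comp (@measurable_cons_rV R n).
  move: Foo.
  have -> : \int[leb n.+1]_x `|F x| =
    \int[pushforward (mu \x leb n) (@cons_rV R n)]_x `|F x| by [].
  rewrite (ge0_integral_pushforward (@measurable_cons_rV R n))//.
  exact: measurableT_comp.
have E : \int[leb n.+1]_x F x = \int[mu \x leb n]_z (F \o @cons_rV R n) z.
  have -> : \int[leb n.+1]_x F x =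
    \int[pushforward (mu \x leb n) (@cons_rV R n)]_x F x by [].
  by rewrite (integral_pushforward (@measurable_cons_rV R n)).
by split; rewrite E; apply/esym;
  [exact: integral12_prod_meas1|exact: integral21_prod_meas1].
Qed.

Lemma lebesgue_rV_obox n (a b : 'rV[R]_n) :
  (forall i, (a ord0 i < b ord0 i)%R) ->
  leb n (obox a b) = (\prod_i (b ord0 i - a ord0 i))%:E.
Proof.
elim: n a b => [|n IH] a b ab.
  rewrite big_ord0 /= diracE mem_set// => -[]//.
have -> : leb n.+1 (obox a b) = (mu \x leb n) (@cons_rV R n @^-1` obox a b) by [].
have -> : @cons_rV R n @^-1` obox a b =
    `]a ord0 ord0, b ord0 ord0[%classic `*`
    obox (\row_j a ord0 (lift ord0 j)) (\row_j b ord0 (lift ord0 j)).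
  apply/seteqP; split=> [[t y] /= H|[t y] /= [H1 H2] i].
    split; first by have := H ord0; rewrite mxE unlift_none in_itv.
    by move=> j; have := H (lift ord0 j); rewrite !mxE liftK.
  rewrite mxE; case: (unliftP ord0 i) => [j ->|->].
    by have := H2 j; rewrite !mxE.
  by move: H1; rewrite in_itv.
rewrite product_measure1E//; last exact: measurable_obox.
rewrite IH; last by move=> i; rewrite !mxE.
rewrite [X in X * _ = _](_ : _ = (b ord0 ord0 - a ord0 ord0)%:E); last first.
  have := @lebesgue_measure_itv R `]a ord0 ord0, b ord0 ord0[.
  by rewrite /= lte_fin ab.
rewrite -EFinM big_ord_recl.
by congr (_ * _)%:E; apply: eq_bigr => i _; rewrite !mxE.
Qed.

Lemma obox_lebesgue_gt0 n (a b : 'rV[R]_n) :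
  (forall i, (a ord0 i < b ord0 i)%R) -> 0 < leb n (obox a b).
Proof.
move=> ab; rewrite lebesgue_rV_obox// lte_fin; apply: prodr_gt0 => i _.
by rewrite subr_gt0.
Qed.

Lemma bounded_lebesgue_lty n (A : set 'rV[R]_n) (M : R) : measurable A ->
  (forall x, A x -> forall i, (`|x ord0 i| <= M)%R) -> leb n A < +oo.
Proof.
move=> mA AM.
(* The box must have positive sides even when [M] is negative, which happens for empty [A] or
   [n = 0]. *)
pose c : 'rV[R]_n := const_mx (`|M| + 1)%R.
apply: (@le_lt_trans _ _ (leb n (obox (- c)%R c))).
  apply: le_measure; rewrite ?inE//; first exact: measurable_obox.
  move=> x Ax i; rewrite !mxE -ltr_norml (le_lt_trans (AM x Ax i))//.
  by rewrite (le_lt_trans (ler_norm _))// ltrDl.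
rewrite lebesgue_rV_obox ?ltry// => i; rewrite !mxE.
by rewrite gtrN// ltr_wpDl.
Qed.

Lemma open_lebesgue_gt0 n (A : set 'rV[R]_n) x : open A -> A x ->
  0 < leb n A.
Proof.
move=> oA Ax.
have [p /= pA xp] : (\bigcup_(p in [set p : 'rV[rat]_n * 'rV[rat]_n |
    cbox (map_mx ratr p.1) (map_mx ratr p.2) `<=` A])
    obox (map_mx ratr p.1) (map_mx ratr p.2)) x by rewrite -open_obox_rat.
apply: lt_le_trans (_ : leb n (obox (map_mx ratr p.1) (map_mx ratr p.2)) <= _).
  by apply: obox_lebesgue_gt0 => i; have /andP[h1 h2] := xp i; exact: lt_trans h2.
apply: le_measure; rewrite ?inE//.
- exact: measurable_obox.
- exact: open_measurable_rV.
by apply: subset_trans pA; exact: obox_cbox.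
Qed.

(** By uniqueness of Lebesgue measure: [s] times its image under [t |-> c + s * t] has the right
    value on every half-open interval. *)
Lemma affine_lebesgue_measure (c s : R) (A : set (measurableTypeR R)) :
  (0 < s)%R -> measurable A ->
  mu ((fun t => c + s * t)%R @^-1` A) = (s^-1)%:E * mu A.
Proof.
move=> s0 mA.
pose f (t : measurableTypeR R) : measurableTypeR R := (c + s * t)%R.
have mf : measurable_fun setT f.
  by apply: measurable_funD => //; apply: measurable_funM.
pose k : {nonneg R} := NngNum (ltW s0).
pose nu_ := mscale k (pushforward mu f) : {measure set (measurableTypeR R) -> \bar R}.
pose nu := nu_ mf.
have nuE : forall B, measurable B -> mu B = nu B.
  apply: (@lebesgue_measure_unique R nu) => _ [[a b] _ <-]/=.
  rewrite /nu /nu_ /mscale /= /pushforward.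
  have -> : f @^-1` `]a, b]%classic =
      `]((a - c) / s)%R, ((b - c) / s)%R]%classic.
    apply/seteqP; split=> t /=;
      rewrite /f !in_itv/= ltr_pdivrMr// ler_pdivlMr// (mulrC t) => /andP[h1 h2];
      apply/andP; split; lra.
  have E1 := @lebesgue_measure_itv R `]a, b].
  have := @lebesgue_measure_itv R `]((a - c) / s)%R, ((b - c) / s)%R].
  move: E1; rewrite /= !lte_fin ltr_pM2r ?invr_gt0// ltrD2r => -> ->.
  case: ifPn => ab; last by rewrite mule0.
  rewrite -!EFinB -EFinM; congr EFin.
  by rewrite -mulrBl mulrCA divff ?gt_eqF// mulr1; ring.
by rewrite (nuE A)// /nu/nu_/mscale/= muleA -EFinM mulVf ?gt_eqF// mul1e.
Qed.

Lemma ge0_integral_affine1 (c s : R) (f : measurableTypeR R -> \bar R) :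
  (0 < s)%R -> measurable_fun setT f -> (forall t, 0 <= f t) ->
  \int[mu]_t f (c + s * t)%R = (s^-1)%:E * \int[mu]_t f t.
Proof.
move=> s0 mf f0.
pose g (t : measurableTypeR R) : measurableTypeR R := (c + s * t)%R.
have mg : measurable_fun setT g.
  by apply: measurable_funD => //; apply: measurable_funM.
have si0 : (0 <= s^-1)%R by rewrite invr_ge0 ltW.
rewrite -(ge0_integral_mscale mu measurableT (NngNum si0))//.
have E : \int[pushforward mu g]_t f t = \int[mu]_t f (c + s * t)%R.
  by rewrite (ge0_integral_pushforward mg mu measurableT).
rewrite -E; apply: eq_measure_integral => A mA _.
by rewrite /mscale/= /pushforward affine_lebesgue_measure.
Qed.

Lemma ge0_integral_affine n (c : 'rV[R]_n) (s : R) (F : 'rV[R]_n -> \bar R) :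
  (0 < s)%R -> measurable_fun setT F -> (forall x, 0 <= F x) ->
  \int[leb n]_x F (c + s *: x)%R = (s ^- n)%:E * \int[leb n]_x F x.
Proof.
move=> s0; elim: n c F => [|n IH] c F mF F0.
  rewrite expr0 invr1 mul1e; apply: eq_integral => x _; congr F.
  by apply/rowP => -[].
pose c' : 'rV[R]_n := \row_j c ord0 (lift ord0 j).
have E t y : (c + s *: cons_rV (t, y) = cons_rV (c ord0 ord0 + s * t, c' + s *: y))%R.
  apply/rowP => i; rewrite !mxE; case: (unliftP ord0 i) => [j ->|->//=].
  by rewrite /= !mxE.
have mA : measurable_fun setT (fun x : 'rV[R]_n.+1 => c + s *: x)%R.
  apply: measurable_fun_rV => i.
  rewrite (_ : (fun _ => _) = fun x : 'rV[R]_n.+1 => c ord0 i + s * rV_coord i x)%R.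
    apply: measurable_funD => //; apply: measurable_funM => //.
    exact: measurable_rV_coord.
  by apply/funext => x; rewrite !mxE.
rewrite ge0_integral_rVS//; last exact: measurableT_comp mA.
rewrite ge0_integral_rVS//.
pose G t := \int[leb n]_y F (cons_rV (t, y)).
have mG : measurable_fun setT G.
  apply: (measurable_fun_fubini_tonelli_F (m2 := leb n) (F \o @cons_rV R n)) => [|x].
    exact: measurableT_comp (@measurable_cons_rV R n).
  exact: F0.
have G0 t : 0 <= G t by apply: integral_ge0 => y _; exact: F0.
transitivity (\int[mu]_t ((s ^- n)%:E * G (c ord0 ord0 + s * t)%R)).
  apply: eq_integral => t _; rewrite -(IH c')//.
    by apply: eq_integral => y _; rewrite E.
  exact: (measurableT_comp mF (measurable_cons_rVl _)).
have mGa : measurable_fun setT (fun t : measurableTypeR R => G (c ord0 ord0 + s * t)%R).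
  apply: (measurableT_comp mG).
  by apply: measurable_funD => //; apply: measurable_funM.
rewrite ge0_integralZl//; last by rewrite lee_fin invr_ge0 exprn_ge0// ltW.
rewrite ge0_integral_affine1// muleA -EFinM; congr (_%:E * _).
by rewrite exprS invfM mulrC.
Qed.

Lemma affine_lebesgue_rV n (c : 'rV[R]_n) (s : R) (A : set 'rV[R]_n) :
  (0 < s)%R -> measurable A ->
  leb n [set x | A (c + s *: x)%R] = (s ^- n)%:E * leb n A.
Proof.
move=> s0 mA.
have mF : measurable_fun setT (fun x : 'rV[R]_n => c + s *: x)%R.
  apply: measurable_fun_rV => i.
  rewrite (_ : (fun _ => _) = fun x : 'rV[R]_n => c ord0 i + s * rV_coord i x)%R.
    apply: measurable_funD => //; apply: measurable_funM => //.
    exact: measurable_rV_coord.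
  by apply/funext => x; rewrite !mxE.
have mA' : measurable [set x : 'rV[R]_n | A (c + s *: x)%R].
  by rewrite -[X in measurable X]setTI; exact: mF.
have := @integral_indic _ _ _ (leb n) _ measurableT _ mA.
have := @integral_indic _ _ _ (leb n) _ measurableT _ mA'.
rewrite !setIT => <- <-.
rewrite -(ge0_integral_affine c s0 (F := fun x => (\1_A x)%:E))//.
by apply/measurable_EFinP.
Qed.

End lebesgue_rV_fubini.

Section rV_continuity.
Context {R : realType}.

Lemma rV_continuous (T : topologicalType) n (f : T -> 'rV[R]_n) (x : T) :
  (forall i, {for x, continuous (fun z => f z ord0 i)}) ->
  {for x, continuous f}.
Proof.
move=> cf P /nbhs_ballP[e /= e0 eP].
have H : forall i, nbhs x [set z | ball (f x ord0 i) e (f z ord0 i)].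
  by move=> i; apply: (cf i); exact: nbhsx_ballx.
have := @filter_forall _ _ _ _ (nbhs_filter x) H.
apply: (@filterS _ _ (nbhs_filter x)) => z Hz; apply: eP; split=> // i j.
by rewrite ord1; exact: Hz.
Qed.

Lemma cons_rV_line n (t : R) (y : 'rV[R]_n) :
  cons_rV (t, y) = t *: delta_mx ord0 ord0 + cons_rV (0, y).
Proof.
apply/rowP => i; rewrite !mxE; case: (unliftP ord0 i) => [j ->|->] /=.
  by rewrite mulr0 add0r.
by rewrite mulr1 addr0.
Qed.

Lemma cons_rV_continuousl n (y : 'rV[R]_n) :
  continuous (fun t : R => cons_rV (t, y)).
Proof.
move=> t; apply: rV_continuous => i.
rewrite (_ : (fun _ => _) = fun z : R => if unlift ord0 i is Some j
   then y ord0 j else z); last by apply/funext => z; rewrite mxE.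
by case: unlift => [j|]; [exact: cst_continuous|exact: cvg_id].
Qed.

Lemma cons_rV_continuousr n (t : R) :
  continuous (fun y : 'rV[R]_n => cons_rV (t, y)).
Proof.
move=> y; apply: rV_continuous => i.
rewrite (_ : (fun _ => _) = fun z : 'rV[R]_n => if unlift ord0 i is Some j
   then z ord0 j else t); last by apply/funext => z; rewrite mxE.
by case: unlift => [j|]; [exact: coord_continuous|exact: cst_continuous].
Qed.

Lemma compact_coord_bound n (A : set 'rV[R]_n) : compact A ->
  exists M : R, forall x, A x -> forall i, `|x ord0 i| <= M.
Proof.
move=> /compact_bounded[M [_ AM]]; exists (M + 1) => x Ax i.
apply: (le_trans _ (AM (M + 1) _ x Ax)); last by rewrite ltrDl.
rewrite [leRHS]/Num.norm /= mx_normrE.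
by apply/bigmax_geP; right; exists (ord0, i).
Qed.

Lemma compact_closed_rV n (A : set 'rV[R]_n) : compact A -> closed A.
Proof. by apply: compact_closed; exact: norm_hausdorff. Qed.

Lemma compact_measurable_rV n (A : set 'rV[R]_n) : compact A -> measurable A.
Proof. by move=> /compact_closed_rV; exact: closed_measurable_rV. Qed.

Lemma compact_lebesgue_lty n (A : set 'rV[R]_n) :
  compact A -> (lebesgue_rV n A < +oo)%E.
Proof.
move=> cA; have [M AM] := compact_coord_bound cA.
by apply: (bounded_lebesgue_lty _ AM); exact: compact_measurable_rV.
Qed.

Lemma compact_continuous_bound (T : topologicalType) (A : set T) (g : T -> R) :
  compact A -> (forall x, A x -> {for x, continuous g}) ->
  exists M : R, forall x, A x -> `|g x| <= M.
Proof.
move=> cA cg.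
have /compact_bounded[M [_ HM]] : compact (g @` A).
  apply: continuous_compact cA; apply: continuous_in_subspaceT => x.
  by rewrite inE; exact: cg.
exists (M + 1) => x Ax; apply: (HM (M + 1)); first by rewrite ltrDl.
by exists x.
Qed.

Lemma compact_integrable n (A U : set 'rV[R]_n) (g : 'rV[R]_n -> R) :
  compact A -> open U -> A `<=` U -> (forall x, U x -> {for x, continuous g}) ->
  (lebesgue_rV n).-integrable A (EFin \o g).
Proof.
move=> cA oU AU cg; have mA := compact_measurable_rV cA.
apply: measurable_bounded_integrable => //; first exact: compact_lebesgue_lty.
  apply: measurable_funS (continuous_measurable_rV oU cg) => //.
  exact: open_measurable_rV.
have [M HM] := compact_continuous_bound cA (fun x Ax => cg x (AU x Ax)).
by exists M; split; [exact: num_real|move=> y My x /HM /le_trans; apply; exact: ltW].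
Qed.

Lemma integrable_supportT n (A U : set 'rV[R]_n) (g : 'rV[R]_n -> R) :
  compact A -> open U -> A `<=` U -> (forall x, U x -> {for x, continuous g}) ->
  (forall x, ~ A x -> g x = 0) ->
  (lebesgue_rV n).-integrable setT (EFin \o g).
Proof.
move=> cA oU AU cg g0.
have -> : EFin \o g = (EFin \o g) \_ A.
  apply/funext => x; rewrite patchE; case: ifPn => //.
  by rewrite notin_setE => /g0 /= ->.
apply/(integrable_mkcond _ (compact_measurable_rV cA)).
exact: (compact_integrable cA oU AU cg).
Qed.

Lemma integral_support d (T : measurableType d)
    (mu : {measure set T -> \bar R}) (A B : set T) (F : T -> \bar R) :
  A `<=` B -> (forall x, ~ A x -> F x = 0%E) ->
  (\int[mu]_(x in B) F x = \int[mu]_(x in A) F x)%E.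
Proof.
move=> AB F0; rewrite integral_mkcond [RHS]integral_mkcond; congr integral.
apply/funext => x; rewrite !patchE; case: ifPn; case: ifPn => //.
- by rewrite notin_setE => /F0.
- by rewrite inE notin_setE => /AB.
Qed.

End rV_continuity.

(** * Integration by parts *)

Section divergence.
Context {R : realType}.
Local Notation mu := (@lebesgue_measure R).

Lemma is_derive1_shift (f : R -> R) (t d : R) :
  is_derive (0 : R) 1 (fun h => f (h + t)) d -> is_derive t 1 f d.
Proof.
move=> H; apply/is_derive_line.
by rewrite (_ : (fun _ => _) = fun h => f (h + t))//;
  apply/funext => h; rewrite [_%:A]mulr1.
Qed.

Lemma integral_derive1_eq0 (f g : R -> R) (M : R) :
  (forall t : R, is_derive t 1 f (g t)) -> continuous g ->
  (forall t, M < `|t| -> f t = 0 /\ g t = 0) ->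
  (\int[mu]_t (g t)%:E = 0)%E.
Proof.
move=> df cg fg0; pose a := `|M| + 1.
have Ma : M < a by rewrite (le_lt_trans (ler_norm _))// ltrDl.
have a0 : 0 < a by rewrite ltr_wpDl.
have cf t : {for t, continuous f}.
  by apply: differentiable_continuous; apply/derivable1_diffP; have [] := df t.
rewrite (@integral_support _ _ _ mu `[(- a), a]%classic)//; last first.
  move=> t /= /negP; rewrite in_itv/= -ler_norml -ltNge => at_.
  by have [_ ->] := fg0 t (lt_trans Ma at_).
rewrite (@continuous_FTC2 _ g f)//.
- have [|-> _] := fg0 a; first by rewrite gtr0_norm.
  have [|-> _] := fg0 (- a); first by rewrite normrN gtr0_norm.
  by rewrite sube0.
- by rewrite gtrN.
- by apply: continuous_subspaceT => x; exact: cg.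
- split.
  + by move=> x _; have [] := df x.
  + by apply: cvg_at_right_filter; exact: cf.
  + by apply: cvg_at_left_filter; exact: cf.
- by move=> x _; rewrite derive1E; have [] := df x.
Qed.

(** When [k] is the first coordinate, the inner integral vanishes by the fundamental theorem of
    calculus; otherwise the first coordinate is frozen and the induction hypothesis applies. *)
Lemma integral_partial_eq0 n (F G : 'rV[R]_n -> R) (k : 'I_n) (M : R) :
  (forall x, is_derive x (delta_mx ord0 k) F (G x)) -> continuous G ->
  (forall x : 'rV[R]_n, (exists i, M < `|x ord0 i|) -> F x = 0 /\ G x = 0) ->
  (\int[lebesgue_rV n]_x (G x)%:E = 0)%E.
Proof.
elim: n F G k => [|n IH] F G k dF cG FG0; first by case: k dF => [].
have iG : (lebesgue_rV n.+1).-integrable setT (EFin \o G).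
  apply: (@integrable_supportT _ _ [set x | forall i, `[(- M), M]%classic (x ord0 i)] setT).
  - by apply: (@rV_compact R n.+1 (fun=> `[(- M), M]%classic)) => _;
      exact: segment_compact.
  - exact: openT.
  - by [].
  - by move=> x _; exact: cG.
  - move=> x /existsNP[i]; rewrite /= in_itv/= -ler_norml => /negP.
    by rewrite -ltNge => Mx; have [|] := FG0 x; first by exists i.
have [E1 E2] := integral_rVS iG.
case: (unliftP ord0 k) dF => [j ->|->] dF.
  rewrite E1 integral0_eq// => t _; apply: (IH (fun y => F (cons_rV (t, y)))
      (fun y => G (cons_rV (t, y))) j).
  - move=> y; apply/is_derive_line; have /is_derive_line := dF (cons_rV (t, y)).
    congr (is_derive _ _ _ _); apply/funext => h; congr F.
    apply/rowP => i; rewrite !mxE; case: (unliftP ord0 i) => [l ->|->] /=.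
      by rewrite !mxE !eqxx/= (inj_eq lift_inj).
    by rewrite mulr0 add0r.
  - by move=> y; apply: continuous_comp;
      [exact: cons_rV_continuousr|exact: cG].
  - move=> y [i Mi]; apply: FG0; exists (lift ord0 i).
    by rewrite mxE liftK.
rewrite E2 integral0_eq// => y _.
apply: (@integral_derive1_eq0 (fun t => F (cons_rV (t, y)))
  (fun t => G (cons_rV (t, y))) M).
- move=> t; apply: is_derive1_shift; have /is_derive_line := dF (cons_rV (t, y)).
  congr (is_derive _ _ _ _); apply/funext => h; congr F.
  by rewrite cons_rV_line addrA -scalerDl -cons_rV_line.
- by move=> t; apply: continuous_comp;
    [exact: cons_rV_continuousl|exact: cG].
- by move=> t Mt; apply: FG0; exists ord0; rewrite mxE unlift_none.
Qed.

(** Although [u] is controlled on [U] only, [u * phi] vanishes off the compact set [A]; every point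
    lies in [U] or in the open complement of [A], so this product is continuously differentiable in
    direction [k] on the whole space and its derivative integrates to 0. *)
Lemma integration_by_parts_rV n (U A : set 'rV[R]_n) (k : 'I_n)
    (u u' phi phi' : 'rV[R]_n -> R) :
  open U -> compact A -> A `<=` U ->
  (forall x, U x -> {for x, continuous u}) ->
  (forall x, U x -> {for x, continuous u'}) ->
  (forall x, U x -> is_derive x (delta_mx ord0 k) u (u' x)) ->
  continuous phi -> continuous phi' ->
  (forall x, is_derive x (delta_mx ord0 k) phi (phi' x)) ->
  (forall x, ~ A x -> phi x = 0) ->
  (\int[lebesgue_rV n]_(x in U) (u x * phi' x)%:E =
   - \int[lebesgue_rV n]_(x in U) (u' x * phi x)%:E)%E.
Proof.
move=> oU cA AU cu cu' du cphi cphi' dphi phi0.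
have oAC : open (~` A) by apply: closed_openC; exact: compact_closed_rV.
have phi'0 x : ~ A x -> phi' x = 0.
  move=> Ax; have [_ <-] := dphi x.
  rewrite (@near_eq_derive _ _ _ _ (fun=> 0)) ?derive_cst//.
  by apply: (near_eq_open oAC) => // y; exact: phi0.
have cP x : U x -> {for x, continuous (fun x => u x * phi' x)}.
  by move=> Ux; apply: continuousM; [exact: cu|exact: cphi'].
have cQ x : U x -> {for x, continuous (fun x => u' x * phi x)}.
  by move=> Ux; apply: continuousM; [exact: cu'|exact: cphi].
have P0 x : ~ A x -> u x * phi' x = 0 by move=> /phi'0 ->; rewrite mulr0.
have Q0 x : ~ A x -> u' x * phi x = 0 by move=> /phi0 ->; rewrite mulr0.
have iP := integrable_supportT cA oU AU cP P0.
have iQ := integrable_supportT cA oU AU cQ Q0.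
rewrite -!(@integral_support _ _ _ _ U setT)//; last 2 first.
- by move=> x Ux; rewrite Q0// => /AU.
- by move=> x Ux; rewrite P0// => /AU.
have [M AM] := compact_coord_bound cA.
pose F x := u x * phi x.
pose G x := u x * phi' x + u' x * phi x.
have locA x : ~ A x -> {near x, (fun=> 0 : R) =1 F} /\ {near x, (fun=> 0 : R) =1 G}.
  move=> Ax; split; apply: (near_eq_open oAC) => // y Ay.
    by rewrite /F phi0// mulr0.
  by rewrite /G P0// Q0// addr0.
have : (\int[lebesgue_rV n]_x (G x)%:E = 0)%E.
  apply: (@integral_partial_eq0 _ F G k M).
  - move=> x; have [Ux|Ux] := pselect (U x).
      apply: is_derive_eq; first exact: is_deriveMR (du _ Ux) (dphi x).
      by rewrite /G [phi x * _]mulrC.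
    have Ax : ~ A x by move=> /AU.
    have -> : G x = 0 by rewrite /G P0// Q0// addr0.
    have [nF _] := locA x Ax.
    exact: near_eq_is_derive nF (is_derive_cst _ _ _).
  - move=> x; have [Ux|Ux] := pselect (U x).
      exact: (continuousD (cP x Ux) (cQ x Ux)).
    have Ax : ~ A x by move=> /AU.
    apply: (eq_continuous_at oAC Ax (g := fun=> 0)); last exact: cst_continuous.
    by move=> y Ay; rewrite /G P0// Q0// addr0.
  - move=> x [i Mi]; have Ax : ~ A x by move=> /AM/(_ i); rewrite leNgt Mi.
    by rewrite /F /G P0// Q0// addr0 phi0// mulr0.
rewrite -[X in X -> _]/(\int[lebesgue_rV n]_x ((u x * phi' x)%:E + (u' x * phi x)%:E) = 0)%E.
rewrite integralD//=.
have := integrable_fin_num measurableT iQ; have := integrable_fin_num measurableT iP.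
rewrite /= => fP fQ; rewrite -(fineK fP) -(fineK fQ) -EFinD -EFinN.
by case=> /eqP; rewrite addr_eq0 => /eqP ->.
Qed.

End divergence.

(** * Superharmonic functions and spherical means *)

Section flat_functions.
Context {R : realType}.
Implicit Types (P : {poly R}) (z : R).

Definition flat P z : R := if 0 < z then P.[z^-1] * expR (- z^-1) else 0.

Lemma flat_le0 P z : z <= 0 -> flat P z = 0.
Proof. by rewrite /flat ltNge => ->. Qed.

Lemma flat_gt0 P z : 0 < z -> flat P z = P.[z^-1] * expR (- z^-1).
Proof. by rewrite /flat => ->. Qed.

Lemma exprM_expRN (y : R) (i : nat) : 0 <= y ->
  y ^+ i.+1 * expR (- y) <= i.+1`!%:R.
Proof.
move=> y0; rewrite expRN ler_pdivrMr ?expR_gt0//.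
have := expR_ge1Dxn i y0.
have f0 : 0 < (i.+1`!%:R : R) by rewrite ltr0n fact_gt0.
move=> /(ler_wpM2l (ltW f0)); apply: le_trans.
by rewrite mulrDr mulr1 mulrCA divff ?gt_eqF// mulr1 lerDr ltW.
Qed.

(** From [y ^+ k * expR (- y) <= k!] at [y = z^-1] with [k = i + 2]: the two spare powers leave the
    factor [z ^+ 2], which forces the derivative at 0 to exist and vanish. *)
Lemma flat_bound P : exists2 C : R, 0 <= C & forall z, `|flat P z| <= C * z ^+ 2.
Proof.
exists (\sum_(i < size P) `|P`_i| * (i.+2`!)%:R).
  by apply: sumr_ge0 => i _; rewrite mulr_ge0.
move=> z; have [z0|z0] := lerP z 0.
  rewrite flat_le0// normr0 mulr_ge0 ?sqr_ge0//.
  by apply: sumr_ge0 => i _; rewrite mulr_ge0.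
rewrite flat_gt0// normrM [X in _ * X]ger0_norm ?expR_ge0// horner_coef.
have y0 : 0 <= z^-1 by rewrite invr_ge0 ltW.
apply: (@le_trans _ _ (\sum_(i < size P) `|P`_i| * (z^-1) ^+ i * expR (- z^-1))).
  rewrite -mulr_suml ler_wpM2r ?expR_ge0//.
  apply: (le_trans (ler_norm_sum _ _ _)); apply: ler_sum => i _.
  by rewrite normrM (ger0_norm (exprn_ge0 _ y0)).
rewrite mulr_suml; apply: ler_sum => i _.
rewrite -!mulrA; apply: ler_wpM2l => //.
have := exprM_expRN i.+1 y0; rewrite -(ler_pM2r (exprn_gt0 2 z0)); apply: le_trans.
rewrite !exprS expr0 mulr1.
have -> : z^-1 * (z^-1 * z^-1 ^+ i) * expR (- z^-1) * (z * z) =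
  (z^-1 * z) * (z^-1 * z) * (z^-1 ^+ i * expR (- z^-1)) by ring.
by rewrite mulVf ?gt_eqF// !mul1r.
Qed.

Lemma is_derive_quadratic_bound (f : R -> R) (C : R) : f 0 = 0 ->
  (forall z, `|f z| <= C * z ^+ 2) -> is_derive (0 : R) 1 f 0.
Proof.
move=> f0 fC.
have H : h^-1 *: (f (h *: (1 : R) + 0) - f 0) @[h --> (0 : R)^'] --> (0 : R).
  have Ch0 : (C * `|h|) @[h --> (0 : R)^'] --> (0 : R).
    rewrite -[X in _ --> X](mulr0 C) -[X in _ --> C * X](@normr0 _ R).
    by apply: cvgMr; apply: cvg_norm; apply: cvg_within_filter; exact: cvg_id.
  apply/cvgr0Pnorm_le => e e0; near=> h.
  have h0 : h != 0 by near: h; exact: nbhs_dnbhs_neq.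
  apply: (@le_trans _ _ (C * `|h|)).
    rewrite addr0 [h *: _]mulr1 f0 subr0 normrZ normfV ler_pdivrMl ?normr_gt0//.
    rewrite (le_trans (fC h))//.
    by rewrite -[in leLHS]real_normK ?num_real// expr2 mulrCA.
  near: h; move/cvgr0Pnorm_le: Ch0 => /(_ e e0); apply: filterS => h.
  by apply: le_trans; exact: ler_norm.
by apply: DeriveDef; [apply/cvg_ex; exists 0|exact/cvg_lim].
Unshelve. all: by end_near. Qed.

Lemma is_derive_flat P z : is_derive z 1 (flat P) (flat ('X^2 * (P - P^`())) z).
Proof.
have [z0|z0|->] := ltgtP z 0.
- rewrite flat_le0 ?ltW//.
  have : is_derive z 1 (fun=> 0 : R) (0 : R) by exact: is_derive_cst.
  apply: near_eq_is_derive; near=> y; rewrite flat_le0// ltW//.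
  by near: y; exact: lt_nbhsl.
- have zn0 : z != 0 by rewrite gt_eqF.
  have I := is_deriveV zn0 (is_derive_id z (1 : R)).
  have dP (y : R) : is_derive y 1 (horner P) P^`().[y].
    apply: DeriveDef; first exact: derivable_horner.
    by rewrite -derive1E -derivE.
  have dE (y : R) : is_derive y 1 (fun y : R => expR (- y)) (expR (- y) * - 1).
    exact: is_derive_compR (is_derive_expR (- y)) (is_deriveN (is_derive_id y (1 : R))).
  have dPE := is_deriveMR (dP z^-1) (dE z^-1).
  have H := is_derive_compR dPE I.
  have : is_derive z 1 ((fun y => P.[y] * expR (- y)) \o (fun y => y^-1))
      (flat ('X^2 * (P - P^`())) z).
    apply: is_derive_eq H _; rewrite [_%:A]mulr1 flat_gt0//.
    by rewrite hornerM hornerXn hornerD hornerN -exprVn; ring.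
  apply: near_eq_is_derive; near=> y; rewrite flat_gt0//=.
  by near: y; exact: lt_nbhsr.
- rewrite flat_le0//; have [C C0 HC] := flat_bound P.
  by apply: is_derive_quadratic_bound HC; rewrite flat_le0.
Unshelve. all: by end_near. Qed.

Lemma flat1_gt0 z : 0 < z -> 0 < flat 1 z.
Proof. by move=> z0; rewrite flat_gt0// hornerC mul1r expR_gt0. Qed.

Lemma flat1_ge0 z : 0 <= flat 1 z.
Proof. by have [/flat_le0->//|/flat1_gt0/ltW] := lerP z 0. Qed.

Lemma flat1_lt1 z : flat 1 z < 1.
Proof.
have [/flat_le0->//|z0] := lerP z 0.
by rewrite flat_gt0// hornerC mul1r expR_lt1 oppr_lt0 invr_gt0.
Qed.

Lemma Cd_flat n (U : set 'rV[R]_n) d g P : open U -> Cd d U g ->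
  Cd d U (fun x => flat P (g x)).
Proof.
move=> oU Cg.
pose F m := flat (iter m (fun Q => 'X^2 * (Q - Q^`())) P).
apply: (Cd_comp oU (V := setT) (F := F) _ _ Cg 0) => // m z _.
exact: is_derive_flat.
Qed.

(* The primitive [z * exp (-1/z)] of [flat (1 + 'X)]: a smooth version of the
   positive part, with slope between 0 and 1. *)
Definition softplus z : R := z * flat 1 z.

Lemma is_derive_softplus z : is_derive z 1 softplus (flat (1 + 'X) z).
Proof.
have := is_deriveMR (is_derive_id z (1 : R)) (is_derive_flat 1 z).
move=> H; apply: is_derive_eq H _; have [z0|z0] := lerP z 0.
  by rewrite !flat_le0//; ring.
have -> : 'X^2 * (1 - 1^`()) = 'X^2 :> {poly R}.
  by rewrite -[1]polyC1 derivC subr0 polyC1 mulr1.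
rewrite !flat_gt0// hornerD hornerXn hornerC hornerX.
by field; rewrite gt_eqF.
Qed.

Lemma is_derive_softplus' z : is_derive z 1 (flat (1 + 'X)) (flat 'X^3 z).
Proof.
apply: is_derive_eq (is_derive_flat _ z) _.
by rewrite derivD derivX derivC add0r addrAC subrr add0r -exprSr.
Qed.

Lemma softplus_ge0 z : 0 <= softplus z.
Proof.
have [/flat_le0 z0|z0] := lerP z 0; first by rewrite /softplus z0 mulr0.
by rewrite /softplus mulr_ge0 ?flat1_ge0// ltW.
Qed.

Lemma softplus_le0 z : z <= 0 -> softplus z = 0.
Proof. by move=> z0; rewrite /softplus flat_le0// mulr0. Qed.

Lemma softplus'_ge0 z : 0 <= flat (1 + 'X) z.
Proof.
have [/flat_le0->//|z0] := lerP z 0.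
by rewrite flat_gt0// mulr_ge0 ?expR_ge0// !hornerE addr_ge0// invr_ge0 ltW.
Qed.

Lemma softplus'_le1 z : flat (1 + 'X) z <= 1.
Proof.
have [/flat_le0->//|z0] := lerP z 0.
rewrite flat_gt0// !hornerE expRN ler_pdivrMr ?expR_gt0// mul1r.
exact: expR_ge1Dx.
Qed.

Lemma softplus'_cvg z : 0 < z ->
  flat (1 + 'X) (m.+1%:R * z) @[m --> \oo] --> (1 : R).
Proof.
move=> z0.
have H : (m.+1%:R * z)^-1 @[m --> \oo] --> (0 : R).
  rewrite (_ : (fun _ => _) = fun m : nat => harmonic m * z^-1); last first.
    by apply/funext => m; rewrite invfM.
  rewrite -[X in _ --> X](mul0r z^-1); apply: cvgMl.
  exact: cvg_harmonic.
have cE : expR (- (m.+1%:R * z)^-1) @[m --> \oo] --> (expR (- 0) : R).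
  by apply: continuous_cvg; [exact: continuous_expR|exact: cvgN].
have c1 : (1 + (m.+1%:R * z)^-1) @[m --> \oo] --> (1 + 0 : R).
  by apply: cvgD => //; exact: cvg_cst.
have := cvgM c1 cE.
rewrite addr0 oppr0 expR0 mul1r => H1.
rewrite (_ : (fun _ => _) = fun m : nat =>
  (1 + (m.+1%:R * z)^-1) * expR (- (m.+1%:R * z)^-1)); first exact: H1.
apply/funext => m; rewrite flat_gt0; last by rewrite mulr_gt0// ltr0n.
by rewrite hornerD hornerC hornerX.
Qed.

End flat_functions.

(** * Green's formula against compactly supported functions *)

Section green.
Context {R : realType} {n : nat}.
Local Notation leb := (@lebesgue_rV R n).

Lemma partial_support (A : set 'rV[R]_n) (H : 'rV[R]_n -> R) k :
  closed A -> (forall x, ~ A x -> H x = 0) ->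
  forall x, ~ A x -> partial k H x = 0.
Proof.
move=> cA H0 x Ax; have oAC : open (~` A) by exact: closed_openC.
by rewrite (partial_eq oAC k (h := fun=> 0) _ Ax)// partial_cst.
Qed.

(** Two integrations by parts in each coordinate; the support of [H] rules out boundary terms. *)
Lemma green2 (U A : set 'rV[R]_n) (g H : 'rV[R]_n -> R) :
  open U -> compact A -> A `<=` U -> Cd 2 U g -> Cd 2 setT H ->
  (forall x, ~ A x -> H x = 0) ->
  (\int[leb]_(x in U) (g x * laplacian H x)%:E =
   \int[leb]_(x in U) (laplacian g x * H x)%:E)%E.
Proof.
move=> oU cA AU Cg CH H0; have clA := compact_closed_rV cA.
have mU := open_measurable_rV oU.
have H1 k := partial_support k clA H0.
have H2 k := partial_support k clA (H1 k).
have CH1 k := CdS_partial k CH; have Cg1 k := CdS_partial k Cg.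
have CH2 k := CdS_partial k (CH1 k); have Cg2 k := CdS_partial k (Cg1 k).
have cH x : {for x, continuous H} := Cd_continuous openT CH (I : setT x).
have cH1 k x : {for x, continuous (partial k H)} :=
  Cd_continuous openT (CH1 k) (I : setT x).
have cH2 k x : {for x, continuous (partial k (partial k H))} :=
  Cd_continuous openT (CH2 k) (I : setT x).
have intl k : leb.-integrable U (EFin \o (fun x => g x * partial k (partial k H) x)).
  apply: (@integrableS _ _ _ leb setT) => //.
  apply: (integrable_supportT cA oU AU) => [x Ux|x Ax]; last by rewrite H2// mulr0.
  exact: continuousM (Cd_continuous oU Cg Ux) (cH2 k x).
have intr k : leb.-integrable U (EFin \o (fun x => partial k (partial k g) x * H x)).
  apply: (@integrableS _ _ _ leb setT) => //.
  apply: (integrable_supportT cA oU AU) => [x Ux|x Ax]; last by rewrite H0// mulr0.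
  exact: continuousM (Cd_continuous oU (Cg2 k) Ux) (cH x).
transitivity (\sum_k \int[leb]_(x in U) (g x * partial k (partial k H) x)%:E)%E.
  rewrite -(integral_sum mU (f := fun k x => (g x * partial k (partial k H) x)%:E))//.
  by apply: eq_integral => x _; rewrite sumEFin mulr_sumr.
transitivity (\sum_k \int[leb]_(x in U) (partial k (partial k g) x * H x)%:E)%E;
    last first.
  rewrite -(integral_sum mU (f := fun k x => (partial k (partial k g) x * H x)%:E))//.
  by apply: eq_integral => x _; rewrite sumEFin mulr_suml.
apply: eq_bigr => k _.
rewrite (integration_by_parts_rV oU cA AU
    (fun x Ux => Cd_continuous oU Cg Ux)
    (fun x Ux => Cd_continuous oU (Cg1 k) Ux)
    (fun x Ux => CdS_derive k Cg Ux) (cH1 k) (cH2 k)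
    (fun x => CdS_derive k (CH1 k) (I : setT x)) (H1 k)).
rewrite (integration_by_parts_rV oU cA AU
    (fun x Ux => Cd_continuous oU (Cg1 k) Ux)
    (fun x Ux => Cd_continuous oU (Cg2 k) Ux)
    (fun x Ux => CdS_derive k (Cg1 k) Ux) cH (cH1 k)
    (fun x => CdS_derive k CH (I : setT x)) H0).
by rewrite oppeK.
Qed.

Definition cball (r : R) : set 'rV[R]_n := [set x | enorm x <= r].

Lemma closed_cball r : closed (cball r).
Proof.
have -> : cball r = @enorm R n @^-1` [set t | t <= r] by [].
by apply: closed_comp; [move=> x _; exact: enorm_continuous|exact: closed_le].
Qed.

Lemma norm_le_enorm (x : 'rV[R]_n) : `|x| <= enorm x.
Proof.
rewrite [leLHS]/Num.norm /= mx_normrE; apply/bigmax_leP; split=> /=.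
  exact: enorm_ge0.
by move=> -[i j] _; rewrite ord1; exact: ler_coord_enorm.
Qed.

Lemma compact_cball r : compact (cball r).
Proof.
apply: bounded_closed_compact; last exact: closed_cball.
exists r; split; first exact: num_real.
move=> y ry x /= xr; apply: le_trans (norm_le_enorm x) _.
exact: le_trans xr (ltW ry).
Qed.

Lemma cball_unit_ball r : r < 1 -> cball r `<=` unit_ball n.
Proof. by move=> r1 x /= xr; rewrite unit_ballE; exact: le_lt_trans r1. Qed.

End green.

(** * Smoothed indicators of balls *)

Section bump_kernel.
Context {R : realType} {n : nat}.
Local Notation leb := (@lebesgue_rV R n).
Variables (m : R) (m0 : 0 < m).

Let q (x : 'rV[R]_n) : R := enorm x ^+ 2.
Let z (w : R) (x : 'rV[R]_n) : R := m * (1 - w ^+ 2 * q x).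

Let qE (x : 'rV[R]_n) : q x = \sum_i x ord0 i ^+ 2.
Proof. exact: enorm_sqr. Qed.

Let Cd_q d : Cd d setT q.
Proof.
apply: (eq_Cd openT (g := fun x => enorm (x - 0) ^+ 2)).
  by move=> x _; rewrite subr0.
exact: Cd_enorm2 openT.
Qed.

Let Cd_z d w : Cd d setT (z w).
Proof.
apply: CdZ; first exact: openT.
apply: CdB; [exact: openT|exact: Cd_cst openT _ _|].
by apply: CdZ; [exact: openT|exact: Cd_q].
Qed.

Let partial_q k (x : 'rV[R]_n) : is_derive x (delta_mx ord0 k) q (2 * x ord0 k).
Proof.
have -> : q = fun y : 'rV[R]_n => \sum_i y ord0 i ^+ 2.
  by apply/funext => y; exact: qE.
have d1 (i : 'I_n) : is_derive x (delta_mx ord0 k)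
    (fun y : 'rV[R]_n => y ord0 i ^+ 2) (2 * x ord0 i * (i == k)%:R).
  have D := is_derive_coord i k x.
  have := is_deriveMR D D.
  rewrite (_ : (fun y => _) = fun y : 'rV[R]_n => y ord0 i ^+ 2).
    by move=> H; apply: is_derive_eq H _; ring.
  by apply/funext => y; rewrite expr2.
have := is_derive_sum d1.
rewrite (_ : \sum_(i < n) _ = fun y : 'rV[R]_n => \sum_i y ord0 i ^+ 2); last first.
  by apply/funext => y; rewrite fct_sumE.
move=> H; apply: is_derive_eq H _.
rewrite (bigD1 k)//= eqxx mulr1 big1 ?addr0// => i /negPf ->.
by rewrite mulr0.
Qed.

(* [kernel w] approximates [w ^+ n] times the indicator of the ball of radius
   [w^-1] as [m] grows, and its derivative in [w] is a negative multiple of the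
   Laplacian of [kernel_potential w].  Green's formula then makes its integral
   against a superharmonic function monotone in [w], so that the mean value
   inequality needs no surface integral. *)
Definition kernel_potential (w : R) (x : 'rV[R]_n) : R := softplus (z w x).

Definition kernel (w : R) (x : 'rV[R]_n) : R := w ^+ n * flat (1 + 'X) (z w x).

Definition kernel' (w : R) (x : 'rV[R]_n) : R :=
  n%:R * w ^+ n.-1 * flat (1 + 'X) (z w x) -
  w ^+ n * flat 'X^3 (z w x) * (2 * m * w * q x).

Lemma Cd_kernel_potential d w : Cd d setT (kernel_potential w).
Proof.
apply: CdM; [exact: openT|exact: Cd_z|].
by apply: Cd_flat; [exact: openT|exact: Cd_z].
Qed.

Lemma kernel_potential_ge0 w x : 0 <= kernel_potential w x.
Proof. exact: softplus_ge0. Qed.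

Let z_le0 (w : R) (x : 'rV[R]_n) : 0 < w -> w^-1 <= enorm x -> z w x <= 0.
Proof.
move=> w0 wx; rewrite /z pmulr_rle0// subr_le0 /q -exprMn -[leLHS](expr1n _ 2).
rewrite ler_pXn2r// ?nnegrE ?mulr_ge0// ?enorm_ge0 ?(ltW w0)//.
by rewrite -ler_pdivrMl// mulr1.
Qed.

Lemma kernel_potential_support (w : R) (x : 'rV[R]_n) :
  0 < w -> ~ cball w^-1 x -> kernel_potential w x = 0.
Proof.
move=> w0 /negP; rewrite -ltNge => wx.
by rewrite /kernel_potential softplus_le0// z_le0// ltW.
Qed.

Lemma laplacian_kernel_potential w x :
  laplacian (kernel_potential w) x =
  flat 'X^3 (z w x) * (4 * m ^+ 2 * w ^+ 4 * q x) -
  flat (1 + 'X) (z w x) * (2 * n%:R * m * w ^+ 2).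
Proof.
have dz k y : is_derive y (delta_mx ord0 k) (z w) (- (2 * m * w ^+ 2) * y ord0 k).
  have dc (c : R) : is_derive y (delta_mx ord0 k) (fun=> c) (0 : R).
    exact: is_derive_cst.
  have := is_deriveMR (dc m)
    (is_deriveB (dc 1) (is_deriveMR (dc (w ^+ 2)) (partial_q k y))).
  by move=> H; apply: is_derive_eq H _; rewrite /=; ring.
have d1 k y : partial k (kernel_potential w) y =
    flat (1 + 'X) (z w y) * (- (2 * m * w ^+ 2) * y ord0 k).
  apply: partial_is_derive.
  exact: is_derive_compR (is_derive_softplus _) (dz k y).
have d2 k y : partial k (partial k (kernel_potential w)) y =
    flat 'X^3 (z w y) * (4 * m ^+ 2 * w ^+ 4) * y ord0 k ^+ 2 -
    flat (1 + 'X) (z w y) * (2 * m * w ^+ 2).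
  have -> : partial k (kernel_potential w) =
    fun y => flat (1 + 'X) (z w y) * (- (2 * m * w ^+ 2) * y ord0 k).
    by apply/funext => y'; exact: d1.
  apply: partial_is_derive.
  have D1 := is_derive_compR (is_derive_softplus' _) (dz k y).
  have D2 := is_deriveMR (is_derive_cst (- (2 * m * w ^+ 2)) y (delta_mx ord0 k))
    (is_derive_coord k k y).
  have := is_deriveMR D1 D2; rewrite eqxx => H; apply: is_derive_eq H _.
  by rewrite /=; ring.
rewrite /laplacian (eq_bigr _ (fun k _ => d2 k x)) sumrB -mulr_sumr -qE.
by rewrite sumr_const card_ord -mulr_natl; ring.
Qed.

(** For a dilation [w ^+ n * k (w x)], the derivative in [w] is [w^-1] times the divergence of [x]
    times that function; and [x] times [kernel w x] is a negative multiple of the gradient of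
    [kernel_potential w]. *)
Lemma kernel'E w x : (0 < n)%N -> 0 < w ->
  kernel' w x = - (w ^+ n / (2 * m * w ^+ 3)) * laplacian (kernel_potential w) x.
Proof.
move=> n0 w0; rewrite laplacian_kernel_potential /kernel'.
have -> : w ^+ n = w * w ^+ n.-1 by rewrite -exprS prednK.
by field; rewrite !gt_eqF.
Qed.

Lemma is_derive_kernel (w : R) (x : 'rV[R]_n) : is_derive w 1 (kernel ^~ x) (kernel' w x).
Proof.
have dc (c : R) : is_derive w 1 (fun=> c) (0 : R) by exact: is_derive_cst.
have dw : is_derive w 1 (fun w : R => w) 1 by exact: is_derive_id.
have dX (i : nat) : is_derive w 1 (fun w : R => w ^+ i) (i%:R * w ^+ i.-1).
  case: i => [|i] /=; first by rewrite mul0r; exact: dc.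
  elim: i => [|i IH]; first by apply: is_derive_eq dw _; rewrite mul1r expr0.
  have := is_deriveMR dw IH => H; rewrite exprS.
  apply: is_derive_eq H _ => /=; rewrite exprS -natr1; ring.
have dz : is_derive w 1 (z ^~ x) (- (2 * m * w * q x)).
  have := is_deriveMR (dc m) (is_deriveB (dc 1) (is_deriveMR (dX 2) (dc (q x)))).
  by move=> H; apply: is_derive_eq H _; rewrite /= expr1; ring.
have := is_deriveMR (dX n) (is_derive_compR (is_derive_softplus' _) dz).
by move=> H; apply: is_derive_eq H _; rewrite /kernel' /=; ring.
Qed.

Lemma kernel_bound (w : R) (x : 'rV[R]_n) : 0 <= w -> 0 <= kernel w x <= w ^+ n.
Proof.
move=> w0; rewrite /kernel mulr_ge0 ?exprn_ge0 ?softplus'_ge0//=.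
by rewrite ler_piMr ?exprn_ge0// softplus'_le1.
Qed.

(** Uniformity in [w] provides the dominating constant for differentiation under the integral
    sign. *)
Lemma kernel'_bound (v : R) : 0 <= v ->
  exists C : R, forall (w : R) (x : 'rV[R]_n), 0 <= w <= v -> enorm x <= 1 -> `|kernel' w x| <= C.
Proof.
move=> v0; have [C C0 HC] := flat_bound ('X^3 : {poly R}).
exists (n%:R * v ^+ n.-1 + v ^+ n * (C * (m * (1 + v ^+ 2)) ^+ 2) * (2 * m * v)).
move=> w x /andP[w0 wv] x1.
have q0 : 0 <= q x by exact: sqr_ge0.
have q1 : q x <= 1 by apply: exprn_ile1 => //; exact: enorm_ge0.
rewrite (le_trans (ler_normB _ _))//; apply: lerD.
  rewrite ger0_norm; last by rewrite !mulr_ge0// ?exprn_ge0// softplus'_ge0.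
  rewrite -[leRHS]mulr1 ler_pM ?softplus'_ge0 ?softplus'_le1//.
    by rewrite mulr_ge0// exprn_ge0.
  by rewrite ler_wpM2l// lerXn2r.
rewrite normrM; apply: ler_pM => //; last first.
  have m2 : 0 <= 2 * m by rewrite mulr_ge0// ltW.
  have h2 : 0 <= 2 * m * w by rewrite mulr_ge0.
  rewrite (ger0_norm (mulr_ge0 h2 q0)) -[leRHS]mulr1.
  by apply: (ler_pM h2 q0 _ q1); rewrite ler_wpM2l.
rewrite normrM (ger0_norm (exprn_ge0 n w0)).
apply: ler_pM => //; first exact: exprn_ge0.
  by rewrite lerXn2r.
rewrite (le_trans (HC _))// ler_wpM2l// -[leLHS]real_normK ?num_real//.
rewrite lerXn2r// ?nnegrE ?mulr_ge0 ?addr_ge0 ?sqr_ge0 ?(ltW m0)//.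
rewrite normrM gtr0_norm// ler_wpM2l ?(ltW m0)// (le_trans (ler_normB _ _))//.
rewrite normr1 lerD2l ger0_norm; last by rewrite mulr_ge0 ?sqr_ge0.
by rewrite -[leRHS]mulr1 ler_pM ?sqr_ge0// lerXn2r.
Qed.

End bump_kernel.

(** * Monotonicity of the kernel means of a superharmonic function *)

Section superharmonic_mono.
Context {R : realType} {n : nat}.
Local Notation leb := (@lebesgue_rV R n).
Local Notation U := (@unit_ball R n).
Variable g : 'rV[R]_n -> R.
Hypothesis n0 : (0 < n)%N.
Hypothesis Cg : Cd 2 U g.
Hypothesis g_super : forall x, U x -> laplacian g x <= 0.

Let oU : open U.
Proof. exact: open_unit_ball. Qed.

Let cg (x : 'rV[R]_n) : U x -> {for x, continuous g}.
Proof. exact: (Cd_continuous oU Cg). Qed.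

Lemma measurable_cball r : measurable (@cball R n r).
Proof. exact: closed_measurable_rV (@closed_cball R n r). Qed.

Lemma superharmonic_integrable_cball r : r < 1 ->
  leb.-integrable (cball r) (EFin \o g).
Proof.
by move=> r1; apply: (compact_integrable (@compact_cball _ _ r) oU) => //;
  exact: cball_unit_ball.
Qed.

Lemma continuous_kernel (m : R) (w : R) : continuous (@kernel R n m w).
Proof.
move=> x.
have C0 : Cd 0 setT (@kernel R n m w).
  apply: CdZ; first exact: openT.
  apply: Cd_flat; first exact: openT.
  apply: CdZ; first exact: openT.
  apply: CdB; [exact: openT|exact: Cd_cst openT _ _|].
  apply: CdZ; first exact: openT.
  apply: (eq_Cd openT (g := fun x => enorm (x - 0) ^+ 2)).
    by move=> y _; rewrite subr0.
  exact: Cd_enorm2 openT.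
exact: (Cd_continuous openT C0 (I : setT x)).
Qed.

(** For every [w > u] the kernel is supported in the one ball of radius [u^-1], compactly contained
    in the unit ball, so the integral can be differentiated in [w] over a fixed domain. Larger [w]
    means smaller balls, where a superharmonic function has larger means. *)
Lemma kernel_mean_nondecreasing (m w1 w2 u : R) : 0 < m -> 1 < u -> u < w1 -> w1 <= w2 ->
  \int[leb]_(x in cball u^-1) (kernel m w1 x * g x) <=
  \int[leb]_(x in cball u^-1) (kernel m w2 x * g x).
Proof.
move=> m0 u1 uw1 w12; set B := cball u^-1; pose v := w2 + 1.
have w1v : w1 < v by rewrite /v; lra.
have w2v : w2 < v by rewrite /v; lra.
have u0 : 0 < u by exact: lt_trans u1.
have iu1 : u^-1 < 1 by rewrite invf_lt1.
have BU : B `<=` U by exact: cball_unit_ball.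
have mB : measurable B by exact: measurable_cball.
pose f w x := kernel m w x * g x.
have df (w : R) (x : 'rV[R]_n) : is_derive w 1 (f ^~ x) (kernel' m w x * g x).
  have := is_deriveMR (is_derive_kernel m w x) (is_derive_cst (g x) w (1 : R)).
  by move=> H; apply: is_derive_eq H _; rewrite mulr0 add0r mulrC.
have intf w : leb.-integrable B (EFin \o f w).
  apply: (compact_integrable (@compact_cball _ _ _) oU BU) => x Ux.
  exact: continuousM (@continuous_kernel m w x) (cg Ux).
have d1E (w : R) (x : 'rV[R]_n) : partial1of2 f w x = kernel' m w x * g x.
  by rewrite partial1of2E; have [_] := df w x.
have v0 : 0 <= v by rewrite addr_ge0// (le_trans _ w12)// ltW// (lt_trans u0).
have [C HC] := @kernel'_bound R n m m0 v v0.
have [M HM] := compact_continuous_bound (@compact_cball R n u^-1)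
  (fun x Bx => cg (BU x Bx)).
have iG : leb.-integrable B (EFin \o fun=> `|C| * `|M|).
  by apply: (compact_integrable (@compact_cball _ _ _) oU BU) => x _;
    exact: cst_continuous.
have GC (w : R) (x : 'rV[R]_n) : `]u, v[%classic w -> B x -> `|partial1of2 f w x| <= `|C| * `|M|.
  rewrite /= in_itv/= => /andP[uw wv] Bx; rewrite d1E normrM; apply: ler_pM => //.
    apply: le_trans (HC w x _ _) (ler_norm _).
      by rewrite (ltW wv) ltW// (lt_trans u0).
    by apply: le_trans Bx _; exact: ltW.
  exact: le_trans (HM _ Bx) (ler_norm _).
have derf1 (w : R) (x : 'rV[R]_n) : `]u, v[%classic w -> B x -> derivable (f ^~ x) w 1.
  by move=> _ _; have [] := df w x.
have G0 (x : 'rV[R]_n) : 0 <= `|C| * `|M| by rewrite mulr_ge0.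
have dF w : w \in `]u, v[ -> derivable (fun w => \int[leb]_(x in B) f w x) w 1.
  by move=> wuv; exact: (@derivable_under_integral _ _ _ leb f B mB w u v wuv
    (fun w _ => intf w) derf1 _ G0 iG GC).
have dFE w : w \in `]u, v[ -> (fun w => \int[leb]_(x in B) f w x)^`()%classic w =
    \int[leb]_(x in B) (kernel' m w x * g x).
  move=> wuv; rewrite (@differentiation_under_integral _ _ _ leb f B mB w u v wuv
    (fun w _ => intf w) derf1 _ G0 iG GC).
  by apply: eq_Rintegral => x _; exact: d1E.
apply: (ger0_derive1_le_oo dF); rewrite ?in_itv/= ?w12//; last 2 first.
- by rewrite uw1.
- by rewrite (lt_le_trans uw1).
- move=> w; rewrite in_itv/= => /andP[uw wv].
  have w0 : 0 < w by exact: lt_trans uw.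
  rewrite dFE ?in_itv/= ?uw//.
  set c := w ^+ n / (2 * m * w ^+ 3).
  have c0 : 0 <= c by rewrite divr_ge0 ?mulr_ge0 ?exprn_ge0// ltW.
  have BwB : cball w^-1 `<=` B.
    by move=> x /= xw; rewrite /B /cball/= (le_trans xw)// lef_pV2// ltW.
  have supp x : ~ B x -> kernel_potential m w x = 0.
    by move=> Bx; apply: kernel_potential_support => // /BwB.
  (* Green's formula moves the Laplacian onto [g], where superharmonicity and the sign of
     [kernel_potential] decide the sign of the derivative. *)
  have := green2 oU (@compact_cball R n u^-1) BU Cg (Cd_kernel_potential m 2 w) supp.
  have suppL : forall x, ~ B x -> laplacian (kernel_potential m w) x = 0.
    move=> x Bx; rewrite /laplacian big1// => k _.
    apply: (partial_support k (@closed_cball R n _) _ Bx).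
    exact: partial_support (@closed_cball R n _) supp.
  rewrite (@integral_support _ _ _ leb B U)//; last first.
    by move=> x /suppL ->; rewrite mulr0.
  rewrite (@integral_support _ _ _ leb B U)//; last first.
    by move=> x /supp ->; rewrite mulr0.
  move=> E.
  have -> : \int[leb]_(x in B) (kernel' m w x * g x) =
      \int[leb]_(x in B) (- c * (g x * laplacian (kernel_potential m w) x)).
    by apply: eq_Rintegral => x _; rewrite (kernel'E m0 x n0 w0) -/c; ring.
  have iL : leb.-integrable B (EFin \o
      (fun x => g x * laplacian (kernel_potential m w) x)).
    apply: (compact_integrable (@compact_cball _ _ _) oU BU) => x Ux.
    have CL : Cd 0 setT (laplacian (@kernel_potential R n m w)).
      apply: Cd_sum; first exact: openT.
      by move=> k _; do 2 apply: CdS_partial; exact: Cd_kernel_potential.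
    exact: (continuousM (cg Ux) (Cd_continuous openT CL (I : setT x))).
  rewrite RintegralZl// mulNr oppr_ge0 mulr_ge0_le0// /Rintegral E.
  have LH x : B x -> (0 <= (- (laplacian g x * kernel_potential m w x))%:E)%E.
    move=> Bx; rewrite lee_fin oppr_ge0 mulr_le0_ge0 ?kernel_potential_ge0//.
    by apply: g_super; exact: BU.
  rewrite (_ : (\int[leb]_(x in B) _)%E = (\int[leb]_(x in B)
    (- (- (laplacian g x * kernel_potential m w x))%:E))%E); last first.
    by apply: eq_integral => x _; rewrite -EFinN opprK.
  rewrite integral_ge0N// fineN oppr_le0; apply: fine_ge0.
  exact: integral_ge0.
- move=> w; rewrite inE => wuv; apply: differentiable_continuous; apply/derivable1_diffP; exact: dF.
Qed.

End superharmonic_mono.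

(** * Volumes of balls and integrals of homogeneous functions *)

Section balls.
Context {R : realType} {n : nat}.
Local Notation leb := (@lebesgue_rV R n).

Definition oball (r : R) : set 'rV[R]_n := [set x | enorm x < r].

Lemma oball1 : oball 1 = unit_ball n.
Proof. by apply/seteqP; split=> x; rewrite unit_ballE. Qed.

Lemma open_oball r : open (oball r).
Proof.
apply: (@open_comp _ _ (@enorm R n) [set t | t < r]); last exact: open_lt.
by move=> x _; exact: enorm_continuous.
Qed.

Lemma measurable_oball r : measurable (oball r).
Proof. exact: open_measurable_rV (@open_oball r). Qed.

Lemma oball_cball r : oball r `<=` cball r.
Proof. by move=> x /ltW. Qed.

Lemma oball_lebesgue_lty r : (leb (oball r) < +oo)%E.
Proof.
apply: (bounded_lebesgue_lty (M := r)); first exact: measurable_oball.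
by move=> x xr i; rewrite (le_trans (ler_coord_enorm _ _))// ltW.
Qed.

Lemma unit_ball_lebesgue_gt0 : (0 < leb (unit_ball n))%E.
Proof.
apply: (@open_lebesgue_gt0 _ _ _ 0); first exact: open_unit_ball.
by rewrite unit_ballE enorm0.
Qed.

Definition vol : R := fine (leb (unit_ball n)).

Lemma volE : leb (unit_ball n) = vol%:E.
Proof.
rewrite fineK// ge0_fin_numE ?measure_ge0// -oball1.
exact: oball_lebesgue_lty.
Qed.

Lemma vol_gt0 : 0 < vol.
Proof. by rewrite -lte_fin -volE unit_ball_lebesgue_gt0. Qed.

Lemma ge0_integral_oball_homogeneous (s : R) (F : 'rV[R]_n -> \bar R) : 0 < s ->
  measurable_fun setT F -> (forall x, 0 <= F x)%E ->
  (forall x, F (s *: x) = F x) ->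
  (\int[leb]_(x in oball s) F x = (s ^+ n)%:E * \int[leb]_(x in unit_ball n) F x)%E.
Proof.
move=> s0 mF F0 Fs.
have mFs : measurable_fun setT (F \_ (oball s)).
  by apply/(measurable_restrictT _ (@measurable_oball s)); exact: measurable_funTS.
have Fs0 x : (0 <= (F \_ (oball s)) x)%E.
  by rewrite patchE; case: ifP.
have := ge0_integral_affine 0 s0 mFs Fs0.
have -> : (\int[leb]_x (F \_ (oball s)) (0 + s *: x)%R =
    \int[leb]_x (F \_ (unit_ball n)) x)%E.
  apply: eq_integral => x _; rewrite !patchE add0r Fs.
  have -> : (s *: x \in oball s) = (x \in unit_ball n).
    by apply/idP/idP; rewrite !inE unit_ballE /oball/= enormZ gtr0_norm//
      gtr_pMr.
  by [].
rewrite -!integral_mkcond => ->; rewrite muleA -EFinM divff ?mul1e//.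
by rewrite gt_eqF// exprn_gt0.
Qed.

Lemma lebesgue_oball (s : R) : 0 < s -> leb (oball s) = (s ^+ n * vol)%:E.
Proof.
move=> s0; have := @ge0_integral_oball_homogeneous s (fun=> 1%E) s0.
rewrite !integral_cst//; [|exact: measurable_unit_ball|exact: measurable_oball].
move=> H; rewrite EFinM -volE.
by have := H (measurable_cst _) (fun=> lee01) (fun=> erefl); rewrite !mul1e.
Qed.

Lemma Rintegral_oball_homogeneous (s : R) (h : 'rV[R]_n -> R) : 0 < s ->
  leb.-integrable (unit_ball n) (EFin \o h) -> measurable_fun setT h ->
  (forall x, h (s *: x) = h x) ->
  \int[leb]_(x in oball s) h x = s ^+ n * \int[leb]_(x in unit_ball n) h x.
Proof.
move=> s0 ih mh hs.
have mEh : measurable_fun setT (EFin \o h) by exact/measurable_EFinP.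
have mU := @measurable_unit_ball R n.
rewrite /Rintegral integralE [in RHS]integralE.
rewrite (ge0_integral_oball_homogeneous s0)//; last 2 first.
- exact: measurable_funepos.
- by move=> x; rewrite !funeposE/= hs.
rewrite (ge0_integral_oball_homogeneous s0)//; last 2 first.
- exact: measurable_funeneg.
- by move=> x; rewrite !funenegE/= hs.
have fp := integrable_pos_fin_num mU ih; have fn := integrable_neg_fin_num mU ih.
rewrite -(fineK fp) -(fineK fn) -!EFinM -!EFinB /=.
by rewrite mulrBr.
Qed.

(** Dilation by 2 maps the set to itself, yet scales its finite measure by a power of 2 that differs
    from 1 as [n] is positive. *)
Lemma set1_lebesgue0 : (0 < n)%N -> leb [set 0] = 0%E.
Proof.
move=> n0.
have m0 : measurable [set 0 : 'rV[R]_n].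
  apply: closed_measurable_rV; apply: accessible_closed_set1.
  by apply: hausdorff_accessible; exact: norm_hausdorff.
have f0 : leb [set 0] \is a fin_num.
  rewrite ge0_fin_numE//; apply: (bounded_lebesgue_lty (M := 0)) => // x -> i.
  by rewrite mxE normr0.
have := @affine_lebesgue_rV R n 0 2 [set 0] (ltr0n _ 2) m0.
have -> : [set x : 'rV[R]_n | [set 0] (0 + 2 *: x)] = [set 0].
  apply/seteqP; split=> x /=; last by move=> ->; rewrite scaler0 addr0.
  by rewrite add0r => /eqP; rewrite scaler_eq0 pnatr_eq0/= => /eqP.
rewrite -(fineK f0) -EFinM => -[] /eqP.
rewrite -subr_eq0 -{1}[fine _]mul1r -mulrBl mulf_eq0 => /orP[|/eqP->//].
rewrite subr_eq0 eq_sym invr_eq1 => /eqP H.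
have : 1 < (2 : R) ^+ n by rewrite exprn_egt1 ?ltr1n// -lt0n.
by rewrite H ltxx.
Qed.

End balls.

Lemma compact_uniform_continuous (R : realType) n (A : set 'rV[R]_n)
    (g : 'rV[R]_n -> R) (e : R) :
  compact A -> (forall x, A x -> {for x, continuous g}) -> 0 < e ->
  exists2 d : R, 0 < d & forall x y, A x -> `|x - y| < d -> `|g x - g y| < e.
Proof.
move=> /compact_near_coveringP cA cg e0.
have H : \forall d \near (0 : R)^'+, A `<=`
    [set x | forall y, `|x - y| < d -> `|g x - g y| < e].
  apply: cA => x Ax.
  have e2 : 0 < e / 2 by rewrite divr_gt0.
  have /nbhs_ballP[d /= d0 dg] : nbhs x [set y | `|g x - g y| < e / 2].
    have := cg x Ax; move/cvgrPdist_lt => /(_ _ e2); exact.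
  have d2 : 0 < d / 2 by rewrite divr_gt0.
  exists (ball x (d / 2), [set t | t < d / 2]) => /=.
    by split; [exact: nbhsx_ballx|exact: nbhs_right_lt].
  move=> [y t] /= [xy td] z yz.
  have Hy : ball x d y by apply: le_ball xy; lra.
  have Hz : ball x d z.
    rewrite (_ : d = d / 2 + d / 2); last by lra.
    by apply: ball_triangle xy _; rewrite mx_norm_ball /ball_/= (lt_trans yz).
  have := dg _ Hy; have := dg _ Hz; rewrite /= !ltr_norml.
  by move=> /andP[? ?] /andP[? ?]; apply/andP; split; lra.
have [d [d0 Hd]] : exists d : R, 0 < d /\ A `<=` [set x | forall y, `|x - y| < d -> `|g x - g y| < e].
  near (0 : R)^'+ => d; exists d; split => //.
  by near: d.
by exists d => // x y Ax; exact: Hd.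
Unshelve. all: by end_near. Qed.

Section radial_functions.
Context {R : realType} {n : nat}.
Local Notation leb := (@lebesgue_rV R n).
Local Notation U := (@unit_ball R n).

Lemma radialZ (s : R) (x : 'rV[R]_n) : 0 < s -> radial (s *: x) = radial x.
Proof.
move=> s0; rewrite /radial enormZ gtr0_norm// scalerA invfM mulrAC mulVf ?mul1r//.
by rewrite gt_eqF.
Qed.

Lemma enorm_radial (x : 'rV[R]_n) : x != 0 -> enorm (radial x) = 1.
Proof.
move=> x0; have xn0 : enorm x != 0.
  by apply/eqP => /enorm_eq0/eqP; rewrite (negPf x0).
by rewrite enormZ ger0_norm ?invr_ge0 ?enorm_ge0// mulVf.
Qed.

Lemma enorm_radial_le1 (x : 'rV[R]_n) : enorm (radial x) <= 1.
Proof.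
have [->|/enorm_radial->//] := eqVneq x 0.
by rewrite /radial scaler0 enorm0.
Qed.

Lemma radial_cball (r : R) (x : 'rV[R]_n) : 0 <= r -> cball r (r *: radial x).
Proof.
move=> r0; rewrite /cball/= enormZ ger0_norm// -[leRHS]mulr1.
by rewrite ler_wpM2l// enorm_radial_le1.
Qed.

Variable g : 'rV[R]_n -> R.
Hypothesis cg : forall x, U x -> {for x, continuous g}.
Variable r : R.
Hypotheses (r0 : 0 <= r) (r1 : r < 1).

Lemma measurable_radial_comp : measurable_fun setT (fun x => g (r *: radial x)).
Proof.
have mr : measurable_fun setT (fun x : 'rV[R]_n => r *: radial x).
  apply: measurable_fun_rV => i.
  rewrite (_ : (fun _ => _) = fun x => r * rV_coord i (radial x)).
    apply: measurable_funM => //.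
    by apply: (measurableT_comp (measurable_rV_coord i)); exact: measurable_radial.
  by apply/funext => x; rewrite mxE.
apply: (@measurable_comp _ _ _ _ _ _ U) mr => //.
- exact: measurable_unit_ball.
- by move=> _ [x _ <-]; apply: cball_unit_ball r1 _ _; exact: radial_cball.
- by apply: continuous_measurable_rV => //; exact: open_unit_ball.
Qed.

Lemma radial_integrable t : leb.-integrable (oball t) (EFin \o (fun x => g (r *: radial x))).
Proof.
apply: measurable_bounded_integrable.
- exact: measurable_oball.
- exact: oball_lebesgue_lty.
- exact: measurable_funTS measurable_radial_comp.
have [M HM] := compact_continuous_bound (@compact_cball R n r)
  (fun x Bx => cg (cball_unit_ball r1 Bx)).
exists M; split; first exact: num_real.
by move=> y My x _ /=; rewrite (le_trans (HM _ (radial_cball x r0)))// ltW.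
Qed.

End radial_functions.

(** * Mean value inequalities on balls and on spheres *)

Section superharmonic_ball.
Context {R : realType} {n : nat}.
Local Notation leb := (@lebesgue_rV R n).
Local Notation U := (@unit_ball R n).
Variable g : 'rV[R]_n -> R.
Hypothesis n0 : (0 < n)%N.
Hypothesis Cg : Cd 2 U g.
Hypothesis g_super : forall x, U x -> laplacian g x <= 0.

Let oU : open U.
Proof. exact: open_unit_ball. Qed.

Let cg (x : 'rV[R]_n) : U x -> {for x, continuous g}.
Proof. exact: (Cd_continuous oU Cg). Qed.

Let ig r : r < 1 -> leb.-integrable (oball r) (EFin \o g).
Proof.
move=> r1; apply: (integrableS _ _ (@oball_cball _ _ r)).
- exact: measurable_cball.
- exact: measurable_oball.
- exact: superharmonic_integrable_cball.
Qed.

Lemma kernel_cvg (w : R) (x : 'rV[R]_n) : 0 < w ->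
  kernel k.+1%:R w x @[k --> \oo] --> w ^+ n * \1_(oball w^-1) x.
Proof.
move=> w0; rewrite /kernel; apply: cvgMr; rewrite indicE.
have wx : (enorm x < w^-1) = (0 < 1 - w ^+ 2 * enorm x ^+ 2).
  rewrite subr_gt0 -exprMn -[in RHS](expr1n _ 2) ltr_pXn2r ?nnegrE//; last first.
    by rewrite mulr_ge0 ?enorm_ge0// ltW.
  by rewrite -ltr_pdivlMl// mulr1.
have [xw|xw] := boolP (x \in oball w^-1).
  by apply: softplus'_cvg; rewrite -wx; rewrite inE in xw.
rewrite (_ : (fun _ => _) = fun=> 0); first exact: cvg_cst.
apply/funext => k; rewrite flat_le0// pmulr_rle0 ?ltr0n// leNgt -wx.
by move/negP: xw; rewrite inE => /negP.
Qed.

Lemma kernel_mean_cvg (u w : R) : 1 < u -> u < w ->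
  (\int[leb]_(x in cball u^-1) (kernel k.+1%:R w x * g x)%:E)%E
    @[k --> \oo] -->
  ((w ^+ n)%:E * \int[leb]_(x in oball w^-1) (g x)%:E)%E.
Proof.
move=> u1 uw; have u0 : 0 < u by exact: lt_trans u1.
have w0 : 0 < w by exact: lt_trans uw.
have iu1 : u^-1 < 1 by rewrite invf_lt1.
have iw1 : w^-1 < 1 by rewrite invf_lt1// (lt_trans u1).
have BU : cball u^-1 `<=` U by exact: cball_unit_ball.
have mB := @measurable_cball R n u^-1.
have ioB : oball w^-1 `<=` @cball R n u^-1.
  move=> x /ltW/le_trans; apply; rewrite lef_pV2//; exact: ltW.
pose f x := w ^+ n * (g x * \1_(oball w^-1) x).
have fE : (\int[leb]_(x in cball u^-1) (f x)%:E =
    (w ^+ n)%:E * \int[leb]_(x in oball w^-1) (g x)%:E)%E.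
  rewrite (@integral_support _ _ _ leb (oball w^-1) (cball u^-1))//; last first.
    by move=> x xw; rewrite /f indicE memNset// !mulr0.
  rewrite -integralZl//; last 2 first.
  - exact: measurable_oball.
  - exact: ig.
  by apply: eq_integral => x xw; rewrite /f indicE xw mulr1 EFinM.
rewrite -fE.
have igB : leb.-integrable (cball u^-1) (EFin \o g).
  exact: superharmonic_integrable_cball.
have mg : measurable_fun (cball u^-1) g.
  by apply/measurable_EFinP; exact: measurable_int igB.
have mk (m : R) : measurable_fun (cball u^-1) (@kernel R n m w).
  apply: measurable_funTS; apply: (continuous_measurable_rV openT) => x _.
  exact: continuous_kernel.
have [] := @dominated_convergence _ _ R leb _ mB
  (fun k x => (kernel k.+1%:R w x * g x)%:E) (EFin \o f)
  (fun x => ((w ^+ n)%:E * `|(EFin \o g) x|)%E).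
- by move=> k; apply/measurable_EFinP; exact: measurable_funM.
- apply/measurable_EFinP; apply: measurable_funM => //; apply: measurable_funM => //.
  by apply: measurable_indic; exact: measurable_oball.
- apply: aeW => x Bx; apply: cvg_EFin; first exact: nearW.
  rewrite /f [g x * _]mulrC mulrA; apply: cvgMl; exact: kernel_cvg.
- apply: integrableZl => //; exact: integrable_abse.
- apply: aeW => x k Bx; rewrite /= -EFinM lee_fin normrM ler_wpM2r//.
  have /andP[k0 k1] := @kernel_bound R n k.+1%:R w x (ltW w0).
  by rewrite ger0_norm.
by [].
Qed.

(** The limit of [kernel_mean_nondecreasing] between [w = r2^-1] and [w = r1^-1] as the kernels
    sharpen to [w ^+ n] times indicators of balls; the means are cross-multiplied by the powers of
    the radii. *)
Lemma ball_mean_nonincreasing (r1 r2 : R) : 0 < r1 -> r1 <= r2 -> r2 < 1 ->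
  r1 ^+ n * \int[leb]_(x in oball r2) g x <=
  r2 ^+ n * \int[leb]_(x in oball r1) g x.
Proof.
move=> r10 r12 r21; have r20 : 0 < r2 by exact: lt_le_trans r12.
have w21 : 1 < r2^-1 by rewrite invf_gt1.
(* Strictly between 1 and [r2^-1]: the ball of radius [u^-1] contains both balls and stays away from
   the unit sphere. *)
pose u := (1 + r2^-1) / 2; have u1 : 1 < u by rewrite /u; lra.
have ur2 : u < r2^-1 by rewrite /u; lra.
have r21' : r2^-1 <= r1^-1 by rewrite lef_pV2.
have c2 := kernel_mean_cvg u1 ur2.
have c1 := kernel_mean_cvg u1 (lt_le_trans ur2 r21').
rewrite !invrK in c1 c2.
have i1 : (\int[leb]_(x in oball r1) (g x)%:E)%E \is a fin_num.
  by apply: integrable_fin_num; [exact: measurable_oball|exact/ig/le_lt_trans/r21].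
have i2 : (\int[leb]_(x in oball r2) (g x)%:E)%E \is a fin_num.
  by apply: integrable_fin_num; [exact: measurable_oball|exact: ig].
suff : ((r2^-1 ^+ n)%:E * \int[leb]_(x in oball r2) (g x)%:E <=
        (r1^-1 ^+ n)%:E * \int[leb]_(x in oball r1) (g x)%:E)%E.
  rewrite -(fineK i1) -(fineK i2) -!EFinM lee_fin -!/(Rintegral _ _ _).
  by rewrite !exprVn ler_pdivrMl ?exprn_gt0// mulrCA ler_pdivlMl ?exprn_gt0.
apply: (lee_cvg_to c2 c1); apply: nearW => k.
have iu1 : u^-1 < 1 by rewrite invf_lt1// (lt_trans _ u1).
have fin w : (\int[leb]_(x in cball u^-1) (kernel k.+1%:R w x * g x)%:E)%E \is a fin_num.
  apply: integrable_fin_num; first exact: measurable_cball.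
  apply: (compact_integrable (@compact_cball _ _ _) oU).
    exact: cball_unit_ball.
  by move=> x Ux; exact: continuousM (@continuous_kernel _ _ _ _ x) (cg Ux).
rewrite -(fineK (fin _)) -(fineK (fin r1^-1)) lee_fin.
exact: kernel_mean_nondecreasing.
Qed.

(** Monotonicity compares the mean with that over a small ball of radius [t], on which continuity
    gives [g < g 0 + e']. *)
Lemma ball_mean_le (r : R) : 0 < r -> r < 1 ->
  \int[leb]_(x in oball r) g x <= r ^+ n * (@vol R n * g 0).
Proof.
move=> r0 r1; suff main (e : R) : 0 < e ->
    \int[leb]_(x in oball r) g x <= r ^+ n * (@vol R n * g 0) + e.
  by apply/ler_addgt0Pr.
move=> e0.
have U0 : U 0 by rewrite unit_ballE enorm0.
pose e' := e / (r ^+ n * @vol R n).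
have rv : 0 < r ^+ n * @vol R n by rewrite mulr_gt0 ?exprn_gt0 ?vol_gt0.
have e'0 : 0 < e' by rewrite divr_gt0.
have /nbhs_ballP[d /= d0 dg] : nbhs (0 : 'rV[R]_n) [set y | `|g 0 - g y| < e'].
  by have := cg U0; move/cvgrPdist_lt => /(_ _ e'0); exact.
pose t := Num.min (d / 2) (r / 2).
have t0 : 0 < t by rewrite lt_min !divr_gt0.
have tr : t < r by rewrite (@le_lt_trans _ _ (r / 2)) ?ge_min ?lexx ?orbT//; lra.
have td : t < d by rewrite (@le_lt_trans _ _ (d / 2)) ?ge_min ?lexx ?orbT//; lra.
have t1 : t < 1 by exact: lt_trans r1.
have H1 : \int[leb]_(x in oball t) g x <= t ^+ n * (@vol R n * (g 0 + e')).
  have -> : t ^+ n * (@vol R n * (g 0 + e')) = \int[leb]_(x in oball t) (g 0 + e').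
    rewrite Rintegral_cst; last exact: measurable_oball.
    transitivity ((g 0 + e') * fine (t ^+ n * @vol R n)%:E).
      by rewrite /=; ring.
    by congr (_ * fine _); rewrite -lebesgue_oball.
  apply: le_Rintegral.
  - exact: measurable_oball.
  - exact: ig.
  - apply: (integrableS _ _ (@oball_cball _ _ t)).
    + exact: measurable_cball.
    + exact: measurable_oball.
    + by apply: (compact_integrable (@compact_cball _ _ _) openT) => // x _;
        exact: cst_continuous.
  - move=> x xt; have := dg x; rewrite mx_norm_ball /ball_/= sub0r normrN.
    move=> /(_ (le_lt_trans (norm_le_enorm x) (lt_trans xt td))).
    by rewrite ltr_norml => /andP[? ?]; lra.
have H2 := ball_mean_nonincreasing t0 (ltW tr) r1.
rewrite -(ler_pM2l (exprn_gt0 n t0)) (le_trans H2)//.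
rewrite (le_trans (ler_wpM2l (exprn_ge0 n (ltW r0)) H1))//.
rewrite mulrCA ler_pM2l ?exprn_gt0// mulrDr mulrDr lerD2l mulrA /e'.
by rewrite mulrCA divff ?mulr1// gt_eqF.
Qed.

(** On a thin shell between radii [t] and [r], [g] is uniformly close to its radial projection [h].
    The integral of [h] over the shell is [r ^+ n - t ^+ n] times its integral over the unit ball,
    by homogeneity; that of [g] is at most [r ^+ n - t ^+ n] times [vol * g 0], by combining
    [ball_mean_nonincreasing] and [ball_mean_le]. The common factor cancels. *)
Lemma superharmonic_radial_mean (r : R) : 0 < r -> r < 1 ->
  \int[leb]_(x in U) g (r *: radial x) <= @vol R n * g 0.
Proof.
move=> r0 r1; set h := fun x => g (r *: radial x).
have hs (s : R) x : 0 < s -> h (s *: x) = h x.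
  by move=> s0; rewrite /h radialZ.
have ih t : leb.-integrable (oball t) (EFin \o h).
  exact: (radial_integrable cg (ltW r0) r1).
have mh : measurable_fun setT h by exact: (measurable_radial_comp cg (ltW r0) r1).
have ihU : leb.-integrable U (EFin \o h) by rewrite -oball1.
have vg0 := @vol_gt0 R n.
suff main (e : R) : 0 < e ->
    \int[leb]_(x in U) h x <= @vol R n * g 0 + e.
  by apply/ler_addgt0Pr.
move=> e0; pose e' := e / @vol R n.
have e'0 : 0 < e' by rewrite divr_gt0.
have BU : cball r `<=` U by exact: cball_unit_ball.
have [d d0 Hd] := compact_uniform_continuous (@compact_cball R n r)
  (fun x Bx => cg (BU x Bx)) e'0.
(* Positive, and closer to [r] than the modulus of continuity [d]. *)
pose t := Num.max (r / 2) (r - d / 2).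
have t0 : 0 < t by rewrite lt_max divr_gt0.
have tr : t < r by rewrite gt_max; apply/andP; split; lra.
have rtd : r - t < d.
  have : r - d / 2 <= t by rewrite le_max lexx orbT.
  lra.
have t1 : t < 1 by exact: lt_trans r1.
have tn0 := exprn_gt0 n t0; have rn0 := exprn_gt0 n r0.
have trn : t ^+ n < r ^+ n by rewrite ltr_pXn2r ?nnegrE// ltW.
pose S := oball r `\` @oball R n t.
have mS : measurable S by apply: measurableD; exact: measurable_oball.
have tor : oball t `<=` @oball R n r by move=> x /lt_trans; apply.
have shell f : leb.-integrable (oball r) (EFin \o f) ->
    \int[leb]_(x in S) f x =
    \int[leb]_(x in oball r) f x - \int[leb]_(x in oball t) f x.
  move=> if_; rewrite -[in X in X - _](setDUK tor).
  rewrite Rintegral_setU ?setDUK//; first by rewrite addrAC subrr add0r.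
    exact: measurable_oball.
  by apply/disj_setPS => x [? []].
have gh : \int[leb]_(x in S) h x <= \int[leb]_(x in S) (g x + e').
  apply: le_Rintegral => //.
  - by apply: (integrableS _ _ (@subDsetl _ (oball r) (oball t)) (ih r)) => //; exact: measurable_oball.
  - apply: (integrableS _ _ (@subDsetl _ (oball r) (oball t))) => //.
      exact: measurable_oball.
    apply: (integrableS _ _ (@oball_cball _ _ r)).
    + exact: measurable_cball.
    + exact: measurable_oball.
    + apply: (compact_integrable (@compact_cball _ _ _) oU BU) => x Ux.
      by apply: continuousD; [exact: cg|exact: cst_continuous].
  - move=> x [xr /negP xt]; rewrite -leNgt in xt.
    have x0 : 0 < enorm x by exact: lt_le_trans xt.
    have : `|g x - h x| < e'.
      apply: Hd; first exact: ltW.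
      rewrite (le_lt_trans (norm_le_enorm _))//.
      rewrite /radial scalerA -[X in X - _]scale1r -scalerBl enormZ.
      rewrite -[X in _ * X]gtr0_norm// -normrM mulrBl mul1r mulfVK ?gt_eqF//.
      by rewrite ltr0_norm; rewrite /oball/= in xr; lra.
    by rewrite ltr_norml => /andP[? ?]; lra.
have igr := ig r1.
have iC : leb.-integrable (oball r) (EFin \o fun=> e').
  apply: (integrableS _ _ (@oball_cball _ _ r)).
  + exact: measurable_cball.
  + exact: measurable_oball.
  + by apply: (compact_integrable (@compact_cball _ _ _) openT) => // x _;
      exact: cst_continuous.
have E1 : \int[leb]_(x in S) h x = (r ^+ n - t ^+ n) * \int[leb]_(x in U) h x.
  rewrite shell// (Rintegral_oball_homogeneous r0 ihU mh (fun x => hs r x r0)).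
  by rewrite (Rintegral_oball_homogeneous t0 ihU mh (fun x => hs t x t0)) mulrBl.
have E2 : \int[leb]_(x in S) (g x + e') <=
    (r ^+ n - t ^+ n) * (@vol R n * g 0 + e).
  rewrite RintegralD//; last 2 first.
  - by apply: (integrableS _ _ (@subDsetl _ (oball r) (oball t)) igr) => //; exact: measurable_oball.
  - by apply: (integrableS _ _ (@subDsetl _ (oball r) (oball t)) iC) => //; exact: measurable_oball.
  have -> : \int[leb]_(x in S) e' = (r ^+ n - t ^+ n) * e.
    rewrite shell// !Rintegral_cst; try exact: measurable_oball.
    have -> : fine (leb (oball r)) = r ^+ n * @vol R n.
      by have -> := lebesgue_oball r0.
    have -> : fine (leb (oball t)) = t ^+ n * @vol R n.
      by have -> := lebesgue_oball t0.
    by rewrite /e'; field; rewrite gt_eqF.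
  rewrite shell// mulrDr lerD2r.
  have A1 := ball_mean_nonincreasing t0 (ltW tr) r1.
  have A2 := ball_mean_le r0 r1.
  rewrite -(ler_pM2l rn0).
  apply: (@le_trans _ _ ((r ^+ n - t ^+ n) * \int[leb]_(x in oball r) g x)).
    by rewrite mulrBr mulrBl lerB.
  by rewrite mulrCA ler_pM2l ?subr_gt0.
by rewrite -(@ler_pM2l _ (r ^+ n - t ^+ n)) ?subr_gt0// -E1 (le_trans gh).
Qed.

End superharmonic_ball.

(** * Integration over the unit sphere *)

Section sphere.
Context {R : realType} {n : nat}.
Local Notation leb := (@lebesgue_rV R n).
Local Notation U := (@unit_ball R n).
Local Notation S := (@unit_sphere R n).
Hypothesis n0 : (0 < n)%N.

Lemma measurable_unit_sphere : measurable S.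
Proof.
have -> : S = @enorm R n @^-1` [set 1] by [].
rewrite -[X in measurable X]setTI; apply: measurable_enorm => //.
Qed.

Lemma ge0_integral_mrestr d (T : measurableType d) (mu : {measure set T -> \bar R})
    (D A : set T) (mD : measurable D) (f : T -> \bar R) :
  measurable A -> measurable_fun A f -> (forall x, A x -> 0 <= f x)%E ->
  (\int[mrestr mu mD]_(x in A) f x = \int[mu]_(x in A `&` D) f x)%E.
Proof.
move=> mA mf f0.
have mAD : measurable (A `&` D) by exact: measurableI.
have E : (\int[mrestr mu mD]_(x in A) f x = \int[mrestr mu mD]_(x in A `&` D) f x)%E.
  rewrite (ge0_negligible_integral (measurableC mD) mA mf f0); last first.
    by rewrite -[LHS]/(mu (~` D `&` D)) setICl measure0.
  by rewrite setDE setCK.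
rewrite E; apply: eq_measure_integral => B mB BAD.
by rewrite -[LHS]/(mu (B `&` D)) setIidl// => x /BAD[].
Qed.

(** Unfolds the definition of the surface measure by cones; the origin is excluded because
    [radial 0 = 0] lies off the sphere. *)
Lemma ge0_integral_sphere (F : 'rV[R]_n -> \bar R) :
  measurable_fun S F -> (forall z, S z -> 0 <= F z)%E ->
  (\int[sphere_measure n]_(z in S) F z =
   (@vol R n)^-1%:E * \int[leb]_(x in U `\ 0%R) F (radial x))%E.
Proof.
move=> mF F0.
have mU := @measurable_unit_ball R n.
have mS := measurable_unit_sphere.
have E0 : @radial R n @^-1` S `&` U = U `\ 0%R.
  apply/seteqP; split=> x /=.
    move=> [Sx Ux]; split => // x0; move: Sx; rewrite /unit_sphere/= x0.
    by rewrite /radial scaler0 enorm0 => /eqP; rewrite eq_sym oner_eq0.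
  by move=> [Ux /eqP x0]; split => //; exact: enorm_radial.
have mrS : measurable (@radial R n @^-1` S).
  by rewrite -[X in measurable X]setTI; exact: measurable_radial.
have mFr : measurable_fun (@radial R n @^-1` S) (F \o @radial R n).
  apply: (@measurable_comp _ _ _ _ _ _ S) => //.
    by move=> _ [x Sx <-].
  by apply: measurable_funTS; exact: measurable_radial.
rewrite /sphere_measure (ge0_integral_pushforward (@measurable_radial R n))//; last first.
  by move=> z; rewrite inE; exact: F0.
rewrite ge0_integral_mrestr//; last by move=> x; exact: F0.
rewrite E0 /normalized_volume ge0_integral_mscale//.
- by rewrite -E0; exact: measurableI.
- by rewrite -E0; apply: measurable_funS mFr => //; exact: subIsetl.
- by rewrite -E0 => x [+ _]; exact: F0.
Qed.

Lemma sphere_unit_ball (r : R) z : 0 <= r < 1 -> S z -> U (r *: z).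
Proof.
move=> /andP[r0 r1] Sz; apply: (cball_unit_ball r1).
by rewrite /cball/= enormZ ger0_norm// Sz mulr1.
Qed.

Lemma measurable_sphere_comp d (T : measurableType d) (g : 'rV[R]_n -> T) (r : R) :
  measurable_fun U g -> 0 <= r < 1 -> measurable_fun S (fun z => g (r *: z)).
Proof.
move=> mg r01; have mU := @measurable_unit_ball R n.
have mz : measurable_fun S (fun z : 'rV[R]_n => r *: z).
  apply: measurable_funTS; apply: measurable_fun_rV => i.
  rewrite (_ : (fun _ => _) = fun x => r * rV_coord i x).
    by apply: measurable_funM => //; exact: measurable_rV_coord.
  by apply/funext => x; rewrite mxE.
apply: (measurable_comp mU _ mg mz).
by move=> _ [z Sz <-]; exact: sphere_unit_ball.
Qed.

Lemma sphere_mean_radial (g : 'rV[R]_n -> R) (r : R) :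
  (forall x, U x -> {for x, continuous g}) -> 0 <= r -> r < 1 ->
  (forall x, U x -> 0 <= g x) ->
  (\int[sphere_measure n]_(z in S) (g (r *: z))%:E =
   ((@vol R n)^-1 * \int[leb]_(x in U) g (r *: radial x))%:E)%E.
Proof.
move=> cg r0 r1 g0.
have mS := measurable_unit_sphere.
have mU := @measurable_unit_ball R n.
have rU (x : 'rV[R]_n) : enorm x <= 1 -> U (r *: x).
  move=> x1; apply: (cball_unit_ball r1); rewrite /cball/= enormZ ger0_norm//.
  by rewrite -[leRHS]mulr1 ler_wpM2l.
rewrite ge0_integral_sphere; last 2 first.
- apply/measurable_EFinP; apply: measurable_sphere_comp; last by rewrite r0.
  by apply: continuous_measurable_rV => //; exact: open_unit_ball.
- by move=> z Sz; rewrite lee_fin g0//; apply: rU; rewrite Sz.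
have m0 : measurable [set 0 : 'rV[R]_n].
  apply: closed_measurable_rV; apply: accessible_closed_set1.
  by apply: hausdorff_accessible; exact: norm_hausdorff.
rewrite -(ge0_negligible_integral m0 mU); last 3 first.
- apply/measurable_EFinP; apply: measurable_funTS.
  exact: (measurable_radial_comp cg r0 r1).
- by move=> x _; rewrite lee_fin g0//; apply: rU; exact: enorm_radial_le1.
- exact: set1_lebesgue0.
rewrite EFinM /Rintegral fineK//; apply: integrable_fin_num => //.
by rewrite -oball1; exact: (radial_integrable cg r0 r1).
Qed.

(** The superharmonic function is split into two nonnegative parts, each with its own sphere
    integral in the extended reals. For the main estimate [u] is [W^b] and [v] collects the
    correction terms. *)
Lemma superharmonic_sphere (u v : 'rV[R]_n -> R) (r : R) :
  Cd 2 U (fun x => u x - v x) ->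
  (forall x, U x -> laplacian (fun x => u x - v x) x <= 0) ->
  (forall x, U x -> {for x, continuous u}) ->
  (forall x, U x -> {for x, continuous v}) ->
  (forall x, U x -> 0 <= u x) -> (forall x, U x -> 0 <= v x) ->
  0 < r -> r < 1 ->
  (\int[sphere_measure n]_(z in S) (u (r *: z))%:E <=
   (u 0 - v 0)%:E + \int[sphere_measure n]_(z in S) (v (r *: z))%:E)%E.
Proof.
move=> Cuv suv cu cv u0 v0 r0 r1.
have mU := @measurable_unit_ball R n.
rewrite !sphere_mean_radial ?(ltW r0)// -EFinD lee_fin.
have := superharmonic_radial_mean n0 Cuv suv r0 r1.
rewrite RintegralB//; last 2 first.
- by rewrite -oball1; exact: (radial_integrable cu (ltW r0) r1).
- by rewrite -oball1; exact: (radial_integrable cv (ltW r0) r1).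
rewrite lerBlDr => H.
rewrite ler_pdivrMl ?vol_gt0// mulrDr mulrA divff ?mul1r//.
by rewrite gt_eqF// vol_gt0.
Qed.

End sphere.

(** * Weak partial derivatives *)

Section box_test_functions.
Context {R : realType} {n : nat}.

Definition box_bump (a b x : 'rV[R]_n) : R :=
  \prod_i (flat 1 (x ord0 i - a ord0 i) * flat 1 (b ord0 i - x ord0 i)).

Lemma Cd_box_bump d a b : Cd d setT (box_bump a b).
Proof.
apply: Cd_prod; first exact: openT.
move=> i _; apply: CdM; first exact: openT.
- apply: Cd_flat; first exact: openT.
  apply: CdB; first exact: openT; [exact: Cd_coord openT _ _|exact: Cd_cst openT _ _].
- apply: Cd_flat; first exact: openT.
  apply: CdB; first exact: openT; [exact: Cd_cst openT _ _|exact: Cd_coord openT _ _].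
Qed.

Lemma box_bump_ge0 a b x : 0 <= box_bump a b x.
Proof. by apply: prodr_ge0 => i _; rewrite mulr_ge0 ?flat1_ge0. Qed.

Lemma box_bump_le1 a b x : box_bump a b x <= 1.
Proof.
apply: prodr_ile1 => i _; rewrite mulr_ge0 ?flat1_ge0//=.
by rewrite mulr_ile1 ?flat1_ge0 ?(ltW (flat1_lt1 _)).
Qed.

Lemma box_bump_gt0 a b x : obox a b x -> 0 < box_bump a b x.
Proof.
move=> abx; apply: prodr_gt0 => i _; have /andP[h1 h2] := abx i.
by rewrite mulr_gt0// flat1_gt0// subr_gt0.
Qed.

Lemma box_bump_out a b x : ~ obox a b x -> box_bump a b x = 0.
Proof.
move=> /existsNP[i abx]; rewrite /box_bump (bigD1 i)//=.
have [h|h] := lerP (x ord0 i) (a ord0 i).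
  by rewrite [flat 1 (x ord0 i - _)]flat_le0 ?subr_le0// !mul0r.
rewrite [flat 1 (b ord0 i - _)]flat_le0 ?mulr0 ?mul0r// subr_le0 leNgt.
by apply/negP => xb; apply: abx; rewrite h.
Qed.

(* Increases to the indicator of the box as [m] grows. *)
Definition box_step (m : nat) (a b x : 'rV[R]_n) : R :=
  1 - (1 - box_bump a b x) ^+ m.+1.

Lemma box_step_test m a b (U : set 'rV[R]_n) :
  cbox a b `<=` U -> test_function U (box_step m a b).
Proof.
move=> abU; split.
  move=> d; apply: CdB; [exact: openT|exact: Cd_cst openT _ _|].
  apply: CdX; first exact: openT.
  by apply: CdB; [exact: openT|exact: Cd_cst openT _ _|exact: Cd_box_bump].
exists (cbox a b); split => //; first exact: compact_cbox.
move=> x abx; rewrite /box_step box_bump_out ?subr0 ?expr1n ?subrr//.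
by move=> /obox_cbox.
Qed.

Lemma box_step_bound m a b x : 0 <= box_step m a b x <= 1.
Proof.
have b0 := box_bump_ge0 a b x; have b1 := box_bump_le1 a b x.
have p0 : 0 <= 1 - box_bump a b x by rewrite subr_ge0.
have p1 : 1 - box_bump a b x <= 1 by rewrite gerBl.
by rewrite subr_ge0 exprn_ile1//= gerBl exprn_ge0.
Qed.

Lemma box_step_cvg a b x :
  box_step m a b x @[m --> \oo] --> (\1_(obox a b) x : R).
Proof.
rewrite indicE; have [abx|abx] := boolP (x \in obox a b).
  rewrite inE in abx; rewrite -[X in _ --> X]subr0.
  apply: cvgB; first exact: cvg_cst.
  have b0 := box_bump_gt0 abx; have b1 := box_bump_le1 a b x.
  have H : (fun m => (1 - box_bump a b x) ^+ m) @ \oo --> 0.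
    apply: cvg_expr; rewrite ger0_norm ?subr_ge0//.
    by rewrite gtrBl.
  by have := H; rewrite -(cvg_shiftS _).
rewrite (_ : (fun _ => _) = fun=> 0); first exact: cvg_cst.
apply/funext => m; rewrite /box_step box_bump_out ?subr0 ?expr1n ?subrr//.
by move/negP: abx; rewrite inE.
Qed.

End box_test_functions.

(** * The du Bois-Reymond lemma *)

Section du_bois_reymond.
Context {R : realType} {n : nat}.
Local Notation leb := (@lebesgue_rV R n).
Implicit Types (U : set 'rV[R]_n) (u : 'rV[R]_n -> R).

(** Boxes are stable under intersection ([obox_setI]), so this description feeds the Dynkin argument
    of [ae_obox_eq0]. Each half-space of a coordinate is open, hence a countable union of rational
    boxes. *)
Lemma measurable_rV_gen_obox : @measurable _ 'rV[R]_n =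
  <<s [set E | exists a b : 'rV[R]_n, E = obox a b] >>.
Proof.
set G := [set E | exists a b : 'rV[R]_n, E = obox a b].
apply/seteqP; split; last first.
  apply: smallest_sub; first exact: sigma_algebra_measurable.
  by move=> _ [a [b ->]]; exact: measurable_obox.
apply: smallest_sub; first exact: smallest_sigma_algebra.
move=> A; rewrite -bigcup_seq => -[/= i _ [B mB <-]].
pose GT := g_sigma_algebraType G.
have mc : measurable_fun [set: GT] (fun x : GT => (x : 'rV[R]_n) ord0 i).
  apply: (measurability _ (RGenOInfty.measurableE R)).
  move=> _ [_ [c ->] <-]; rewrite setTI.
  have oA : open [set x : 'rV[R]_n | c < x ord0 i].
    apply: (@open_comp _ _ (fun x : 'rV[R]_n => x ord0 i) [set t | c < t]).
      by move=> x _; exact: coord_continuous.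
    exact: open_gt.
  have -> : (fun x : GT => (x : 'rV[R]_n) ord0 i) @^-1` `]c, +oo[%classic =
      [set x : 'rV[R]_n | c < x ord0 i].
    by apply/seteqP; split=> x /=; rewrite in_itv/= andbT.
  rewrite (open_obox_rat oA) bigcup_mkcond.
  apply: (@countable_bigcupT_measurable _ GT) => // p.
  case: ifP => // _; apply: sub_sigma_algebra.
  by exists (map_mx ratr p.1), (map_mx ratr p.2).
by have := mc measurableT _ mB; rewrite setTI.
Qed.

Lemma locally_Lp1_integrable U u (A : set 'rV[R]_n) : measurable U ->
  locally_Lp 1 U u -> compact A -> A `<=` U -> leb.-integrable A (EFin \o u).
Proof.
move=> mU [mu_ ui] cA AU; apply/integrableP; split.
  apply/measurable_EFinP; apply: measurable_funS mu_ => //.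
apply: le_lt_trans (ui A cA AU); rewrite le_eqVlt; apply/orP; left; apply/eqP.
by apply: eq_integral => x _; rewrite /= powRr1.
Qed.

Variables (U : set 'rV[R]_n) (u : 'rV[R]_n -> R).
Hypothesis oU : open U.
Hypothesis iu : forall A, compact A -> A `<=` U -> leb.-integrable A (EFin \o u).
Hypothesis Hu : forall phi, test_function U phi ->
  (\int[leb]_(x in U) (u x * phi x)%:E = 0)%E.

(** The test functions [box_step m a b] are bounded by 1 and tend to the indicator of the box, so
    dominated convergence applies. *)
Lemma integral_obox_eq0 (a b : 'rV[R]_n) : cbox a b `<=` U ->
  (\int[leb]_(x in obox a b) (u x)%:E = 0)%E.
Proof.
move=> abU.
have mC : measurable (cbox a b) by exact: compact_measurable_rV (@compact_cbox _ _ a b).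
have mO := @measurable_obox R n a b.
have iuC := iu (@compact_cbox _ _ a b) abU.
have mu_ : measurable_fun (cbox a b) u by apply/measurable_EFinP; exact: measurable_int iuC.
have step0 m x : ~ cbox a b x -> box_step m a b x = 0.
  move=> abx; rewrite /box_step box_bump_out ?subr0 ?expr1n ?subrr//.
  by move=> /obox_cbox.
have E m : (\int[leb]_(x in cbox a b) (u x * box_step m a b x)%:E = 0)%E.
  rewrite -(Hu (box_step_test m abU)); apply/esym/integral_support => //.
  by move=> x abx; rewrite step0// mulr0.
have [] := @dominated_convergence _ _ R leb _ mC
  (fun m x => (u x * box_step m a b x)%:E) (fun x => (u x * \1_(obox a b) x)%:E)
  (abse \o (EFin \o u)).
- move=> m; apply/measurable_EFinP; apply: measurable_funM => //.
  apply: measurable_funTS; apply: (continuous_measurable_rV openT) => x _.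
  have [Cs _] := box_step_test m abU.
  exact: (Cd_continuous openT (Cs 0) (I : setT x)).
- by apply/measurable_EFinP; exact: measurable_funM.
- apply: aeW => x Bx; apply: cvg_EFin; first exact: nearW.
  by apply: cvgMr; exact: box_step_cvg.
- exact: integrable_abse.
- apply: aeW => x m Bx; rewrite /= lee_fin normrM.
  have /andP[s0 s1] := box_step_bound m a b x.
  by rewrite (ger0_norm s0) ler_piMr.
move=> _ _; rewrite (_ : [sequence _]_m = fun=> 0%E); last exact/funext/E.
move=> /(cvg_unique (@ereal_hausdorff R) (cvg_cst _)) H.
rewrite (@integral_support _ _ _ leb (obox a b) (cbox a b)) in H; last 2 first.
- exact: obox_cbox.
- by move=> x abx; rewrite indicE memNset// mulr0.
rewrite [RHS]H; apply: eq_integral => x abx.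
by rewrite indicE abx mulr1.
Qed.

Lemma obox_setI (a b c d : 'rV[R]_n) : obox a b `&` obox c d =
  obox (\row_i Num.max (a ord0 i) (c ord0 i)) (\row_i Num.min (b ord0 i) (d ord0 i)).
Proof.
apply/seteqP; split=> x /=.
  move=> [h1 h2] i; rewrite !mxE gt_max lt_min.
  by have /andP[-> ->] := h1 i; have /andP[-> ->] := h2 i.
by move=> h; split=> i; have := h i; rewrite !mxE gt_max lt_min =>
  /andP[/andP[h1 h2] /andP[h3 h4]]; apply/andP.
Qed.

(** By Dynkin's theorem the integral of [u] vanishes over the trace of every measurable set on the
    box, not only over subboxes; an integrable function with this property is null. *)
Lemma ae_obox_eq0 (a b : 'rV[R]_n) : cbox a b `<=` U ->
  {ae leb, forall x, obox a b x -> u x = 0}.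
Proof.
move=> abU; have mQ := @measurable_obox R n a b.
have iuQ : leb.-integrable (obox a b) (EFin \o u).
  apply: (integrableS _ mQ (@obox_cbox _ _ a b)).
    exact: compact_measurable_rV (@compact_cbox _ _ a b).
  exact: iu (@compact_cbox _ _ a b) abU.
have iuE E : measurable E -> leb.-integrable (E `&` obox a b) (EFin \o u).
  by move=> mE; apply: integrableS iuQ => //; exact: measurableI.
have Q0 := integral_obox_eq0 abU.
pose P (E : set 'rV[R]_n) := (\int[leb]_(x in E `&` obox a b) (u x)%:E = 0)%E.
pose G := [set E : set 'rV[R]_n | exists a b : 'rV[R]_n, E = obox a b].
have PE : forall E, <<s G >> E -> P E.
  apply: (@dynkin_induction _ _ G P measurable_rV_gen_obox).
  - by move=> _ _ [a1 [b1 ->]] [a2 [b2 ->]]; rewrite obox_setI; eexists; eexists.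
  - by rewrite /P setTI.
  - move=> _ [c [d ->]]; rewrite /P obox_setI; apply: integral_obox_eq0.
    apply: subset_trans abU => x xcd i; have := xcd i; rewrite !mxE.
    by rewrite ge_max le_min => /andP[/andP[_ ->] /andP[_ ->]].
  - move=> E mE PE; rewrite /P.
    have := Q0; rewrite -[in X in X -> _](setTI (obox a b)) -(setUv E) setIUl.
    rewrite integral_setU//; last 4 first.
    + exact: measurableI.
    + by apply: measurableI => //; exact: measurableC.
    + by rewrite -setIUl setUv setTI; exact: measurable_int iuQ.
    + by apply/disj_setPS => x [[? _] [? _]].
    by move: PE; rewrite /P => ->; rewrite add0e.
  - move=> F mF tF PF; rewrite /P setI_bigcupl integral_bigcup//.
    + by apply: eseries0 => k _ _; exact: PF.
    + exact: trivIset_setIr.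
    + by move=> k; exact: measurableI.
    + by rewrite -setI_bigcupl; apply: iuE; exact: bigcupT_measurable.
have := @integral_ae_eq _ _ _ leb _ mQ (fun=> 0%E) (EFin \o u) iuQ.
have H E : E `<=` obox a b -> measurable E ->
    (\int[leb]_(x in E) (EFin \o u) x = \int[leb]_(x in E) 0)%E.
  move=> EQ mE; rewrite integral0.
  have : P E by apply: PE; rewrite -measurable_rV_gen_obox.
  by rewrite /P setIidl.
move=> /(_ (measurable_cst _) H); apply: filterS => x /= xQ /xQ.
by case.
Qed.

(** Countably many rational boxes with closed box inside [U] cover [U], so the exceptional sets form
    a countable union of null sets. *)
Lemma du_bois_reymond : {ae leb, forall x, U x -> u x = 0}.
Proof.
pose N (p : 'rV[rat]_n * 'rV[rat]_n) : set 'rV[R]_n :=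
  if `[< @cbox R n (map_mx ratr p.1) (map_mx ratr p.2) `<=` U >]
  then ~` [set x | obox (map_mx ratr p.1) (map_mx ratr p.2) x -> u x = 0] else set0.
have nN p : leb.-negligible (N p).
  rewrite /N; case: asboolP => [pU|_]; last exact: negligible_set0.
  exact: ae_obox_eq0.
pose F k := if @unpickle ('rV[rat]_n * 'rV[rat]_n)%type k is Some p then N p else set0.
have nF k : leb.-negligible (F k).
  by rewrite /F; case: unpickle => [p|]; [exact: nN|exact: negligible_set0].
apply: negligibleS (negligible_bigcup nF) => x /= /not_implyP[Ux ux].
move: Ux; rewrite (open_obox_rat oU) => -[p /= pU xp].
exists (pickle p) => //; rewrite /F pickleK /N asboolT//= => H.
exact/ux/H.
Qed.

End du_bois_reymond.

(** Classical integration by parts shows that [h - partial k g] integrates to 0 against every test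
    function. *)
Lemma weak_partial_eq (R : realType) n (U : set 'rV[R]_n) (g h : 'rV[R]_n -> R) k :
  open U -> Cd 1 U g -> weak_partial U k g h ->
  {ae lebesgue_rV n, forall x, U x -> h x = partial k g x}.
Proof.
move=> oU Cg [_ Lh Hw]; have mU := open_measurable_rV oU.
have cg x (Ux : U x) := Cd_continuous oU Cg Ux.
have cg' x (Ux : U x) := Cd_continuous oU (CdS_partial k Cg) Ux.
have ih A : compact A -> A `<=` U -> (lebesgue_rV n).-integrable A (EFin \o h).
  by move=> cA AU; exact: locally_Lp1_integrable Lh cA AU.
have ig A : compact A -> A `<=` U ->
    (lebesgue_rV n).-integrable A (EFin \o partial k g).
  by move=> cA AU; exact: compact_integrable cg'.
suff : {ae lebesgue_rV n, forall x, U x -> h x - partial k g x = 0}.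
  by apply: filterS => x H /H /eqP; rewrite subr_eq0 => /eqP.
apply: du_bois_reymond => //.
  move=> A cA AU; rewrite (_ : _ \o _ = ((EFin \o h) \- (EFin \o partial k g))%E)//.
  by apply: integrableB; [exact: compact_measurable_rV|exact: ih|exact: ig].
move=> phi Tphi; have [Cphi [A [cA AU phi0]]] := Tphi.
have mA := compact_measurable_rV cA.
have cphi x : {for x, continuous phi} := Cd_continuous openT (Cphi 1) (I : setT x).
have cphi' x : {for x, continuous (partial k phi)} :=
  Cd_continuous openT (CdS_partial k (Cphi 1)) (I : setT x).
have := Hw phi Tphi.
rewrite (integration_by_parts_rV oU cA AU cg cg' (fun x Ux => CdS_derive k Cg Ux)
  cphi cphi' (fun x => CdS_derive k (Cphi 1) (I : setT x)) phi0).
rewrite !(@integral_support _ _ _ _ A U)//; last 3 first.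
- by move=> x /phi0 ->; rewrite mulr0.
- by move=> x /phi0 ->; rewrite mulr0.
- by move=> x /phi0 ->; rewrite mulr0.
have [M HM] := compact_continuous_bound cA (fun x _ => cphi x).
have bphi : [bounded phi x | x in A].
  by exists M; split; [exact: num_real|move=> y My x /HM /le_trans; apply; exact: ltW].
have mphi : measurable_fun A phi.
  by apply: measurable_funTS; exact: (continuous_measurable_rV openT (fun x _ => cphi x)).
have i1 : (lebesgue_rV n).-integrable A (EFin \o (fun x => partial k g x * phi x)).
  by have := integrableMl mA (ig A cA AU) mphi bphi.
have i2 : (lebesgue_rV n).-integrable A (EFin \o (fun x => h x * phi x)).
  by have := integrableMl mA (ih A cA AU) mphi bphi.
move=> /oppe_inj E.
transitivity (\int[lebesgue_rV n]_(x in A)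
    ((h x * phi x)%:E - (partial k g x * phi x)%:E))%E.
  by apply: eq_integral => x _; rewrite -EFinB mulrBl.
rewrite integralB// E subee//; exact: integrable_fin_num i2.
Qed.

(** * The Hardy norm of a quasiregular map *)

Section operator_norm.
Context {R : realType} {n : nat}.
Implicit Types M : 'M[R]_n.

Lemma enorm_mulmx_le M (v : 'rV[R]_n) : enorm v <= 1 ->
  enorm (v *m M) <= \sum_i \sum_k `|M k i|.
Proof.
move=> v1; apply: (le_trans (enorm_le_sum _)); apply: ler_sum => i _.
rewrite mxE (le_trans (ler_norm_sum _ _ _))//; apply: ler_sum => k _.
by rewrite normrM ler_piMl// (le_trans (ler_coord_enorm _ _)).
Qed.

Lemma opnorm_le M : opnorm M <= \sum_i \sum_k `|M k i|.
Proof.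
apply: ge_sup; last by move=> _ [v /= v1 <-]; exact: enorm_mulmx_le.
by exists (enorm ((0 : 'rV[R]_n) *m M)), 0 => //=; rewrite enorm0.
Qed.

Lemma coord_le_opnorm M k i : `|M k i| <= opnorm M.
Proof.
pose e : 'rV[R]_n := delta_mx ord0 k.
have e1 : enorm e <= 1.
  rewrite /enorm (bigD1 k)//= mxE !eqxx expr1n big1 ?addr0 ?sqrtr1// => l lk.
  by rewrite mxE (negPf lk) andbF expr0n.
apply: (@le_trans _ _ (enorm (e *m M))).
  apply: le_trans (ler_coord_enorm _ i); rewrite mxE (bigD1 k)//= mxE !eqxx mul1r.
  by rewrite big1 ?addr0// => l lk; rewrite mxE (negPf lk) andbF mul0r.
apply: ub_le_sup; last by exists e.
by exists (\sum_i \sum_k `|M k i|) => _ [v /= v1 <-]; exact: enorm_mulmx_le.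
Qed.

Lemma opnorm_ge0 M : 0 <= opnorm M.
Proof.
apply: (@le_trans _ _ (enorm ((0 : 'rV[R]_n) *m M))); first exact: enorm_ge0.
apply: ub_le_sup; last by exists 0 => //=; rewrite enorm0.
by exists (\sum_i \sum_k `|M k i|) => _ [v /= v1 <-]; exact: enorm_mulmx_le.
Qed.

(* Each term of the determinant has one factor in column [j]. *)
Lemma det_le_col M (j : 'I_n) :
  `|\det M| <= n`!%:R * (\sum_k `|M k j|) * opnorm M ^+ n.-1.
Proof.
rewrite /determinant (le_trans (ler_norm_sum _ _ _))//.
have -> : n`!%:R * (\sum_k `|M k j|) * opnorm M ^+ n.-1 =
    \sum_(s : 'S_n) (\sum_k `|M k j|) * opnorm M ^+ n.-1.
  by rewrite sumr_const -mulrA mulr_natl; congr (_ *+ _); rewrite card_Sn.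
apply: ler_sum => s _; rewrite normrM normr_sign mul1r normr_prod.
rewrite (bigD1 ((s^-1)%g j))//= permKV; apply: ler_pM => //.
- exact: prodr_ge0.
- by rewrite (bigD1 ((s^-1)%g j))//= lerDl; exact: sumr_ge0.
apply: (@le_trans _ _ (\prod_(i < n | i != (s^-1)%g j) opnorm M)).
  by apply: ler_prod => i _; rewrite normr_ge0/= coord_le_opnorm.
rewrite prodr_const; have -> // : #|[pred i | i != (s^-1)%g j]| = n.-1.
by rewrite cardC1 card_ord.
Qed.

(** By [det_le_col] the determinant is at most a constant times column [j] times [opnorm M ^+ n.-1],
    and this power divides out. Column [j] of the derivative is the gradient of the [j]-th
    component, which thus controls all the others. *)
Lemma distortion_bound (K : R) M (j : 'I_n) : 0 <= K ->
  opnorm M ^+ n <= K * \det M ->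
  opnorm M <= K * n`!%:R * \sum_k `|M k j|.
Proof.
move=> K0 qr; have o0 := opnorm_ge0 M.
have s0 : 0 <= \sum_k `|M k j| by exact: sumr_ge0.
move: o0; rewrite le_eqVlt => /predU1P[<-|o0]; first by rewrite !mulr_ge0.
have n0 : (0 < n)%N by exact: leq_trans (ltn_ord j).
rewrite -(@ler_pM2r _ (opnorm M ^+ n.-1)) ?exprn_gt0// -exprS prednK//.
rewrite (le_trans qr)// -!mulrA ler_wpM2l// mulrA.
exact: le_trans (ler_norm _) (det_le_col M j).
Qed.

End operator_norm.

(** * Inequalities between powers of [W] and [S] *)

Section numeric_inequalities.
Context {R : realType}.
Implicit Types (b c W S : R).

Lemma powR_mulB1 b x : 0 < x -> x `^ (b - 1) * x = x `^ b :> R.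
Proof.
move=> x0; rewrite -{2}(powRr1 (ltW x0)) -powRD ?subrK//.
by apply/implyP => _; rewrite gt_eqF.
Qed.

(** Write [q] for the square root of [S / W]. Where [c3 * q <= 1], the first two terms already have
    a nonpositive sum. Elsewhere [S / W] stays between [c3 ^- 2] and 1, so [S^(b-1)] is comparable
    to [W^(b-1)] and a large [C2] wins. *)
Lemma superharmonic_constants b c0 c3 (k : R) : 0 <= c0 -> 0 < c3 -> 0 < k ->
  exists C2 : R, 0 <= C2 /\ forall W S, 0 < S -> S <= W ->
  c0 * W `^ (b - 1) - c0 * (2 * W `^ (b - 1) - c3 * (W `^ (b - 2) * (Num.sqrt W * Num.sqrt S)))
    - C2 * (k * S `^ (b - 1)) <= 0.
Proof.
move=> c00 c30 k0.
(* A lower bound for [t^(b-1)] on [c3 ^- 2 <= t <= 1]: the left end decides when [b >= 1], the right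
   end when [b < 1]. *)
pose m0 : R := Num.min 1 ((c3 ^- 2) `^ (b - 1)).
have ic3 : 0 < c3 ^- 2 by rewrite invr_gt0 exprn_gt0.
have m00 : 0 < m0 by rewrite lt_min ltr01 powR_gt0.
exists (c0 * c3 / (k * m0)); split.
  by rewrite divr_ge0 ?mulr_ge0// ltW.
move=> W S S0 SW; have W0 : 0 < W by exact: lt_le_trans SW.
pose t := S / W; have t0 : 0 < t by rewrite divr_gt0.
have t1 : t <= 1 by rewrite ler_pdivrMr// mul1r.
have St : S = t * W by rewrite /t divfK// gt_eqF.
pose q := Num.sqrt t.
have q0 : 0 < q by rewrite sqrtr_gt0.
have q1 : q <= 1 by rewrite -sqrtr1 ler_wsqrtr.
have Sb : S `^ (b - 1) = t `^ (b - 1) * W `^ (b - 1) by rewrite St powRM// ltW.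
have Wq : W `^ (b - 2) * (Num.sqrt W * Num.sqrt S) = q * W `^ (b - 1).
  have sW : Num.sqrt W * Num.sqrt W = W by rewrite -expr2 sqr_sqrtr// ltW.
  have WW : W `^ (b - 2) * W = W `^ (b - 1).
    by rewrite (_ : b - 2 = b - 1 - 1) ?powR_mulB1//; lra.
  rewrite St sqrtrM ?(ltW t0)// -WW -/q.
  by rewrite [Num.sqrt W * _]mulrCA sW mulrCA.
rewrite Sb Wq.
have Wb : 0 < W `^ (b - 1) by rewrite powR_gt0.
set X := W `^ (b - 1) in Wb *; set T := t `^ (b - 1).
have T0 : 0 < T by rewrite powR_gt0.
have -> : c0 * X - c0 * (2 * X - c3 * (q * X)) - c0 * c3 / (k * m0) * (k * (T * X)) =
    X * (c0 * (c3 * q - 1) - c0 * c3 * (T / m0)).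
  by field; rewrite !gt_eqF.
rewrite pmulr_rle0// subr_le0.
have [cq|cq] := lerP (c3 * q) 1.
  rewrite (@le_trans _ _ 0)//; first by rewrite mulr_ge0_le0// subr_le0.
  by rewrite !mulr_ge0 ?invr_ge0// ltW.
have tc : c3 ^- 2 <= t.
  rewrite -(sqr_sqrtr (ltW t0)) -/q -exprVn lerXn2r ?nnegrE ?invr_ge0 ?(ltW c30) ?(ltW q0)//.
  by rewrite -[c3^-1]mulr1 ler_pdivrMl// ltW.
have mT : m0 <= T.
  rewrite ge_min; have [b1|b1] := lerP 1 b.
    by apply/orP; right; apply: ge0_ler_powR; rewrite ?subr_ge0// nnegrE ltW.
  apply/orP; left; rewrite -(powRr0 t) /T.
  by apply: ger_powR; rewrite ?t0// subr_le0 ltW.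
apply: (@le_trans _ _ (c0 * c3)).
  rewrite ler_wpM2l// lerBlDr (@le_trans _ _ c3)//; last by rewrite lerDl.
  by rewrite ler_piMr// ltW.
by rewrite ler_peMr ?mulr_ge0 ?(ltW c30)// ler_pdivlMr// mul1r.
Qed.

(** Either [c * S <= W / 2], and the first summand suffices, or [W < 2 * c * S], and then
    [W^(b-1) S <= W^b <= (2 c S)^b]. The coefficient one half is what lets the mean of [W^b] be
    absorbed later. *)
Lemma young_powR b c W S : 0 < b -> 0 <= c -> 0 < S -> S <= W ->
  c * (W `^ (b - 1) * S) <= W `^ b / 2 + c * (2 * c) `^ b * S `^ b.
Proof.
move=> b0 c0 S0 SW; have W0 : 0 < W by exact: lt_le_trans SW.
have Wb : W `^ b = W `^ (b - 1) * W by rewrite powR_mulB1.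
have h0 : 0 <= W `^ (b - 1) by exact: powR_ge0.
have [cS|cS] := lerP (c * S) (W / 2).
  rewrite ler_wpDr//; first by rewrite !mulr_ge0 ?powR_ge0.
  by rewrite Wb mulrCA -mulrA ler_wpM2l.
rewrite ler_wpDl//; first by rewrite divr_ge0 ?powR_ge0.
rewrite -mulrA ler_wpM2l// -powRM ?mulr_ge0// ?(ltW S0)//.
apply: (@le_trans _ _ (W `^ b)); first by rewrite Wb ler_wpM2l.
by apply: ge0_ler_powR; rewrite ?nnegrE ?mulr_ge0 ?(ltW b0) ?(ltW W0) ?(ltW S0)//; lra.
Qed.

End numeric_inequalities.

(** * From almost-everywhere to pointwise bounds *)

Section pointwise_bounds.
Context {R : realType} {n : nat}.
Variable U : set 'rV[R]_n.
Hypothesis oU : open U.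
Implicit Types g h : 'rV[R]_n -> R.

(** The set where the inequality fails is open and null, and nonempty open sets have positive
    measure. *)
Lemma ae_le_continuous g h :
  (forall x, U x -> {for x, continuous g}) ->
  (forall x, U x -> {for x, continuous h}) ->
  {ae lebesgue_rV n, forall x, U x -> g x <= h x} ->
  forall x, U x -> g x <= h x.
Proof.
move=> cg ch gh x Ux; rewrite leNgt; apply/negP => hg.
pose A := [set y | U y /\ h y < g y].
have oA : open A.
  rewrite openE => y [Uy hgy]; apply: filterI; first exact: open_nbhs_nbhs.
  have cB : {for y, continuous (fun z => g z - h z)}.
    by apply: continuousB; [exact: cg|exact: ch].
  have /cB : nbhs (g y - h y) [set z : R | 0 < z].
    by apply: open_nbhs_nbhs; split; [exact: open_gt|rewrite /= subr_gt0].
  rewrite nbhs_filterE /= => gh0.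
  by apply: (@filterS _ _ (nbhs_filter y) _ _ _ gh0) => z /=; rewrite subr_gt0.
have Ax : A x by [].
have := open_lebesgue_gt0 oA Ax; have [B [mB B0 sB]] := gh.
have AB : A `<=` B by move=> y [Uy hgy]; apply: sB => /(_ Uy); rewrite leNgt hgy.
rewrite ltNge => /negP; apply; rewrite -B0 le_measure ?inE//.
exact: open_measurable_rV.
Qed.

(** Almost everywhere the weak partials in [D] are the classical ones and [distortion_bound]
    applies; both sides being continuous, the inequality extends to every point of [U]. *)
Lemma quasiregular_partial_bound (K : R) (f : 'rV[R]_n -> 'rV[R]_n) :
  quasiregular K U f -> (forall i, Cd 1 U (component f i)) ->
  forall j k i x, U x ->
  `|partial k (component f i) x| <=
    K * n`!%:R * n%:R * enorm (gradient (component f j) x).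
Proof.
move=> [K1 _ [D [wD _ qD]]] Cf j k i.
have K0 : 0 <= K by exact: le_trans K1.
have cp i' k' x : U x -> {for x, continuous (partial k' (component f i'))}.
  by move=> Ux; exact: (@Cd_continuous R n U oU 0 _ x (CdS_partial k' (Cf i')) Ux).
have main : forall x, U x -> `|partial k (component f i) x| <=
    K * n`!%:R * \sum_k' `|partial k' (component f j) x|.
  apply: ae_le_continuous.
  - by move=> x Ux; apply: (continuous_comp (cp i k x Ux)); exact: norm_continuous.
  - move=> x Ux.
    have CS : Cd 0 U (fun y => \sum_k' `|partial k' (component f j) y|).
      apply: (Cd_sum oU) => k' _; split => //; apply/(within_contP oU) => y Uy.
      by apply: (continuous_comp (cp j k' y Uy)); exact: norm_continuous.
    exact: (Cd_continuous oU (CdZ oU _ CS) Ux).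
  have wi k' : {ae lebesgue_rV n, forall x, U x -> D x k' i = partial k' (component f i) x}.
    exact: weak_partial_eq oU (Cf i) (wD k' i).
  have wj : {ae lebesgue_rV n, forall x k', U x -> D x k' j = partial k' (component f j) x}.
    have : \forall x \near (almost_everywhere (lebesgue_rV n)), forall k',
        U x -> D x k' j = partial k' (component f j) x.
      by apply: filter_forall => k'; exact: weak_partial_eq oU (Cf j) (wD k' j).
    by [].
  near=> x => Ux.
  have <- : D x k i = partial k (component f i) x by move: Ux; near: x; exact: wi.
  have <- : \sum_k' `|D x k' j| = \sum_k' `|partial k' (component f j) x|.
    apply: eq_bigr => k' _; congr (`| _ |).
    have : forall k', U x -> D x k' j = partial k' (component f j) x by near: x.
    exact.
  apply: le_trans (coord_le_opnorm _ _ _) _; apply: distortion_bound => //.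
  by move: Ux; near: x.
move=> x Ux; apply: le_trans (main x Ux) _.
rewrite -[leRHS]mulrA ler_wpM2l ?mulr_ge0//.
have -> : n%:R * enorm (gradient (component f j) x) =
    \sum_(k' < n) enorm (gradient (component f j) x).
  by rewrite sumr_const card_ord mulr_natl.
apply: ler_sum => k' _; have := ler_coord_enorm (gradient (component f j) x) k'.
by rewrite mxE.
Unshelve. all: by end_near. Qed.

End pointwise_bounds.

(** * Construction of the superharmonic function *)

Section riesz_superharmonic.
Context {R : realType} {n : nat}.
Variable U : set 'rV[R]_n.
Hypothesis oU : open U.
Implicit Types g h : 'rV[R]_n -> R.

Lemma laplacian_sum (I : Type) (r : seq I) (F : I -> 'rV[R]_n -> R) x :
  (forall i, Cd 2 U (F i)) -> U x ->
  laplacian (fun y => \sum_(i <- r) F i y) x = \sum_(i <- r) laplacian (F i) x.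
Proof.
move=> CF Ux; elim: r => [|i r IH].
  rewrite big_nil -[RHS](laplacian_cst x 0); apply: (eq_laplacian oU) => // y _.
  by rewrite big_nil.
rewrite big_cons -IH -(laplacianD oU (CF i) (Cd_sum oU _ (fun i _ => CF i)) Ux).
by apply: (eq_laplacian oU) => // y _; rewrite big_cons.
Qed.

Lemma partial_sum (I : Type) (r : seq I) (F : I -> 'rV[R]_n -> R) k x :
  (forall i, Cd 1 U (F i)) -> U x ->
  partial k (fun y => \sum_(i <- r) F i y) x = \sum_(i <- r) partial k (F i) x.
Proof.
move=> CF Ux; elim: r => [|i r IH].
  rewrite big_nil -[RHS](partial_cst k x 0); apply: (partial_eq oU) => // y _.
  by rewrite big_nil.
rewrite big_cons -IH -(partialD k (CF i) (Cd_sum oU _ (fun i _ => CF i)) Ux).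
by apply: (partial_eq oU) => // y _; rewrite big_cons.
Qed.

Lemma laplacianB g h x : Cd 2 U g -> Cd 2 U h -> U x ->
  laplacian (fun y => g y - h y) x = laplacian g x - laplacian h x.
Proof.
move=> Cg Ch Ux; rewrite -[- laplacian h x]mulN1r -(laplacianZ oU _ Ch Ux).
rewrite -(laplacianD oU Cg (CdZ oU _ Ch) Ux).
by apply: (eq_laplacian oU) => // y _; rewrite mulN1r.
Qed.

Lemma laplacian_sqr g x : Cd 2 U g -> U x ->
  laplacian (fun y => g y ^+ 2) x =
  2 * (g x * laplacian g x) + 2 * enorm (gradient g x) ^+ 2.
Proof.
move=> Cg Ux; rewrite (eq_laplacian oU (h := fun y => g y * g y))//.
by rewrite (laplacianM oU)// graddot_gradient; ring.
Qed.

Lemma partial_sqr g k x : Cd 1 U g -> U x ->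
  partial k (fun y => g y ^+ 2) x = 2 * (g x * partial k g x).
Proof.
move=> Cg Ux; rewrite (partial_eq oU k (h := fun y => g y * g y))//.
by rewrite (partialM k Cg Cg Ux); ring.
Qed.

Lemma sum_ord_cst (m : nat) (c : R) : \sum_(i < m) c = m%:R * c.
Proof. by rewrite sumr_const card_ord mulr_natl. Qed.

Lemma graddot_le g h x (a b : R) :
  (forall k, `|partial k g x| <= a) -> (forall k, `|partial k h x| <= b) ->
  `|graddot g h x| <= n%:R * (a * b).
Proof.
move=> ga hb; apply: le_trans (ler_norm_sum _ _ _) _.
rewrite -sum_ord_cst.
by apply: ler_sum => k _; rewrite normrM ler_pM.
Qed.

(** The gradient hypothesis carries a factor [g x], which raises the exponent [b - 2] of the
    second-order term to the [b - 1] of the first, so that both are of the same size. *)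
Lemma laplacian_powR_bound g x (b M N d : R) :
  (forall y, U y -> 0 < g y) -> Cd 2 U g -> U x ->
  `|laplacian g x| <= M * d -> graddot g g x <= N * (g x * d) ->
  `|laplacian (fun y => g y `^ b) x| <=
    `|b| * (M + `|b - 1| * N) * (g x `^ (b - 1) * d).
Proof.
move=> g0 Cg Ux Md Nd; rewrite (laplacian_powR oU)//.
have gx0 := g0 x Ux; have gg0 : 0 <= graddot g g x.
  by rewrite graddot_gradient sqr_ge0.
have p1 : 0 <= g x `^ (b - 1) by exact: powR_ge0.
have p2 : 0 <= g x `^ (b - 2) by exact: powR_ge0.
have p21 : g x `^ (b - 2) * g x = g x `^ (b - 1).
  by rewrite (_ : b - 2 = b - 1 - 1) ?powR_mulB1//; lra.
apply: le_trans (ler_normD _ _) _.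
rewrite !normrM (ger0_norm p1) (ger0_norm p2) (ger0_norm gg0).
apply: (@le_trans _ _ (`|b| * g x `^ (b - 1) * (M * d) +
    `|b| * `|b - 1| * g x `^ (b - 2) * (N * (g x * d)))).
  by apply: lerD; apply: ler_wpM2l => //; rewrite !mulr_ge0.
rewrite -p21 le_eqVlt; apply/orP; left; apply/eqP.
by move: (`|b|) (`|b - 1|) (g x) (g x `^ _) => B B1 X P; ring.
Qed.

(* With [d = |grad (F j)|^2]: the Laplacian of [W^b] is at most [c0 W^(b-1) d],
   that of [W^(b-1) S] at least [(2 - c3 (S/W)^(1/2)) W^(b-1) d], which settles
   the points where [S / W] is small, and that of [S^b] at least
   [k S^(b-1) d] with [k > 0] as [2 b > 1], which settles the others. *)
Lemma riesz_superharmonic (F : 'I_n -> 'rV[R]_n -> R) (j : 'I_n) (L A b : R) :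
  (forall i, Cd 2 U (F i)) -> 0 <= L -> 0 <= A -> 2^-1 < b ->
  (forall k i x, U x -> `|partial k (F i) x| <= L * enorm (gradient (F j) x)) ->
  (forall x, U x -> 0 <= \sum_i F i x * laplacian (F i) x <=
     A * \sum_i enorm (gradient (F i) x) ^+ 2) ->
  (forall x, U x -> 0 <= F j x * laplacian (F j) x) ->
  exists C1 C2 : R, [/\ 0 <= C1, 0 <= C2 & forall x, U x ->
    laplacian (fun y => (\sum_i F i y ^+ 2 + 1) `^ b -
      (C1 * ((\sum_i F i y ^+ 2 + 1) `^ (b - 1) * (F j y ^+ 2 + 1)) +
       C2 * (F j y ^+ 2 + 1) `^ b)) x <= 0].
Proof.
move=> CF L0 A0 b2 gF Ha Hj.
have eb : b - 1 - 1 = b - 2 by ring.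
pose W y := \sum_i F i y ^+ 2 + 1; pose S y := F j y ^+ 2 + 1.
pose d x := enorm (gradient (F j) x) ^+ 2.
have S0 y : 0 < S y by rewrite ltr_wpDl// sqr_ge0.
have SW y : S y <= W y.
  by rewrite lerD2r (bigD1 j)//= lerDl; apply: sumr_ge0 => i _; exact: sqr_ge0.
have W0 y : 0 < W y by exact: lt_le_trans (SW y).
have CF2 i : Cd 2 U (fun y => F i y ^+ 2) by exact: CdX.
have CS : Cd 2 U S := CdD oU (CF2 j) (Cd_cst oU 2 1).
have CsW : Cd 2 U (fun y => \sum_i F i y ^+ 2) by exact: (Cd_sum oU _ (fun i _ => CF2 i)).
have CW : Cd 2 U W := CdD oU CsW (Cd_cst oU 2 1).
have CSb : Cd 2 U (fun y => S y `^ b) := Cd_powR oU b (fun y _ => S0 y) CS.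
have CWp (c : R) : Cd 2 U (fun y => W y `^ c) := Cd_powR oU c (fun y _ => W0 y) CW.
(* With [d = |grad (F j)|^2]: [N1] serves in [|grad W|^2 <= N1 W d], [M1] in
   [|laplacian W| <= M1 d], and [T c] is the resulting constant for the Laplacian of [W^c]. *)
pose N1 : R := n%:R * (2 * n%:R * L) ^+ 2.
pose M1 : R := 2 * (A + 1) * (n%:R * (n%:R * L ^+ 2)).
have N10 : 0 <= N1 by rewrite mulr_ge0// sqr_ge0.
have M10 : 0 <= M1 by rewrite !mulr_ge0// ?addr_ge0// sqr_ge0.
pose T (c : R) : R := `|c| * (M1 + `|c - 1| * N1).
have T0 c : 0 <= T c by rewrite mulr_ge0// addr_ge0// mulr_ge0.
have d0 x : 0 <= d x by exact: sqr_ge0.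
have lapS x : U x -> 2 * d x <= laplacian S x.
  move=> Ux; rewrite (laplacianD oU (CF2 j) (Cd_cst oU 2 1) Ux) laplacian_cst addr0.
  by rewrite (laplacian_sqr (CF j) Ux) lerDr mulr_ge0// Hj.
have pS k x : U x -> partial k S x = 2 * (F j x * partial k (F j) x).
  move=> Ux; rewrite (partialD _ (CdW (CF2 j)) (Cd_cst oU 1 1) Ux).
  by rewrite partial_cst addr0 (partial_sqr _ (CdW (CF j)) Ux).
have pW k x : U x -> partial k W x = \sum_i 2 * (F i x * partial k (F i) x).
  move=> Ux; rewrite (partialD _ (CdW CsW) (Cd_cst oU 1 1) Ux).
  rewrite partial_cst addr0 (partial_sum _ _ (fun i => CdW (CF2 i)) Ux).
  by apply: eq_bigr => i _; rewrite (partial_sqr _ (CdW (CF i)) Ux).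
have gSS x : U x -> graddot S S x = 4 * (F j x ^+ 2 * d x).
  move=> Ux; rewrite /d -graddot_gradient /graddot !mulr_sumr.
  by apply: eq_bigr => k _; rewrite pS//; ring.
have lapW x : U x -> `|laplacian W x| <= M1 * d x.
  move=> Ux; rewrite (laplacianD oU CsW (Cd_cst oU 2 1) Ux) laplacian_cst addr0.
  rewrite (laplacian_sum _ CF2 Ux).
  under eq_bigr => i _ do rewrite (laplacian_sqr (CF i) Ux).
  rewrite big_split/= -!mulr_sumr; have /andP[h1 h2] := Ha x Ux.
  set G := \sum_i enorm _ ^+ 2 in h2 *.
  have G0 : 0 <= G by apply: sumr_ge0 => i _; exact: sqr_ge0.
  have Gd : G <= n%:R * (n%:R * L ^+ 2) * d x.
    have -> : n%:R * (n%:R * L ^+ 2) * d x = \sum_(i < n) \sum_(k < n) (L * enorm (gradient (F j) x)) ^+ 2.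
        by rewrite !sum_ord_cst /d; move: (enorm _) => e; ring.
    apply: ler_sum => i _; rewrite enorm_sqr; apply: ler_sum => k _.
    rewrite mxE -real_normK ?num_real// lerXn2r ?nnegrE ?gF//.
    by rewrite mulr_ge0 ?enorm_ge0.
  rewrite ger0_norm; last by rewrite addr_ge0// mulr_ge0.
  rewrite /M1 -mulrA -[in leRHS]mulrA.
  have : (A + 1) * G <= (A + 1) * (n%:R * (n%:R * L ^+ 2) * d x).
    by rewrite ler_wpM2l// addr_ge0.
  by lra.
have pWb k x : U x -> `|partial k W x| <=
    2 * n%:R * L * (Num.sqrt (W x) * enorm (gradient (F j) x)).
  move=> Ux; rewrite pW//; apply: le_trans (ler_norm_sum _ _ _) _.
  have -> : 2 * n%:R * L * (Num.sqrt (W x) * enorm (gradient (F j) x)) =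
      \sum_(i < n) 2 * (Num.sqrt (W x) * (L * enorm (gradient (F j) x))).
    by rewrite sum_ord_cst; move: (enorm _) (Num.sqrt _) => e w; ring.
  apply: ler_sum => i _; rewrite !normrM ger0_norm// ler_wpM2l// ler_pM ?gF//.
  rewrite -sqrtr_sqr ler_wsqrtr// /W (bigD1 i)//= -addrA lerDl addr_ge0//.
  by apply: sumr_ge0 => l _; exact: sqr_ge0.
have pSb k x : U x -> `|partial k S x| <=
    2 * (Num.sqrt (S x) * enorm (gradient (F j) x)).
  move=> Ux; rewrite pS// !normrM ger0_norm// ler_wpM2l// ler_pM//.
    by rewrite -sqrtr_sqr ler_wsqrtr// lerDl.
  by have := ler_coord_enorm (gradient (F j) x) k; rewrite mxE.
have gWW x : U x -> graddot W W x <= N1 * (W x * d x).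
  move=> Ux; apply: le_trans (ler_norm _) _.
  apply: le_trans (graddot_le (fun k => pWb k x Ux) (fun k => pWb k x Ux)) _.
  rewrite /N1 /d -{3}(sqr_sqrtr (ltW (W0 x))).
  by move: (Num.sqrt (W x)) (enorm (gradient _ _)) => w e; rewrite le_eqVlt; apply/orP; left; apply/eqP; ring.
have gWS x : U x -> `|graddot W S x| <=
    4 * n%:R * n%:R * L * (Num.sqrt (W x) * Num.sqrt (S x) * d x).
  move=> Ux; apply: le_trans (graddot_le (fun k => pWb k x Ux) (fun k => pSb k x Ux)) _.
  rewrite /d; move: (Num.sqrt (W x)) (Num.sqrt (S x)) (enorm (gradient _ _)) => w s e.
  by rewrite le_eqVlt; apply/orP; left; apply/eqP; ring.
(* In the Laplacian of [W^(b-1) S], the first summand bounds the term with the Laplacian of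
   [W^(b-1)], the second the cross term of the gradients; the 1 only ensures positivity. *)
pose c3 : R := T (b - 1) + 8 * n%:R * n%:R * L * `|b - 1| + 1.
have c30 : 0 < c3.
  by rewrite ltr_wpDl// addr_ge0// !mulr_ge0.
(* For [b < 1] this is [2 b (2 b - 1)], positive because [b > 1/2]: here the condition [p > 1]
   enters. For [b >= 1] it is [2 b]. *)
pose ka : R := 2 * b + 4 * b * Num.min 0 (b - 1).
have b0 : 0 < b by lra.
have ka0 : 0 < ka.
  by rewrite /ka; case: (leP 0 (b - 1)) => b1; [lra|nra].
have [C2 [C20 HC]] := superharmonic_constants b (T0 b) c30 ka0.
exists (T b), C2; split => // x Ux.
have CWS : Cd 2 U (fun y => W y `^ (b - 1) * S y) := CdM oU (CWp _) CS.
rewrite (laplacianB (CWp b) (CdD oU (CdZ oU _ CWS) (CdZ oU _ CSb)) Ux).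
rewrite (laplacianD oU (CdZ oU _ CWS) (CdZ oU _ CSb) Ux).
rewrite (laplacianZ oU _ CWS Ux) (laplacianZ oU _ CSb Ux).
have lapWb (c : R) : `|laplacian (fun y => W y `^ c) x| <= T c * (W x `^ (c - 1) * d x).
  by apply: laplacian_powR_bound => //; [exact: lapW|exact: gWW].
have h1 : laplacian (fun y => W y `^ b) x <= T b * (W x `^ (b - 1) * d x).
  exact: le_trans (ler_norm _) (lapWb b).
pose Y := W x `^ (b - 2) * (Num.sqrt (W x) * Num.sqrt (S x)).
have p2 : 0 <= W x `^ (b - 2) by exact: powR_ge0.
have h2 : (2 * W x `^ (b - 1) - c3 * Y) * d x <=
    laplacian (fun y => W y `^ (b - 1) * S y) x.
  rewrite (laplacianM oU (CWp _) CS Ux) (graddot_powRl _ _ (fun y _ => W0 y) (CdW CW) Ux).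
  rewrite eb.
  have e1 : W x `^ (b - 1) * (2 * d x) <= W x `^ (b - 1) * laplacian S x.
    exact: (ler_wpM2l (powR_ge0 _ _) (lapS x Ux)).
  have SY : S x <= Num.sqrt (W x) * Num.sqrt (S x).
    rewrite -{1}(sqr_sqrtr (ltW (S0 x))) expr2 ler_wpM2r ?sqrtr_ge0//.
    by rewrite ler_wsqrtr.
  have e2 : `|S x * laplacian (fun y => W y `^ (b - 1)) x| <= T (b - 1) * Y * d x.
    rewrite normrM (ger0_norm (ltW (S0 x))).
    have := ler_pM (ltW (S0 x)) (normr_ge0 _) SY (lapWb (b - 1)).
    move=> /le_trans; apply; rewrite eb.
    rewrite /Y le_eqVlt; apply/orP; left; apply/eqP.
    by move: (T _) (W x `^ _) (Num.sqrt (W x)) (Num.sqrt (S x)) (d x) => t w q q' e; ring.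
  have e3 : `|2 * ((b - 1) * W x `^ (b - 2) * graddot W S x)| <=
      8 * n%:R * n%:R * L * `|b - 1| * Y * d x.
    rewrite !normrM (ger0_norm p2) ger0_norm//.
    have := ler_wpM2l (mulr_ge0 (normr_ge0 (b - 1)) p2) (gWS x Ux).
    rewrite -(ler_pM2l (x := 2))// => /le_trans; apply.
    rewrite /Y le_eqVlt; apply/orP; left; apply/eqP.
    by move: (`|b - 1|) (W x `^ _) (Num.sqrt (W x)) (Num.sqrt (S x)) (d x) => t w q q' e; ring.
  have Y0 : 0 <= Y * d x by rewrite /Y !mulr_ge0 ?sqrtr_ge0.
  move: e1 e2 e3; rewrite !ler_norml => e1 /andP[e2 _] /andP[e3 _].
  rewrite /c3; set t := T (b - 1) in e2 *; set m := 8 * n%:R * n%:R * L * `|b - 1| in e3 *.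
  set X := W x `^ (b - 1) in e1 *.
  have -> : (2 * X - (t + m + 1) * Y) * d x =
    X * (2 * d x) - t * Y * d x - m * Y * d x - Y * d x by ring.
  by apply: le_trans (lerD (lerD e1 e2) e3); rewrite gerBl.
have h3 : ka * S x `^ (b - 1) * d x <= laplacian (fun y => S y `^ b) x.
  rewrite (laplacian_powR oU b (fun y _ => S0 y) CS Ux) gSS//.
  have q0 : 0 <= S x `^ (b - 2) by exact: powR_ge0.
  have q1 : 0 <= S x `^ (b - 1) by exact: powR_ge0.
  have qq : S x `^ (b - 2) * S x = S x `^ (b - 1).
    by rewrite -eb powR_mulB1.
  have e1 : b * S x `^ (b - 1) * (2 * d x) <= b * S x `^ (b - 1) * laplacian S x.
    exact: (ler_wpM2l (mulr_ge0 (ltW b0) q1) (lapS x Ux)).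
  have e2 : 0 <= S x `^ (b - 2) * (F j x ^+ 2 * d x) <= S x `^ (b - 1) * d x.
    apply/andP; split; first exact: (mulr_ge0 q0 (mulr_ge0 (sqr_ge0 _) (d0 x))).
    have FS : F j x ^+ 2 <= S x by rewrite lerDl.
    by rewrite mulrA -qq; exact: (ler_wpM2r (d0 x) (ler_wpM2l q0 FS)).
  set P := S x `^ (b - 2) * _ in e2; set X := S x `^ (b - 1) in e1 e2 *.
  have -> : b * (b - 1) * S x `^ (b - 2) * (4 * (F j x ^+ 2 * d x)) =
    4 * b * ((b - 1) * P) by rewrite /P; ring.
  have e3 : Num.min 0 (b - 1) * (X * d x) <= (b - 1) * P.
    move/andP: e2 => [P0 PX]; have [b1|b1] := lerP 0 (b - 1).
      by rewrite mul0r; exact: mulr_ge0.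
    exact: (ler_wnM2l (ltW b1) PX).
  have := ler_wpM2l (mulr_ge0 (ler0n R 4) (ltW b0)) e3.
  rewrite /ka; move: e1; set a := Num.min 0 _.
  have -> : (2 * b + 4 * b * a) * X * d x = b * X * (2 * d x) + 4 * b * (a * (X * d x)) by ring.
  by move=> e1; exact: lerD e1.
have := HC (W x) (S x) (S0 x) (SW x); rewrite -/Y => h4.
have := mulr_le0_ge0 h4 (d0 x).
have g2 := ler_wpM2l (T0 b) h2; have g3 := ler_wpM2l C20 h3.
set X := W x `^ (b - 1) in h1 g2 *; set Z := S x `^ (b - 1) in g3 *.
have -> : (T b * X - T b * (2 * X - c3 * Y) - C2 * (ka * Z)) * d x =
  T b * (X * d x) - T b * ((2 * X - c3 * Y) * d x) - C2 * (ka * Z * d x) by ring.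
by rewrite opprD addrA; exact/le_trans/(lerB (lerB h1 g2) g3).
Qed.

End riesz_superharmonic.

(** * Hardy spaces in terms of bounded means *)

Section hardy_criterion.
Context {R : realType} {n : nat}.
Local Notation U := (@unit_ball R n).
Local Notation S := (@unit_sphere R n).
Local Notation sigma := (@sphere_measure R n).

Lemma sphere_measure_lty : (sigma S < +oo)%E.
Proof.
have mS := @measurable_unit_sphere R n.
rewrite /sphere_measure /pushforward /mrestr /normalized_volume /mscale/=.
have mU := @measurable_unit_ball R n.
have mrS : measurable (@radial R n @^-1` S).
  by rewrite -[X in measurable X]setTI; exact: measurable_radial.
have UU : (lebesgue_rV n (@radial R n @^-1` S `&` U) < +oo)%E.
  apply: le_lt_trans (_ : lebesgue_rV n U < +oo)%E.
    by apply: le_measure; rewrite ?inE//; exact: measurableI.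
  by rewrite -oball1; exact: oball_lebesgue_lty.
by apply: lte_mul_pinfty => //; rewrite lee_fin invr_ge0 fine_ge0.
Qed.

Lemma sphere_bounded_integrable (g : 'rV[R]_n -> R) (M r : R) :
  measurable_fun U g -> 0 <= r < 1 -> (forall z, S z -> `|g (r *: z)| <= M) ->
  sigma.-integrable S (fun z => (g (r *: z))%:E).
Proof.
move=> mg r01 gM; apply: measurable_bounded_integrable.
- exact: measurable_unit_sphere.
- exact: sphere_measure_lty.
- exact: measurable_sphere_comp.
- exists M; split; first exact: num_real.
  by move=> M' MM' z Sz; apply: le_trans (gM z Sz) (ltW MM').
Qed.

Lemma continuous_sphere_integrable (g : 'rV[R]_n -> R) (r : R) :
  (forall x, U x -> {for x, continuous g}) -> 0 <= r < 1 ->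
  sigma.-integrable S (fun z => (g (r *: z))%:E).
Proof.
move=> cg r01; have /andP[r0 r1] := r01.
have [M gM] := compact_continuous_bound (@compact_cball R n r)
  (fun x (Bx : cball r x) => cg x (cball_unit_ball r1 Bx)).
apply: (@sphere_bounded_integrable g M) => //.
  by apply: continuous_measurable_rV => //; exact: open_unit_ball.
by move=> z Sz; apply: gM; rewrite /cball/= enormZ ger0_norm// Sz mulr1.
Qed.

Lemma measurable_enorm_powR m (p : R) (f : 'rV[R]_n -> 'rV[R]_m) :
  measurable_fun U f -> measurable_fun U (fun x => enorm (f x) `^ p).
Proof.
move=> mf; apply: (measurableT_comp (measurable_powR p)).
by apply: (measurableT_comp (@measurable_enorm R m)).
Qed.

(** The majorant is continuous on the ball, hence integrable on each sphere of radius less than 1,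
    which yields integrability of the means together with their bound. *)
Lemma hardy_intro m (p : R) (f : 'rV[R]_n -> 'rV[R]_m) (h : 'rV[R]_n -> R) (B : R) :
  0 < p -> (forall i, Cd 0 U (component f i)) ->
  (forall x, U x -> {for x, continuous h}) ->
  (forall x, U x -> enorm (f x) `^ p <= h x) ->
  (forall r : R, 0 < r < 1 -> (\int[sigma]_(z in S) (h (r *: z))%:E <= B%:E)%E) ->
  hardy p f.
Proof.
move=> p0 Cf ch fh hB; have oU := @open_unit_ball R n.
have mS := @measurable_unit_sphere R n.
have mf : measurable_fun U f.
  apply: measurable_fun_rV => i; apply: continuous_measurable_rV => // x Ux.
  exact: (Cd_continuous oU (Cf i) Ux).
have intf (r : R) : 0 <= r < 1 ->
    sigma.-integrable S (fun z => (enorm (f (r *: z)) `^ p)%:E).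
  move=> r01; apply: le_integrable (continuous_sphere_integrable ch r01) => //.
    apply/measurable_EFinP.
    exact: (measurable_sphere_comp (measurable_enorm_powR p mf)).
  move=> z Sz; have Uz := sphere_unit_ball r01 Sz.
  rewrite lee_fin ger0_norm ?powR_ge0//.
  exact: le_trans (fh _ Uz) (ler_norm _).
split => //; apply: le_lt_trans (ltry (B `^ p^-1)).
apply: ge_ereal_sup => _ [r /= r01 <-].
have r01' : 0 <= r < 1 by move/andP: r01 => [/ltW -> ->].
have I0 : (0 <= \int[sigma]_(z in S) (enorm (f (r *: z)) `^ p)%:E)%E.
  by apply: integral_ge0 => z _; rewrite lee_fin powR_ge0.
have IB : (\int[sigma]_(z in S) (enorm (f (r *: z)) `^ p)%:E <= B%:E)%E.
  apply: le_trans (hB r r01); apply: le_integral => //.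
  - exact: intf.
  - exact: continuous_sphere_integrable.
  - by move=> z; rewrite inE => Sz; rewrite lee_fin fh//; exact: sphere_unit_ball.
rewrite /Mp -poweR_EFin; apply: gt0_ler_poweR => //.
- by rewrite invr_ge0 ltW.
- by rewrite in_itv/= I0 leey.
- by rewrite in_itv/= (le_trans I0 IB) leey.
Qed.

Lemma hardy_bounded m (p : R) (f : 'rV[R]_n -> 'rV[R]_m) : 0 < p -> hardy p f ->
  exists B : R, forall r : R, 0 < r < 1 ->
    (\int[sigma]_(z in S) (enorm (f (r *: z)) `^ p)%:E <= B%:E)%E.
Proof.
move=> p0 [_ _]; set s := ereal_sup _ => sy.
have I0 (r : R) : (0 <= \int[sigma]_(z in S) (enorm (f (r *: z)) `^ p)%:E)%E.
  by apply: integral_ge0 => z _; rewrite lee_fin powR_ge0.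
have rs r : 0 < r < 1 -> (Mp p r f <= s)%E.
  by move=> r01; apply: ereal_sup_ubound; exists r.
have s0 : (0 <= s)%E.
  apply: le_trans (rs 2^-1 _); first exact: poweR_ge0.
  by apply/andP; split; lra.
exists (fine s `^ p) => r r01.
rewrite -poweR_EFin fineK ?ge0_fin_numE//.
have -> : (\int[sigma]_(z in S) (enorm (f (r *: z)) `^ p)%:E = poweR (Mp p r f) p)%E.
  by rewrite /Mp -poweRrM mulVf ?gt_eqF// poweRe1.
apply: gt0_ler_poweR; rewrite ?(ltW p0)//.
- by rewrite in_itv/= poweR_ge0 leey.
- by rewrite in_itv/= s0 leey.
- exact: rs.
Qed.

End hardy_criterion.

(** * The estimate for exponents greater than 1 *)

Section riesz.
Context {R : realType} {n : nat}.
Local Notation U := (@unit_ball R n).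
Local Notation S := (@unit_sphere R n).
Local Notation sigma := (@sphere_measure R n).

Lemma riesz_hardy (K : R) (a : 'rV[R]_n -> R) (f : 'rV[R]_n -> 'rV[R]_n)
    (j : 'I_n) (p : R) :
  riesz_setting K a f j -> 1 < p -> hardy p (scalar_map (component f j)) ->
  hardy p f.
Proof.
move=> [[_ a0 Cf Haf] qr supa fj _] p1 hj.
have n0 : (0 < n)%N by exact: leq_trans (ltn_ord j).
have oU := @open_unit_ball R n.
have K0 : 0 <= K by have [K1 _ _] := qr; exact: le_trans K1.
pose L : R := K * n`!%:R * n%:R.
have L0 : 0 <= L by rewrite !mulr_ge0.
have p0 : 0 < p by exact: lt_trans p1.
pose b := p / 2; have b0 : 0 < b by rewrite divr_gt0.
have b2 : 2^-1 < b by rewrite /b; lra.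
have [A [A0 aA]] : exists A : R, 0 <= A /\ forall x, U x -> a x <= A.
  have U0 : U 0 by rewrite unit_ballE enorm0.
  set s := ereal_sup _ in supa.
  have as_ x : U x -> ((a x)%:E <= s)%E by move=> Ux; apply: ereal_sup_ubound; exists x.
  have s0 : (0 <= s)%E by apply: le_trans (as_ 0 U0); rewrite lee_fin a0.
  exists (fine s); split; first exact: fine_ge0.
  by move=> x Ux; rewrite -lee_fin fineK ?as_// ge0_fin_numE.
pose F i := component f i.
have gF k i x : U x -> `|partial k (F i) x| <= L * enorm (gradient (F j) x).
  exact: (quasiregular_partial_bound oU qr (fun i => CdW (Cf i)) j k i).
have Ha x : U x -> 0 <= \sum_i F i x * laplacian (F i) x <=
    A * \sum_i enorm (gradient (F i) x) ^+ 2.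
  move=> Ux; have /andP[-> h] := Haf x Ux; apply: le_trans h _.
  by rewrite ler_wpM2r ?aA// sumr_ge0// => i _; exact: sqr_ge0.
have [C1 [C2 [C10 C20 sup]]] := riesz_superharmonic oU Cf L0 A0 b2 gF Ha fj.
pose W y := \sum_i F i y ^+ 2 + 1; pose Sj y := F j y ^+ 2 + 1.
have Sj0 y : 0 < Sj y by rewrite ltr_wpDl// sqr_ge0.
have SW y : Sj y <= W y.
  by rewrite lerD2r (bigD1 j)//= lerDl; apply: sumr_ge0 => i _; exact: sqr_ge0.
have W0 y : 0 < W y by exact: lt_le_trans (SW y).
have CF2 i : Cd 2 U (fun y => F i y ^+ 2) by exact: (CdX oU 2 (Cf i)).
have CS : Cd 2 U Sj := CdD oU (CF2 j) (Cd_cst oU 2 1).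
have CW : Cd 2 U W := CdD oU (Cd_sum oU _ (fun i _ => CF2 i)) (Cd_cst oU 2 1).
have CSb : Cd 2 U (fun y => Sj y `^ b) := Cd_powR oU b (fun y _ => Sj0 y) CS.
have CWp (c : R) : Cd 2 U (fun y => W y `^ c) := Cd_powR oU c (fun y _ => W0 y) CW.
pose v y := C1 * (W y `^ (b - 1) * Sj y) + C2 * Sj y `^ b.
have Cv : Cd 2 U v := CdD oU (CdZ oU C1 (CdM oU (CWp _) CS)) (CdZ oU C2 CSb).
have v0 y : 0 <= v y.
  by apply: addr_ge0; apply: mulr_ge0 => //; rewrite ?mulr_ge0 ?powR_ge0// ltW.
pose E y := enorm (scalar_map (F j) y) `^ p.
have e2b (t : R) : 0 <= t -> t `^ p = (t ^+ 2) `^ b.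
  by move=> t0; rewrite -powR_mulrn// -powRrM mulrC divfK.
have SE y : Sj y `^ b <= 2 `^ b * (E y + 1).
  have FE : F j y ^+ 2 = enorm (scalar_map (F j) y) ^+ 2.
    by rewrite enorm_sqr big_ord1 mxE eqxx mulr1n.
  rewrite /E e2b ?enorm_ge0// -FE /Sj.
  have := sqr_ge0 (F j y); move: (F j y ^+ 2) => q q0.
  have [F1|F1] := lerP q 1.
    rewrite -[leLHS]mulr1 ler_pM ?powR_ge0//.
      by apply: ge0_ler_powR; rewrite ?nnegrE ?(ltW b0) ?addr_ge0//; lra.
    by rewrite lerDr powR_ge0.
  apply: (@le_trans _ _ ((2 * q) `^ b)).
    apply: ge0_ler_powR; rewrite ?nnegrE ?(ltW b0) ?addr_ge0 ?mulr_ge0//.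
    by move: F1; lra.
  by rewrite powRM// ler_wpM2l ?powR_ge0// lerDl.
have [B0 hB0] := hardy_bounded p0 hj; have [_ iE _] := hj.
pose C3 := C1 * (2 * C1) `^ b + C2.
have C30 : 0 <= C3 by rewrite addr_ge0// mulr_ge0// powR_ge0.
have vW y : v y <= 2^-1 * W y `^ b + C3 * Sj y `^ b.
  rewrite /v /C3 mulrDl addrA lerD2r.
  by have := young_powR b0 C10 (Sj0 y) (SW y); rewrite [_ / 2]mulrC.
have cont d g : Cd d U g -> forall x, U x -> {for x, continuous g}.
  by move=> Cg x Ux; exact: (Cd_continuous oU Cg Ux).
pose m := fine (sigma S).
pose J0 := 2 `^ b * (B0 + m).
(* Half of the mean of [W^b] will be absorbed from the mean of [v], whence the factor 2; [J0] bounds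
   the means of [Sj^b] uniformly in [r]. *)
apply: (@hardy_intro R n n p f (fun y => W y `^ b)
  (2 * (W 0 `^ b - v 0 + C3 * J0))) => //.
- by move=> i; exact: CdW (CdW (Cf i)).
- exact: cont (CWp b).
- move=> x _; rewrite e2b ?enorm_ge0//; apply: ge0_ler_powR.
  + exact: ltW.
  + by rewrite nnegrE sqr_ge0.
  + by rewrite nnegrE ltW.
  + by rewrite enorm_sqr lerDl.
move=> r r01; have r01' : 0 <= r < 1 by move/andP: r01 => [/ltW -> ->].
have mS := @measurable_unit_sphere R n.
have iW := continuous_sphere_integrable (cont _ _ (CWp b)) r01'.
have iS := continuous_sphere_integrable (cont _ _ CSb) r01'.
have iv := continuous_sphere_integrable (cont _ _ Cv) r01'.
have /andP[r0 r1] := r01.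
have := superharmonic_sphere n0 (CdB oU (CWp b) Cv) sup (cont _ _ (CWp b))
  (cont _ _ Cv) (fun y _ => powR_ge0 _ _) (fun y _ => v0 y) r0 r1.
have J0P : (\int[sigma]_(z in S) (Sj (r *: z) `^ b)%:E <= J0%:E)%E.
  have i1 : sigma.-integrable S (cst 1%:E).
    exact: (continuous_sphere_integrable (cont _ _ (Cd_cst oU 0 1)) r01').
  have iE1 : sigma.-integrable S (fun z => (E (r *: z))%:E + 1%:E)%E.
    by apply: integrableD => //; exact: iE.
  apply: (@le_trans _ _ (\int[sigma]_(z in S) ((2 `^ b)%:E * ((E (r *: z))%:E + 1%:E)))%E).
    apply: le_integral => //; first exact: integrableZl.
    by move=> z _; rewrite -EFinD -EFinM lee_fin.
  rewrite integralZl// integralD//; last exact: iE.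
  rewrite integral_cst// mul1e /J0 EFinM lee_wpmul2l ?lee_fin ?powR_ge0// EFinD leeD//.
    exact: hB0.
  by rewrite /m fineK// ge0_fin_numE// sphere_measure_lty.
have vP : (\int[sigma]_(z in S) (v (r *: z))%:E <=
    2^-1%:E * \int[sigma]_(z in S) (W (r *: z) `^ b)%:E +
    C3%:E * \int[sigma]_(z in S) (Sj (r *: z) `^ b)%:E)%E.
  rewrite -!integralZl// -integralD//; [|exact: integrableZl..].
  apply: le_integral => //; first by apply: integrableD => //; exact: integrableZl.
  by move=> z _; rewrite -!EFinM -EFinD lee_fin.
(* The three means are finite, so the half of the mean of [W^b] can be subtracted as a real
   number. *)
have := integrable_fin_num mS iW; have := integrable_fin_num mS iS.
have := integrable_fin_num mS iv; move: J0P vP.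
set IW := (\int[_]_(_ in _) (W _ `^ _)%:E)%E; set IS := (\int[_]_(_ in _) (Sj _ `^ _)%:E)%E.
set Iv := (\int[_]_(_ in _) (v _)%:E)%E.
case: IW => // w; case: IS => // s; case: Iv => // t.
rewrite -!EFinM -!EFinD !lee_fin => sJ tws _ _ _ wt.
have := ler_wpM2l C30 sJ; lra.
Qed.

End riesz.

(** * Sharpness of the exponent 1 *)

(** The Weinstein-Aronszajn identity, by factoring [T] in two ways. It turns the determinant of a
    rank-one perturbation of the identity into a scalar. *)
Lemma det_add1_mul (F : comPzRingType) (n m : nat) (u : 'M[F]_(n, m)) (v : 'M[F]_(m, n)) :
  \det (1%:M + u *m v) = \det (1%:M + v *m u).
Proof.
pose T := block_mx 1%:M (- u) v (1%:M : 'M[F]_m).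
have E1 : T = block_mx 1%:M 0 v 1%:M *m block_mx 1%:M (- u) 0 (1%:M + v *m u).
  rewrite mulmx_block ?mul1mx ?mul0mx ?mulmx0 ?mulmx1 ?addr0 mulmxN.
  by congr block_mx; rewrite addrC addrK.
have E2 : T = block_mx (1%:M + u *m v) (- u) 0 1%:M *m block_mx 1%:M 0 v 1%:M.
  rewrite mulmx_block ?mul1mx ?mul0mx ?mulmx0 ?mulmx1 ?add0r mulNmx.
  by congr block_mx; rewrite addrK.
have : \det T = \det (1%:M + v *m u) by rewrite E1 det_mulmx det_lblock det_ublock !det1 !mul1r.
by rewrite E2 det_mulmx det_ublock det_lblock !det1 !mulr1.
Qed.

Section smooth_maps.
Context {R : realType} {n : nat}.
Variable U : set 'rV[R]_n.
Hypothesis oU : open U.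

Lemma continuous_locally_Lp (p : R) g : 0 <= p ->
  (forall x, U x -> {for x, continuous g}) -> locally_Lp p U g.
Proof.
move=> p0 cg; split; first exact: continuous_measurable_rV.
move=> A cA AU; have mA := compact_measurable_rV cA.
have [M HM] := compact_continuous_bound cA (fun x Ax => cg x (AU x Ax)).
have mgA : measurable_fun A (fun x => `|g x| `^ p).
  apply: (measurableT_comp (measurable_powR p)).
  apply: measurableT_comp => //; apply: measurable_funS (continuous_measurable_rV oU cg) => //.
  exact: open_measurable_rV.
apply: (@le_lt_trans _ _ (\int[lebesgue_rV n]_(x in A) (M `^ p)%:E)%E).
  apply: ge0_le_integral => //.
    exact/measurable_EFinP.
  move=> x Ax; rewrite lee_fin; apply: ge0_ler_powR => //; rewrite ?nnegrE ?HM//.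
  by apply: le_trans (HM x Ax).
rewrite integral_cst//; apply: lte_mul_pinfty => //; last exact: compact_lebesgue_lty.
by rewrite lee_fin powR_ge0.
Qed.

Lemma Cd_weak_partial g k : Cd 1 U g -> weak_partial U k g (partial k g).
Proof.
move=> Cg.
have cg x (Ux : U x) := Cd_continuous oU Cg Ux.
have cg' x (Ux : U x) := Cd_continuous oU (CdS_partial k Cg) Ux.
split; [exact: continuous_locally_Lp|exact: continuous_locally_Lp|].
move=> phi [Cphi [A [cA AU phi0]]].
have cphi x : {for x, continuous phi} := Cd_continuous openT (Cphi 1) (I : setT x).
have cphi' x : {for x, continuous (partial k phi)} :=
  Cd_continuous openT (CdS_partial k (Cphi 1)) (I : setT x).
exact: (integration_by_parts_rV oU cA AU cg cg'
  (fun x Ux => CdS_derive k Cg Ux) cphi cphi' (fun x => CdS_derive k (Cphi 1) I) phi0).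
Qed.

Lemma quasiregular_intro (K : R) (f : 'rV[R]_n -> 'rV[R]_n) :
  1 <= K -> (forall i, Cd 1 U (component f i)) ->
  (forall x, U x -> opnorm (\matrix_(k, i) partial k (component f i) x) ^+ n <=
     K * \det (\matrix_(k, i) partial k (component f i) x)) ->
  quasiregular K U f.
Proof.
move=> K1 Cf fK; split => //.
  apply: continuous_in_subspaceT => x; rewrite inE => Ux; apply: rV_continuous => i.
  exact: (Cd_continuous oU (Cf i) Ux).
exists (fun x => \matrix_(k, i) partial k (component f i) x); split.
- move=> k i; rewrite (_ : (fun _ => _) = partial k (component f i)).
    exact: Cd_weak_partial.
  by apply/funext => x; rewrite mxE.
- move=> k i; rewrite (_ : (fun _ => _) = partial k (component f i)).
    apply: continuous_locally_Lp => // x Ux.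
    exact: (Cd_continuous oU (CdS_partial k (Cf i)) Ux).
  by apply/funext => x; rewrite mxE.
- exact: aeW.
Qed.

End smooth_maps.

Lemma component_scalar_map (R : realType) n (g : 'rV[R]_n -> R) (i : 'I_1) :
  component (scalar_map g) i = g.
Proof. by apply/funext => x; rewrite /component mxE (ord1 i) eqxx mulr1n. Qed.

(** * The extremal map *)

Section kelvin_map.
Context {R : realType} {m : nat}.
Local Notation n := m.+1.
Local Notation U := (@unit_ball R n).
Hypothesis m0 : (0 < m)%N.
Let oU := @open_unit_ball R n.

Definition pole : 'rV[R]_n := delta_mx ord0 ord0.

Let w (i : 'I_n) (x : 'rV[R]_n) : R := x ord0 i - pole ord0 i.
Let q (x : 'rV[R]_n) : R := enorm (x - pole) ^+ 2.
Let a : R := - (n%:R / 2).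
Let s (i : 'I_n) : R := if i == ord0 then -1 else 1.

(* Here [q x `^ a = |x - pole|^-n]. *)
Definition kelvin_map (x : 'rV[R]_n) : 'rV[R]_n := \row_i (s i * (w i x * q x `^ a)).

Lemma enorm_pole : enorm pole = 1.
Proof.
rewrite /enorm (bigD1 ord0)//= mxE !eqxx expr1n big1 ?addr0 ?sqrtr1// => i i0.
by rewrite mxE (negPf i0) andbF expr0n.
Qed.

Lemma pole_dist_gt0 x : U x -> 0 < enorm (x - pole).
Proof.
rewrite unit_ballE => x1; rewrite lt_def enorm_ge0 andbT; apply/eqP => /enorm_eq0.
by move/eqP; rewrite subr_eq0 => /eqP xe; move: x1; rewrite xe enorm_pole ltxx.
Qed.

Let q_gt0 x : U x -> 0 < q x.
Proof. by move=> Ux; rewrite exprn_gt0// pole_dist_gt0. Qed.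

Let qE x : q x = \sum_i w i x ^+ 2.
Proof. by rewrite /q enorm_sqr; apply: eq_bigr => i _; rewrite /w !mxE. Qed.

Let Cw d i : Cd d U (w i).
Proof. exact: (CdB oU (Cd_coord oU d i) (Cd_cst oU d _)). Qed.

Let Cq d : Cd d U q.
Proof. exact: Cd_enorm2. Qed.

Let Cqp d (b : R) : Cd d U (fun x => q x `^ b).
Proof. exact: (Cd_powR oU b q_gt0 (Cq d)). Qed.

Let partial_w k i x : partial k (w i) x = (i == k)%:R.
Proof.
apply: partial_is_derive.
have H := is_deriveB (is_derive_coord i k x) (is_derive_cst (pole ord0 i) x (delta_mx ord0 k)).
by apply: is_derive_eq H _; rewrite subr0.
Qed.

Let lap_w i x : laplacian (w i) x = 0.
Proof.
rewrite /laplacian big1// => k _.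
rewrite (_ : partial k (w i) = fun=> (i == k)%:R) ?partial_cst//.
by apply/funext => y; exact: partial_w.
Qed.

Let partial_q k x : U x -> partial k q x = 2 * w k x.
Proof.
move=> Ux; rewrite (partial_eq oU k (fun y _ => qE y) Ux).
rewrite (partial_sum oU _ _ (fun i => CdX oU 2 (Cw 1 i)) Ux).
rewrite (bigD1 k)//= big1 ?addr0 => [|i ik].
  by rewrite (partial_sqr oU k (Cw 1 k) Ux) partial_w eqxx mulr1.
by rewrite (partial_sqr oU k (Cw 1 i) Ux) partial_w (negPf ik) !mulr0.
Qed.

Let gradient_w i x : enorm (gradient (w i) x) ^+ 2 = 1.
Proof.
rewrite enorm_sqr (bigD1 i)//= mxE partial_w eqxx expr1n big1 ?addr0// => k ki.
by rewrite mxE partial_w eq_sym (negPf ki) expr0n.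
Qed.

Let lap_q x : U x -> laplacian q x = 2 * n%:R.
Proof.
move=> Ux; rewrite (eq_laplacian oU (fun y _ => qE y) Ux).
rewrite (laplacian_sum oU _ (fun i => CdX oU 2 (Cw 2 i)) Ux).
rewrite [RHS]mulrC -sum_ord_cst; apply: eq_bigr => i _.
by rewrite (laplacian_sqr oU (Cw 2 i) Ux) lap_w gradient_w !mulr0 add0r mulr1.
Qed.

Let graddot_q x : U x -> graddot q q x = 4 * q x.
Proof.
move=> Ux; rewrite qE /graddot mulr_sumr; apply: eq_bigr => k _.
by rewrite partial_q//; ring.
Qed.

Let partial_qa k x : U x -> partial k (fun y => q y `^ a) x =
  - (n%:R * (w k x * q x `^ (a - 1))).
Proof.
move=> Ux; rewrite (partial_powR a k q_gt0 (Cq 1) Ux) partial_q//.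
by rewrite /a; move: (_ `^ _) (w k x) => t z; field.
Qed.

Let qa1 x : U x -> q x `^ (a - 1) * q x = q x `^ a.
Proof. by move=> Ux; rewrite powR_mulB1// q_gt0. Qed.

Let lap_qa x : U x -> laplacian (fun y => q y `^ a) x =
  2 * n%:R * q x `^ (a - 1).
Proof.
move=> Ux; rewrite (laplacian_powR oU a q_gt0 (Cq 2) Ux) lap_q// graddot_q//.
have -> : a - 2 = a - 1 - 1 by ring.
have := powR_mulB1 (a - 1) (q_gt0 Ux); rewrite /a.
move: (q x `^ (- (n%:R / 2) - 1)) (q x `^ (- (n%:R / 2) - 1 - 1)) (q x) => t t' z <-.
by field.
Qed.

Let lap_wqa i x : U x -> laplacian (fun y => w i y * q y `^ a) x = 0.
Proof.
move=> Ux; rewrite (laplacianM oU (Cw 2 i) (Cqp 2 a) Ux) lap_qa// lap_w mulr0 addr0.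
rewrite /graddot (bigD1 i)//= big1 ?addr0 => [|k ki].
  rewrite partial_w eqxx partial_qa// mulr1n.
  by move: (n%:R : R) (w i x) (q x `^ _) => N z t; ring.
by rewrite partial_w eq_sym (negPf ki) mul0r.
Qed.

Let componentE i : component kelvin_map i = fun x => s i * (w i x * q x `^ a).
Proof. by apply/funext => x; rewrite /component mxE. Qed.

Lemma Cd_kelvin_map d i : Cd d U (component kelvin_map i).
Proof. by rewrite componentE; exact: (CdZ oU _ (CdM oU (Cw d i) (Cqp d a))). Qed.

Lemma laplacian_kelvin_map i x : U x -> laplacian (component kelvin_map i) x = 0.
Proof.
move=> Ux; rewrite componentE (laplacianZ oU _ (CdM oU (Cw 2 i) (Cqp 2 a)) Ux).
by rewrite lap_wqa// mulr0.
Qed.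

Lemma partial_kelvin_map k i x : U x -> partial k (component kelvin_map i) x =
  q x `^ a * ((i == k)%:R - n%:R * (w k x / q x) * w i x) * s i.
Proof.
move=> Ux; rewrite componentE (partialZ oU _ k (CdM oU (Cw 1 i) (Cqp 1 a)) Ux).
rewrite (partialM k (Cw 1 i) (Cqp 1 a) Ux) partial_w partial_qa// -(qa1 Ux).
have : q x != 0 by rewrite gt_eqF// q_gt0.
by move: (q x) (q x `^ (a - 1)) (w k x) (w i x) (s i) (n%:R : R) => z t w1 w2 sg N z0; field.
Qed.

Let ws_le i x : U x -> `|w i x| <= enorm (x - pole).
Proof. move=> Ux; have -> : w i x = (x - pole) ord0 i by rewrite /w !mxE.
exact: ler_coord_enorm. Qed.

Let s_norm i : `|s i| = 1.
Proof. by rewrite /s; case: ifP; rewrite ?normrN normr1. Qed.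

Lemma partial_kelvin_map_le k i x : U x ->
  `|partial k (component kelvin_map i) x| <= n.+1%:R * q x `^ a.
Proof.
move=> Ux; have q0 := q_gt0 Ux.
rewrite partial_kelvin_map// !normrM s_norm mulr1 (ger0_norm (powR_ge0 _ _)) mulrC.
rewrite ler_wpM2r ?powR_ge0//; apply: le_trans (ler_normB _ _) _.
have -> : m.+2%:R = 1 + n%:R :> R by rewrite -natr1 addrC.
rewrite lerD//; first by rewrite ger0_norm// lern1 leq_b1.
rewrite !normrM normfV ger0_norm// -!mulrA ler_piMr//.
rewrite mulrCA (ger0_norm (ltW q0)) mulrC ler_pdivrMr// mul1r mulrC /q expr2.
by apply: ler_pM => //; exact: ws_le.
Qed.

Lemma det_kelvin_map x : U x ->
  \det (\matrix_(k, i) partial k (component kelvin_map i) x) = m%:R * q x `^ a ^+ n.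
Proof.
move=> Ux; have q0 := q_gt0 Ux.
pose u : 'cV[R]_n := \col_k (- n%:R * (w k x / q x)).
pose v : 'rV[R]_n := \row_i w i x.
have -> : \matrix_(k, i) partial k (component kelvin_map i) x =
    q x `^ a *: ((1%:M + u *m v) *m diag_mx (\row_i s i)).
  apply/matrixP => k i; rewrite mxE partial_kelvin_map// mul_mx_diag !mxE big_ord1 !mxE.
  rewrite (eq_sym k).
  by move: (q x `^ a) ((i == k)%:R) (w k x / q x) (w i x) (s i) => A B C D E; ring.
rewrite detZ det_mulmx det_add1_mul det_diag.
have -> : \prod_i (\row_i0 s i0) ord0 i = -1.
  rewrite big_ord_recl mxE /s eqxx big1 ?mulr1// => i _.
  by rewrite mxE.
have -> : \det (1%:M + v *m u) = - m%:R.
  have -> : 1%:M + v *m u = (- m%:R)%:M.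
    rewrite [v *m u]mx11_scalar -raddfD/=; congr (_%:M).
    rewrite mxE (eq_bigr (fun i => (- n%:R / q x) * w i x ^+ 2)) => [|i _].
      by rewrite -mulr_sumr -qE divfK ?gt_eqF// -natr1 opprD addrCA subrr addr0.
    by rewrite !mxE; ring.
  by rewrite det_scalar expr1.
by rewrite mulrN1 opprK mulrC.
Qed.

(** Each of the [n * n] entries of the derivative is at most [n.+1 * q x]^
    a[, and the Jacobian is at least the]n[-th power of]q x [^ a] because [m >= 1]. *)
Lemma quasiregular_kelvin_map :
  quasiregular ((n%:R * (n%:R * n.+1%:R)) ^+ n) U kelvin_map.
Proof.
apply: (quasiregular_intro oU).
- rewrite exprn_ege1// -!natrM ler1n.
  by rewrite !muln_gt0.
- by move=> i; exact: Cd_kelvin_map.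
move=> x Ux; rewrite det_kelvin_map//.
set D := \matrix_(_, _) _.
have D0 : opnorm D <= n%:R * (n%:R * n.+1%:R) * q x `^ a.
  apply: le_trans (opnorm_le D) _.
  have -> : n%:R * (n%:R * n.+1%:R) * q x `^ a =
      \sum_(i < n) \sum_(k < n) (n.+1%:R * q x `^ a).
    by rewrite !sum_ord_cst !mulrA.
  by apply: ler_sum => i _; apply: ler_sum => k _; rewrite mxE partial_kelvin_map_le.
apply: (@le_trans _ _ ((n%:R * (n%:R * n.+1%:R) * q x `^ a) ^+ n)).
  by rewrite lerXn2r// nnegrE ?opnorm_ge0// !mulr_ge0// powR_ge0.
rewrite exprMn ler_wpM2l ?exprn_ge0 ?mulr_ge0//.
by rewrite ler_peMl ?exprn_ge0 ?powR_ge0// ler1n.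
Qed.

Lemma class_Ha_kelvin_map : class_Ha (fun=> 0) kelvin_map.
Proof.
split => //.
- by apply: continuous_subspaceT => x; exact: cst_continuous.
- by move=> j; exact: Cd_kelvin_map.
- by move=> x Ux; rewrite mul0r big1 ?lexx// => j _; rewrite laplacian_kelvin_map// mulr0.
Qed.

(** The squared gradient equals [|x - pole|^(-2n)] times [1 + n (n - 2) w_0^2 / q]; the lower bound
    is where [n >= 2] matters. *)
Let gradient_0 x : U x ->
  q x `^ a ^+ 2 <= enorm (gradient (component kelvin_map ord0) x) ^+ 2 <=
  n%:R * n.+1%:R ^+ 2 * q x `^ a ^+ 2.
Proof.
move=> Ux; have q0 := q_gt0 Ux; rewrite enorm_sqr; apply/andP; split; last first.
  rewrite -mulrA -exprMn -sum_ord_cst; apply: ler_sum => k _; rewrite mxE.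
  rewrite -real_normK ?num_real// lerXn2r ?nnegrE ?partial_kelvin_map_le//.
  by rewrite mulr_ge0 ?powR_ge0.
have -> : \sum_i (gradient (component kelvin_map ord0) x) ord0 i ^+ 2 =
    q x `^ a ^+ 2 * (1 + n%:R * (n%:R - 2) * (w ord0 x ^+ 2 / q x)).
  transitivity (\sum_i (q x `^ a ^+ 2 * ((i == ord0)%:R
     - 2 * n%:R * (w ord0 x / q x) * ((i == ord0)%:R * w i x)
     + n%:R ^+ 2 * (w ord0 x / q x) ^+ 2 * w i x ^+ 2))).
    apply: eq_bigr => i _; rewrite mxE partial_kelvin_map// /s eqxx eq_sym.
    case: (i == ord0) => /=; ring.
  rewrite -mulr_sumr !big_split/= sumrN -!mulr_sumr -qE; congr (_ * _).
  rewrite (bigD1 ord0)//= big1 ?addr0; last by move=> i /negPf ->.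
  rewrite [\sum_i (_ * w i x)](bigD1 ord0)//= big1 ?addr0; last first.
    by move=> i /negPf ->; rewrite mul0r.
  have : q x != 0 by rewrite gt_eqF.
  by move: (w _ _) (q x) => w1 z z0; field.
rewrite ler_peMr ?exprn_ge0 ?powR_ge0// lerDl mulr_ge0//; last first.
  by rewrite divr_ge0 ?sqr_ge0// ltW.
by rewrite mulr_ge0// subr_ge0 ler_nat.
Qed.

Let qaE x : U x -> q x `^ a = (enorm (x - pole) ^+ n)^-1.
Proof.
move=> Ux; have d0 := pole_dist_gt0 Ux; rewrite /a powRN /q -powR_mulrn ?(ltW d0)//.
by rewrite -powRrM mulrC divfK// powR_mulrn// ltW.
Qed.

Lemma enorm_kelvin_map x : U x -> enorm (kelvin_map x) = (enorm (x - pole) ^+ m)^-1.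
Proof.
move=> Ux; have d0 := pole_dist_gt0 Ux.
have -> : (enorm (x - pole) ^+ m)^-1 = enorm (x - pole) * q x `^ a.
  by rewrite qaE// exprS invfM mulrA divff ?mul1r// gt_eqF.
apply/eqP; rewrite -(eqrXn2 (n := 2)) ?enorm_ge0 ?mulr_ge0 ?powR_ge0 ?(ltW d0)//.
rewrite enorm_sqr exprMn -/(q x) {1}qE mulr_suml; apply/eqP; apply: eq_bigr => i _.
by rewrite mxE !exprMn -[s i ^+ 2]real_normK ?num_real// s_norm expr1n mul1r.
Qed.

Lemma kelvin_map0_gt0 x : U x -> 0 < component kelvin_map ord0 x.
Proof.
move=> Ux; rewrite componentE /s eqxx mulN1r -mulNr mulr_gt0 ?powR_gt0 ?q_gt0//.
rewrite oppr_gt0 subr_lt0 mxE !eqxx mulr1n; apply: le_lt_trans (ler_norm _) _.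
by apply: le_lt_trans (ler_coord_enorm x ord0) _; rewrite -unit_ballE.
Qed.

(** A positive harmonic function is its own absolute value, so the mean value inequality with
    [v = 0] bounds its means by the value at 0. *)
Lemma hardy1_kelvin_map0 : hardy 1 (scalar_map (component kelvin_map ord0)).
Proof.
pose f0 := component kelvin_map ord0.
have C0 d : Cd d U f0 := Cd_kelvin_map d ord0.
apply: (@hardy_intro R n 1 1 _ f0 (f0 0)) => //.
- by move=> i; rewrite component_scalar_map.
- by move=> x Ux; exact: Cd_continuous (C0 0) Ux.
- move=> x Ux; rewrite powRr1 ?enorm_ge0//.
  apply: le_trans (enorm_le_sum _) _; rewrite big_ord1.
  rewrite -[scalar_map _ _ _ _]/(component (scalar_map f0) ord0 x) component_scalar_map.
  by rewrite ger0_norm// ltW// kelvin_map0_gt0.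
move=> r /andP[r0 r1].
have Cf0 : Cd 2 U (fun x => f0 x - 0) := CdB oU (C0 2) (Cd_cst oU 2 0).
have sup x : U x -> laplacian (fun x => f0 x - 0) x <= 0.
  move=> Ux; rewrite (eq_laplacian oU (h := f0)) ?laplacian_kelvin_map//.
  by move=> y _; rewrite subr0.
have := superharmonic_sphere (ltn0Sn m) Cf0 sup
  (fun x Ux => Cd_continuous oU (C0 0) Ux)
  (fun x Ux => Cd_continuous oU (Cd_cst oU 0 0) Ux)
  (fun x Ux => ltW (kelvin_map0_gt0 Ux)) (fun x _ => lexx 0) r0 r1.
by rewrite integral0 adde0 subr0.
Qed.

(** The function is comparable to [|x - pole|^(-2n)]. A ball inside the unit ball cannot contain the
    pole, so its radius is at most the distance of its center to the pole; on it the distance to the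
    pole grows by a bounded factor only, and the function is at least a fixed fraction of its value
    at the center. *)
Lemma qns_kelvin_map0 :
  quasi_nearly_subharmonic U (laplacian (fun x => component kelvin_map ord0 x ^+ 2)).
Proof.
pose f0 := component kelvin_map ord0; pose psi := laplacian (fun x => f0 x ^+ 2).
have C0 d : Cd d U f0 := Cd_kelvin_map d ord0.
have cpsi x : U x -> {for x, continuous psi}.
  move=> Ux; have C2 : Cd 2 U (fun x => f0 x ^+ 2) := CdX oU 2 (C0 2).
  have Cpsi : Cd 0 U psi :=
    Cd_sum oU _ (fun k _ => CdS_partial k (CdS_partial k C2)).
  exact: Cd_continuous Cpsi Ux.
have psiE x : U x -> psi x = 2 * enorm (gradient f0 x) ^+ 2.
  move=> Ux; rewrite /psi (laplacian_sqr oU (C0 2) Ux) laplacian_kelvin_map//.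
  by rewrite !mulr0 add0r.
have psi0 x : U x -> 0 <= psi x by move=> Ux; rewrite psiE// mulr_ge0// sqr_ge0.
(* [N] is the upper constant of [gradient_0]; [c] comes from the factor [2 n] between the distances
   to the pole, raised to the power [-2n]. *)
pose N : R := n%:R * n.+1%:R ^+ 2; pose c : R := (((2 * n%:R) ^+ n)^-1) ^+ 2.
have N0 : 0 < N by rewrite mulr_gt0// exprn_gt0.
have c0 : 0 < c by rewrite exprn_gt0// invr_gt0 exprn_gt0// mulr_gt0.
split => //; first exact: (continuous_locally_Lp oU ler01 cpsi).
exists (N / c); first by rewrite divr_gt0.
move=> x r r0 xrU.
have Ux : U x by apply: xrU; rewrite /eball/= subrr enorm0.
have rd : r <= enorm (x - pole).
  rewrite leNgt; apply/negP => dr; have /xrU : eball x r pole.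
    by rewrite /eball/= -opprB -scaleN1r enormZ normrN1 mul1r.
  by rewrite unit_ballE enorm_pole ltxx.
have psiL y : eball x r y -> c / N * psi x <= psi y.
  move=> xry; have Uy := xrU y xry; have d0 := pole_dist_gt0 Ux.
  have dy : enorm (y - pole) <= 2 * n%:R * enorm (x - pole).
    have -> : y - pole = (y - x) + (x - pole) by rewrite addrA subrK.
    apply: le_trans (enorm_leD _ _) _; rewrite [2 * _]mulrC -mulrA ler_wpM2l//.
    rewrite mulr2n mulrDl mul1r lerD2r; apply: le_trans rd; exact: ltW.
  have /andP[_ h1] := gradient_0 Ux; have /andP[h2 _] := gradient_0 Uy.
  rewrite !psiE// mulrCA ler_pM2l//.
  apply: le_trans h2; apply: (@le_trans _ _ (c * q x `^ a ^+ 2)).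
    rewrite -mulrA ler_pM2l// ler_pdivrMl//; exact: h1.
  have dy0 := pole_dist_gt0 Uy.
  rewrite !qaE// /c -exprMn lerXn2r ?nnegrE ?mulr_ge0 ?invr_ge0 ?exprn_ge0 ?mulr_ge0 ?enorm_ge0//.
  rewrite -invfM -exprMn lef_pV2 ?posrE ?exprn_gt0 ?mulr_gt0//.
  by rewrite lerXn2r// nnegrE ?enorm_ge0// !mulr_ge0 ?enorm_ge0.
have mB : measurable (eball x r).
  apply: open_measurable_rV.
  have -> : eball x r = (fun y => enorm (y - x)) @^-1` [set t | t < r] by [].
  apply: open_comp; last exact: open_lt.
  move=> y _; have cx : {for y, continuous (fun z : 'rV[R]_n => z - x)}.
    by apply: continuousB => //; exact: cst_continuous.
  exact: (continuous_comp cx (@enorm_continuous R n (y - x))).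
have vB : normalized_volume n (eball x r) = (r ^+ n)%:E.
  have := affine_lebesgue_rV x r0 mB.
  have -> : [set y | eball x r (x + r *: y)] = U.
    apply/seteqP; split=> y /=; rewrite unit_ballE /eball/= addrAC subrr add0r enormZ gtr0_norm//.
      by rewrite -{2}[r]mulr1 ltr_pM2l.
    by rewrite -{2}[r]mulr1 ltr_pM2l.
  rewrite volE => vE.
  have -> : normalized_volume n (eball x r) = ((@vol R n)^-1%:E * lebesgue_rV n (eball x r))%E.
    by [].
  have -> : lebesgue_rV n (eball x r) = (r ^+ n * @vol R n)%:E.
    by rewrite EFinM vE muleA -EFinM divff ?mul1e// gt_eqF// exprn_gt0.
  by rewrite -EFinM mulrCA mulVf ?mulr1// gt_eqF// vol_gt0.
apply: (@le_trans _ _ ((N / c / r ^+ n)%:E *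
    \int[normalized_volume n]_(y in eball x r) (c / N * psi x)%:E)%E).
  rewrite integral_cst// -[X in (_ * (_ * X))%E]/(normalized_volume n (eball x r)) vB -!EFinM lee_fin le_eqVlt; apply/orP; left; apply/eqP.
  have alg (P M d t : R) : 0 < M -> 0 < d -> 0 < t ->
      P = M / d / t * (d / M * P * t).
    by move=> M0 d0 t0; field; rewrite !gt_eqF.
  exact: (alg (psi x) N c (r ^+ n) N0 c0 (exprn_gt0 _ r0)).
apply: lee_wpmul2l; first by rewrite lee_fin !divr_ge0 ?ltW// exprn_gt0.
apply: ge0_le_integral => //.
- by move=> y _; rewrite lee_fin mulr_ge0 ?psi0 ?divr_ge0 ?(ltW c0) ?(ltW N0).
- apply/measurable_EFinP; apply: measurable_funS (continuous_measurable_rV oU cpsi) => //.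
  exact: open_measurable_rV.
Qed.

End kelvin_map.

(** * A logarithmically divergent integral *)

Section singular_kernel.
Context {R : realType} {m : nat}.
Hypothesis m0 : (0 < m)%N.
Local Notation leb := (@lebesgue_rV R m).
Local Notation ball r := (@oball R m r).

(** With [e = 1 - r], a lower bound for [|kelvin_map|] near the pole on the sphere of radius [r], in
    terms of the coordinates [y] other than the first; the 8 is the constant of [cone_pole_dist]. *)
Definition singular_kernel (e : R) (y : 'rV[R]_m) : R := ((8 * (e + enorm y)) ^+ m)^-1.

Lemma singular_kernel_ge0 e y : 0 <= e -> 0 <= singular_kernel e y.
Proof. by move=> e0; rewrite invr_ge0 exprn_ge0// mulr_ge0// addr_ge0// enorm_ge0. Qed.

Lemma measurable_singular_kernel e : 0 < e -> measurable_fun setT (singular_kernel e).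
Proof.
move=> e0; have -> : singular_kernel e = fun y => (8 * (e + enorm y)) `^ (- m%:R).
  apply/funext => y; rewrite powRN powR_mulrn//.
  by rewrite mulr_ge0// addr_ge0 ?enorm_ge0// ltW.
apply: (measurableT_comp (measurable_powR _)); apply: measurable_funM => //.
by apply: measurable_funD => //; exact: measurable_enorm.
Qed.

Definition singular_integral (e : R) : \bar R :=
  (\int[leb]_(y in ball 2^-1) (singular_kernel e y)%:E)%E.

Lemma singular_kernel_scale e y : 0 < e ->
  singular_kernel e (2^-1 *: y) = 2 ^+ m * singular_kernel (2 * e) y.
Proof.
move=> e0; rewrite /singular_kernel enormZ ger0_norm//.
have -> : 8 * (2 * e + enorm y) = 2 * (8 * (e + 2^-1 * enorm y)) by field.
by move: (8 * _) => t; rewrite exprMn invfM mulrA divff ?mul1r// expf_neq0.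
Qed.

(** The kernel is homogeneous of degree [- m] in [e] and [y] jointly, which exactly offsets the
    Jacobian of the dilation. *)
Lemma singular_integral_half e : 0 < e ->
  (\int[leb]_(y in ball (2^-1 / 2)) (singular_kernel e y)%:E =
   singular_integral (2 * e))%E.
Proof.
move=> e0.
have mb (r : R) : measurable (ball r) by exact: measurable_oball.
have mk (e' : R) : 0 < e' -> measurable_fun setT (fun y => (singular_kernel e' y)%:E).
  by move=> e'0; apply/measurable_EFinP; exact: measurable_singular_kernel.
have mF : measurable_fun setT ((fun y => (singular_kernel e y)%:E) \_ (ball (2^-1 / 2))).
  apply/(measurable_restrictT _ (mb _)); apply: measurable_funTS; exact: mk.
have F0 x : (0 <= ((fun y => (singular_kernel e y)%:E) \_ (ball (2^-1 / 2))) x)%E.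
  by apply: erestrict_ge0 => y _; rewrite lee_fin singular_kernel_ge0// ltW.
have h2 : 0 < 2^-1 :> R by [].
have := ge0_integral_affine 0 h2 mF F0.
have -> : (\int[leb]_y ((fun z => (singular_kernel e z)%:E) \_ (ball (2^-1 / 2)))
     (0 + 2^-1 *: y)%R)%E = (
    (2 ^+ m)%:E * singular_integral (2 * e))%E.
  rewrite /singular_integral -ge0_integralZl//; last 2 first.
  - by apply: measurable_funTS; apply: mk; rewrite mulr_gt0.
  - by move=> y _; rewrite lee_fin singular_kernel_ge0// mulr_ge0// ltW.
  rewrite [RHS]integral_mkcond; apply: eq_integral => y _.
  rewrite !patchE add0r.
  have -> : (2^-1 *: y \in ball (2^-1 / 2)) = (y \in ball 2^-1).
    apply/idP/idP; rewrite !inE /oball/= enormZ ger0_norm// [_ / 2]mulrC.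
      by rewrite ltr_pM2l.
    by rewrite ltr_pM2l.
  by case: ifP => // _; rewrite singular_kernel_scale.
rewrite -[in RHS]integral_mkcond exprVn invrK => /(congr1 (fun t => ((2 ^+ m)^-1%:E * t)%E)).
by rewrite !muleA -!EFinM mulVf ?mul1e// expf_neq0.
Qed.

(* Scaling by [1/2] maps the integral over the whole ball to that over the half
   ball, so each halving of [e] adds the contribution of the shell. *)
Lemma singular_integral_step : exists k : R, 0 < k /\
  forall e : R, 0 < e -> e <= 2^-1 ->
  (singular_integral (2 * e) + k%:E <= singular_integral e)%E.
Proof.
have mb (r : R) : measurable (ball r) by exact: measurable_oball.
pose A := ball 2^-1 `\` ball (2^-1 / 2).
have mA : measurable A by exact: measurableD.
have sub : ball (2^-1 / 2) `<=` ball 2^-1.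
  by move=> y /= yb; apply: lt_le_trans yb _; lra.
have h2 : 0 < 2^-1 :> R by [].
have h4 : 0 < 2^-1 / 2 :> R by rewrite divr_gt0.
have [x [x0 Ax]] : exists x : R, 0 < x /\ leb A = x%:E.
  have : (leb (ball 2^-1) = leb A + leb (ball (2^-1 / 2)))%E.
    have := measureDI leb (mb 2^-1) (mb (2^-1 / 2)); rewrite setIidr//.
  rewrite !lebesgue_oball//.
  have : (leb A < +oo)%E.
    apply: le_lt_trans (@oball_lebesgue_lty R m 2^-1).
    by apply: le_measure; rewrite ?inE//; exact: subDsetl.
  have := measure_ge0 leb A.
  case: (leb A) => // x _ _ [] E; exists x; split => //.
  have : (2^-1 / 2) ^+ m * @vol R m < 2^-1 ^+ m * @vol R m.
    rewrite ltr_pM2r ?vol_gt0// ltrXn2r ?nnegrE ?(ltW h4) ?(ltW h2)//; last by lra.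
    by rewrite -lt0n.
  by rewrite E ltrDr.
(* On the shell [A], of measure [x], one has [e + |y| <= 1], so the kernel is at least [8 ^- m]
   there. *)
exists ((8 ^+ m)^-1 * x); split; first by rewrite mulr_gt0// invr_gt0 exprn_gt0.
move=> e e0 e2; rewrite -singular_integral_half//.
have -> : singular_integral e = (\int[leb]_(y in ball (2^-1 / 2) `|` A) (singular_kernel e y)%:E)%E.
  by rewrite /A setDUK.
rewrite ge0_integral_setU//; last 3 first.
- by apply: measurable_funTS; apply/measurable_EFinP; exact: measurable_singular_kernel.
- by move=> y _; rewrite lee_fin singular_kernel_ge0// ltW.
- by apply/disj_setPS => y [? []].
rewrite leeD2l// EFinM -Ax -integral_cst//; apply: ge0_le_integral => //.
- by move=> y _; rewrite lee_fin invr_ge0 exprn_ge0.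
- by apply: measurable_funTS; apply/measurable_EFinP; exact: measurable_singular_kernel.
move=> y [yb _]; rewrite lee_fin /singular_kernel.
have ey : 0 < e + enorm y by rewrite ltr_pwDl// enorm_ge0.
rewrite lef_pV2 ?posrE ?exprn_gt0 ?mulr_gt0// lerXn2r ?nnegrE ?mulr_ge0 ?(ltW ey)//.
by move: yb; rewrite /oball/=; lra.
Qed.

(** Each halving of [e], starting from one half, adds at least the same [k]. *)
Lemma singular_integral_unbounded (B : R) :
  exists e : R, 0 < e < 1 /\ (B%:E < singular_integral e)%E.
Proof.
have [k [k0 Hk]] := singular_integral_step.
have I0 (e : R) : 0 < e -> (0 <= singular_integral e)%E.
  by move=> e0; apply: integral_ge0 => y _; rewrite lee_fin singular_kernel_ge0// ltW.
have H (j : nat) : ((j%:R * k)%:E <= singular_integral (2^-1 ^+ j.+1))%E.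
  elim: j => [|j IH]; first by rewrite mul0r I0// exprn_gt0.
  apply: le_trans (Hk _ _ _); last 2 first.
  - by rewrite exprn_gt0.
  - by rewrite exprS ler_piMr// exprn_ile1// invf_le1// ler1n.
  rewrite [2^-1 ^+ j.+2]exprS mulrA divff// mul1r.
  by rewrite -natr1 mulrDl mul1r EFinD leeD2r.
have [j jB] : exists j : nat, B < j%:R * k.
  exists (Num.truncn (B / k)).+1; rewrite -ltr_pdivrMr//.
  exact: truncnS_gt.
exists (2^-1 ^+ j.+1); split; last by apply: lt_le_trans (H j); rewrite lte_fin.
by rewrite exprn_gt0//= exprn_ilt1// invf_lt1// ltr1n.
Qed.

End singular_kernel.

(** * Unboundedness of the means of the extremal map *)

Section kelvin_not_hardy.
Context {R : realType} {m : nat}.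
Hypothesis m0 : (0 < m)%N.
Local Notation n := m.+1.
Local Notation U := (@unit_ball R n).
Local Notation S := (@unit_sphere R n).
Local Notation km := (@kelvin_map R m).
Local Notation T := [set t : R | (4^-1 < t < 2^-1)%R].

Definition tail_rV (x : 'rV[R]_n) : 'rV[R]_m := \row_j x ord0 (lift ord0 j).

Lemma tail_cons_rV t (y : 'rV[R]_m) : tail_rV (cons_rV (t, y)) = y.
Proof. by apply/rowP => j; rewrite !mxE liftK. Qed.

Lemma head_cons_rV t (y : 'rV[R]_m) : cons_rV (t, y) ord0 ord0 = t :> R.
Proof. by rewrite mxE unlift_none. Qed.

Lemma measurable_tail_rV : measurable_fun setT tail_rV.
Proof.
apply: measurable_fun_rV => i.
rewrite (_ : (fun _ => _) = rV_coord (lift ord0 i)); first exact: measurable_rV_coord.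
by apply/funext => x; rewrite mxE.
Qed.

Lemma enorm_sqr_tail (x : 'rV[R]_n) :
  enorm x ^+ 2 = x ord0 ord0 ^+ 2 + enorm (tail_rV x) ^+ 2.
Proof.
rewrite !enorm_sqr big_ord_recl; congr (_ + _); apply: eq_bigr => i _.
by rewrite mxE.
Qed.

Lemma cone_unit_ball (x : 'rV[R]_n) : T (x ord0 ord0) -> oball 2^-1 (tail_rV x) ->
  U x.
Proof.
rewrite /oball/= => /andP[t0 t1] y1; rewrite unit_ballE.
rewrite -(@ltr_pXn2r _ 2)// ?nnegrE ?enorm_ge0// enorm_sqr_tail expr1n.
have y0 := enorm_ge0 (tail_rV x); nra.
Qed.

(** With [c] and [z] the cosine and sine of the angle between [x] and the pole, the distance is at
    most [(1 - r c) + r z]. Since [p <= t + y] gives [1 - c <= z], this is at most [1 - r + 2 z];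
    and [p > 1/4] gives [z <= 4 y]. *)
Lemma cone_pole_dist (x : 'rV[R]_n) (r : R) : 0 < r < 1 -> T (x ord0 ord0) ->
  enorm (r *: radial x - pole) <= 8 * (1 - r + enorm (tail_rV x)).
Proof.
move=> /andP[r0 r1] /andP[t0 t1]; set t := x ord0 ord0 in t0 t1; set y := enorm (tail_rV x).
have y0 : 0 <= y by exact: enorm_ge0.
set p := enorm x; have p2 : p ^+ 2 = t ^+ 2 + y ^+ 2 by exact: enorm_sqr_tail.
have tp : t <= p.
  by apply: le_trans (ler_norm _) _; exact: ler_coord_enorm.
have p0 : 0 < p by lra.
have pty : p <= t + y.
  rewrite -(@ler_pXn2r _ 2)// ?nnegrE ?(ltW p0) ?addr_ge0//; last by lra.
  rewrite p2; nra.
rewrite -(@ler_pXn2r _ 2)// ?nnegrE ?enorm_ge0//; last by rewrite mulr_ge0//; lra.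
rewrite enorm_sqr_tail.
have -> : (r *: radial x - pole) ord0 ord0 = r * (t / p) - 1.
  by rewrite !mxE !eqxx mulr1n [t / p]mulrC.
have -> : enorm (tail_rV (r *: radial x - pole)) = r * (y / p).
  have -> : tail_rV (r *: radial x - pole) = (r * p^-1) *: tail_rV x.
    apply/rowP => j; rewrite !mxE eq_sym (negPf (neq_lift _ _)) andbF subr0.
    by rewrite mulrA.
  by rewrite enormZ ger0_norm ?mulr_ge0 ?invr_ge0 ?(ltW r0) ?(ltW p0)// mulrAC -mulrA.
set c := t / p; set z := y / p.
have c1 : c <= 1 by rewrite ler_pdivrMr// mul1r.
have c0 : 0 <= c by rewrite divr_ge0 ?(ltW p0)//; lra.
have z0 : 0 <= z by rewrite divr_ge0 ?(ltW p0).
have cz : 1 - c <= z.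
  rewrite lerBlDl /c /z -mulrDl ler_pdivlMr// mul1r//.
have zy : z <= 4 * y.
  by rewrite ler_pdivrMr//; nra.
have A1 : 1 - r * c <= 1 - r + z by nra.
have A0 : 0 <= 1 - r * c by nra.
have B1 : r * z <= z by nra.
have B0 : 0 <= r * z by nra.
have -> : (r * c - 1) ^+ 2 = (1 - r * c) ^+ 2 by ring.
apply: (@le_trans _ _ ((1 - r * c + r * z) ^+ 2)); first by nra.
have P1 : 0 <= 1 - r * c + r * z by lra.
have P2 : 0 <= 8 * (1 - r + y) by lra.
by rewrite lerXn2r ?nnegrE//; lra.
Qed.

(** Since the surface measure comes from cones, the sphere integral is a volume integral, bounded
    below by its part over a cylinder with axis through the pole. The lower bound there does not
    depend on the first coordinate, so Tonelli's theorem leaves the length 1/4 of [T] times the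
    singular integral in the other coordinates. *)
Lemma kelvin_map_sphere_integral (r : R) : 0 < r < 1 ->
  ((@vol R n)^-1%:E * (4^-1%:E * @singular_integral R m (1 - r)) <=
   \int[sphere_measure n]_(z in S) (enorm (km (r *: z)) `^ 1)%:E)%E.
Proof.
move=> r01; have /andP[r0 r1] := r01; have e0 : 0 < 1 - r by rewrite subr_gt0.
have r01' : 0 <= r < 1 by rewrite (ltW r0).
have mU := @measurable_unit_ball R n.
have oU := @open_unit_ball R n.
have mkm : measurable_fun U (fun x => enorm (km x) `^ 1).
  apply: measurable_enorm_powR; apply: measurable_fun_rV => i.
  apply: continuous_measurable_rV => // x Ux.
  exact: (Cd_continuous oU (Cd_kelvin_map 0 i) Ux).
pose F (z : 'rV[R]_n) := (enorm (km (r *: z)) `^ 1)%:E.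
have mF : measurable_fun S F.
  by apply/measurable_EFinP; exact: (measurable_sphere_comp mkm r01').
have F0 z : (0 <= F z)%E by rewrite lee_fin powR_ge0.
rewrite (ge0_integral_sphere mF (fun z _ => F0 z)).
apply: lee_wpmul2l; first by rewrite lee_fin invr_ge0 ltW// vol_gt0.
pose h (y : 'rV[R]_m) : R := \1_(oball 2^-1) y * singular_kernel (1 - r) y.
pose G (x : 'rV[R]_n) : \bar R := (\1_T (x ord0 ord0) * h (tail_rV x))%:E.
have mT : measurable (T : set (measurableTypeR R)).
  rewrite (_ : T = `]4^-1, 2^-1[%classic); first exact: measurable_itv.
  by apply/seteqP; split=> t /=; rewrite in_itv.
have mh : measurable_fun setT h.
  apply: measurable_funM; last exact: measurable_singular_kernel.
  by apply: measurable_indic; exact: measurable_oball.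
have h0 y : 0 <= h y.
  by rewrite mulr_ge0// singular_kernel_ge0// ltW.
have mG : measurable_fun setT G.
  apply/measurable_EFinP; apply: measurable_funM.
    apply: (measurableT_comp (f := (\1_T : measurableTypeR R -> R))).
      exact: measurable_indic.
    exact: (measurable_rV_coord ord0).
  exact: (measurableT_comp mh measurable_tail_rV).
have G0 x : (0 <= G x)%E by rewrite lee_fin mulr_ge0.
have intG : (\int[lebesgue_rV n]_x G x = 4^-1%:E * @singular_integral R m (1 - r))%E.
  rewrite ge0_integral_rVS//.
  have inth : (\int[lebesgue_rV m]_y (h y)%:E = @singular_integral R m (1 - r))%E.
    rewrite /singular_integral [RHS]integral_mkcond; apply: eq_integral => y _.
    rewrite patchE /h indicE; case: ifP => _; by rewrite ?mul1r ?mul0r.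
  have inner t : (\int[lebesgue_rV m]_y G (cons_rV (t, y)) =
      (\1_T t)%:E * @singular_integral R m (1 - r))%E.
    rewrite -inth -ge0_integralZl//.
    - by apply: eq_integral => y _; rewrite /G head_cons_rV tail_cons_rV EFinM.
    - exact/measurable_EFinP.
    - by move=> y _; rewrite lee_fin.
  under eq_integral do rewrite inner.
  have mTE : measurable_fun setT (fun t : measurableTypeR R => (\1_T t : R)%:E).
    by apply/measurable_EFinP; exact: measurable_indic.
  rewrite ge0_integralZr//; last first.
  - by rewrite -inth; apply: integral_ge0 => y _; rewrite lee_fin.
  rewrite integral_indic// setIT (_ : T = `]4^-1, 2^-1[%classic); last first.
    by apply/seteqP; split=> t /=; rewrite in_itv.
  congr (_ * _)%E; apply: etrans (lebesgue_measure_itv _) _.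
  by rewrite /= lte_fin ifT -?EFinB; [congr (_%:E); field|lra].
have GU x : ~ (U `\ 0%R) x -> G x = 0%E.
  move=> Ux; rewrite /G /h !indicE.
  have [/[!inE] xT|] := boolP (_ \in T); last by rewrite mul0r.
  have [/[!inE] xb|] := boolP (_ \in oball _); last by rewrite mul0r mulr0.
  exfalso; apply: Ux; split; first exact: cone_unit_ball.
  by move=> x0; move: xT; rewrite x0 mxE /= => /andP[]; lra.
rewrite -intG (integral_support _ (subsetT (U `\ 0%R)) GU).
have mU0 : measurable (U `\ (0 : 'rV[R]_n)).
  apply: measurableD => //; apply: closed_measurable_rV; apply: accessible_closed_set1.
  by apply: hausdorff_accessible; exact: norm_hausdorff.
have rU (x : 'rV[R]_n) : U (r *: radial x).
  apply: (cball_unit_ball r1); rewrite /cball/= enormZ ger0_norm ?(ltW r0)//.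
  by rewrite -[leRHS]mulr1 ler_wpM2l ?(ltW r0)// enorm_radial_le1.
have mFr : measurable_fun (U `\ (0 : 'rV[R]_n)) (fun x => F (radial x)).
  have mr : measurable_fun (U `\ (0 : 'rV[R]_n)) (@radial R n).
    by apply: measurable_funTS; exact: measurable_radial.
  apply: (measurable_comp (@measurable_unit_sphere R n) _ mF mr).
  by move=> _ [x [_ /eqP x0] <-]; exact: enorm_radial.
apply: ge0_le_integral; [exact: mU0|by move=> x _; exact: G0| |exact: mFr|].
  exact: (measurable_funTS mG).
move=> x _; rewrite /G /F /h lee_fin !indicE powRr1 ?enorm_ge0//.
have [/[!inE] xT|_] := boolP (_ \in T); last by rewrite mul0r enorm_ge0.
rewrite mul1r; have [_|_] := boolP (_ \in _); last by rewrite mul0r enorm_ge0.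
rewrite mul1r enorm_kelvin_map// /singular_kernel.
have d0 := pole_dist_gt0 (rU x); have dx := cone_pole_dist r01 xT.
rewrite lef_pV2 ?posrE ?exprn_gt0//; last exact: lt_le_trans dx.
by rewrite lerXn2r// nnegrE ?(ltW d0)// (le_trans (ltW d0)).
Qed.

Lemma kelvin_map_not_hardy1 : ~ hardy 1 km.
Proof.
move=> /(hardy_bounded ltr01)[B HB].
have v0 := @vol_gt0 R n.
have [e [/andP[e0 e1] Be]] := singular_integral_unbounded m0 (4 * (@vol R n * B)).
have r01 : 0 < 1 - e < 1 by apply/andP; split; lra.
have := le_trans (kelvin_map_sphere_integral r01) (HB _ r01).
rewrite leNgt => /negP; apply; rewrite subKr.
have -> : B%:E = ((@vol R n)^-1%:E * (4^-1%:E * (4 * (@vol R n * B))%:E))%E.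
  by rewrite -!EFinM; congr (_%:E); field; rewrite gt_eqF.
rewrite lte_pmul2l// ?lte_fin ?invr_gt0// lte_pmul2l// lte_fin//.
Qed.

End kelvin_not_hardy.

Theorem theorem1p4 (R : realType) (n : nat) (hn : (2 <= n)%N) :
  (forall (K : R) (a : 'rV[R]_n -> R) (f : 'rV[R]_n -> 'rV[R]_n) (j : 'I_n),
     riesz_setting K a f j ->
     forall p : R, 1 < p ->
       hardy p (scalar_map (component f j)) -> hardy p f) /\
  (exists (K : R) (a : 'rV[R]_n -> R) (f : 'rV[R]_n -> 'rV[R]_n) (j : 'I_n),
     [/\ riesz_setting K a f j,
         hardy 1 (scalar_map (component f j)) &
         ~ hardy 1 f]).
Proof.
split; first by move=> K a f j H p; exact: riesz_hardy H.
case: n hn => [//|m]; rewrite ltnS => m0.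
exists ((m.+1%:R * (m.+1%:R * m.+2%:R)) ^+ m.+1), (fun=> 0), (@kelvin_map R m), ord0.
split; last 2 first.
- exact: hardy1_kelvin_map0.
- exact: kelvin_map_not_hardy1.
split.
- exact: class_Ha_kelvin_map.
- exact: quasiregular_kelvin_map.
- apply: le_lt_trans (ltry (0 : R)); apply: ge_ereal_sup => _ [x _ <-].
  by rewrite lexx.
- by move=> x Ux; rewrite laplacian_kelvin_map// mulr0.
- exact: qns_kelvin_map0.
Qed.
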